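(* Let $n\ge1$, $N=2n$, $q\in(0,1)$, $a\in\mathbb R_{>0}^n$. Let $\mathbf Z=(\mathbf Z(t),t\ge0)$ be the process on $\mathbb K_0^N$ evolving either according to the $q$-deformed Berele dynamics or according to the fully randomised dynamics (both described in the context), and suppose that $\mathbf Z$ starts at the origin (all coordinates equal to $0$). Assume hypothesis (C): for every $n\ge 1$ and every $z\in\mathcal W_0^n$, the Laurent polynomial $\mathcal P^{(n)}_z(\cdot;q)$ coincides with the $q$-deformed $\mathfrak{so}_{2n+1}$-Whittaker function $P^{(n)}_z(\cdot;q)$. Then, for $t\ge0$ and $\mathbf z\in\mathbb K_0^N$, $$\mathbb P(\mathbf Z(t)=\mathbf z)=\frac{w^N_{a,q}(\mathbf z)\,Q^{(n)}_{z^N}(t;q)}{\Pi(a;t)}.$$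
   Context: **Patterns.** $\mathcal W_0^n=\Lambda_n=\{z\in\mathbb Z^n:z_1\ge\dots\ge z_n\ge0\}$. $\mathbb K_0^{2n}$ is the set of $\mathbf z=(z^1,\dots,z^{2n})$, $z^{2l-1},z^{2l}\in\mathbb Z_{\ge0}^l$, with $z^{2l}_{i+1}\le z^{2l-1}_i\le z^{2l}_i$ ($1\le i\le l$, $z^{2l}_{l+1}:=0$) and $z^{2l+1}_{i+1}\le z^{2l}_i\le z^{2l+1}_i$ ($1\le i\le l$). $|z|=\sum z_i$, $|z^0|=0$. $(x;q)_m=\prod_{k=0}^{m-1}(1-xq^k)$, $(x;q)_\infty=\prod_{k\ge0}(1-xq^k)$, $(x_1,\dots,x_r;q)_\infty=\prod_j(x_j;q)_\infty$, $\binom mk_q=\frac{(q;q)_m}{(q;q)_k(q;q)_{m-k}}$. **Weights.** $w^{2n}_{a,q}(\mathbf z)=\prod_{k=1}^na_k^{2|z^{2k-1}|-|z^{2k-2}|-|z^{2k}|}\prod_{i=1}^{k-1}\binom{z^{2k-1}_i-z^{2k-1}_{i+1}}{z^{2k-1}_i-z^{2k-2}_i}_q\binom{z^{2k}_i-z^{2k}_{i+1}}{z^{2k}_i-z^{2k-1}_i}_q\binom{z^{2k}_k}{z^{2k}_k-z^{2k-1}_k}_q$, and $\mathcal P_z^{(n)}(a;q)=\sum_{\mathbf z\in\mathbb K_0^{2n}:z^{2n}=z}w^{2n}_{a,q}(\mathbf z)$ (a Laurent polynomial in $a$). **$q$-deformed $\mathfrak{so}_{2n+1}$-Whittaker functions.**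 $P^{(n)}_\lambda(\cdot;q)$, $\lambda\in\Lambda_n$, is the unique Laurent polynomial, invariant under permutations and inversions of its variables, with coefficients rational in $q$, such that $P_\lambda^{(n)}=m_\lambda+\sum_{\mu\in\Lambda_n,\mu<\lambda}c_{\lambda,\mu}m_\mu$, with $m_\lambda(a)=\sum_{\mu\in W_n\lambda}\prod_ja_j^{\mu_j}$ ($W_n\lambda$ the orbit under signed permutations), $<$ the dominance order ($\mu\le\lambda$ iff $\mu_1+\dots+\mu_i\le\lambda_1+\dots+\lambda_i$ for all $i$), and orthogonal for $\langle f,g\rangle_{\hat\Delta^{(n)}}=\frac1{(2\pi\mathrm i)^nn!}\int_{\mathbb T^n}f\,\overline g\,\hat\Delta^{(n)}\prod_j\frac{db_j}{b_j}$, $\mathbb T^n=\{|b_j|=1\}$, $\hat\Delta^{(n)}(b)=\prod_j(b_j^2,b_j^{-2};q)_\infty\prod_{j<k}(b_jb_k,b_j^{-1}b_k,b_jb_k^{-1},b_j^{-1}b_k^{-1};q)_\infty$. **Other quantities.** $\Pi(a;t)=e^{\sum_{i=1}^n(a_i+a_i^{-1})t}$, $Q^{(n)}_z(t;q)=\langle\Pi(\cdot;t),\mathcal P^{(n)}_z(\cdot;q)\rangle_{\hat\Delta^{(n)}}/\langle\mathcal P^{(n)}_z(\cdot;q),\mathcal P^{(n)}_z(\cdot;q)\rangle_{\hat\Delta^{(n)}}$. **$q$-deformed Berele dynamics.** Put $r_i(y;x)=q^{y_i-x_i}\frac{1-q^{x_{i-1}-y_i}}{1-q^{x_{i-1}-x_i}}$,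 $l_i(y;x)=q^{x_i-y_{i+1}}\frac{1-q^{y_{i+1}-x_{i+1}}}{1-q^{x_i-x_{i+1}}}$ (the $0$-th coordinate of a vector is $+\infty$, the coordinate one past the last is $0$). Only right-edge particles attempt jumps on their own, one step right, with independent exponential clocks: $Z^{2l-1}_1$ at rate $a_l$, $Z^{2l}_1$ at rate $a_l^{-1}$. Moves propagate instantaneously downwards, probabilities being evaluated just before the jump time. Rightward attempt by $Z^k_i$, $k<2n$ (own or triggered): if $k$ is odd and $i=\frac{k+1}2$, then with probability $r_i(Z^{k+1};Z^k)$ it is performed and triggers a rightward attempt of $Z^{k+1}_i$, otherwise it is suppressed and $Z^{k+1}_i$ performs a left jump; for all other particles it is performed and triggers a rightward attempt of $Z^{k+1}_i$ with probability $r_i(Z^{k+1};Z^k)$, of $Z^{k+1}_{i+1}$ otherwise. At level $2n$ it is simply performed. A left jump of $Z^k_i$, $k<2n$, triggers a left jump of $Z^{k+1}_{i+1}$ with probability $l_i(Z^{k+1};Z^k)$, of $Z^{k+1}_i$ otherwise. **Fully randomised dynamics.** With $\bar a_{2l}=a_l^{-1}$, $\bar a_{2l-1}=a_l$, each $Z^k_j$ independently jumps one step right at rate $\bar a_k(1-q^{Z^{k-1}_{j-1}-Z^k_j})\frac{1-q^{Z^k_j-Z^k_{j+1}+1}}{1-q^{Z^k_j-Z^{k-1}_j+1}}$ and one step left at rate $\bar a_k^{-1}(1-q^{Z^k_j-Z^{k-1}_j})\frac{1-q^{Z^k_{j-1}-Z^k_j+1}}{1-q^{Z^{k-1}_{j-1}-Z^k_j+1}}$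 ($Z^k_0=+\infty$, $Z^k_{[\frac{k+1}2]+1}=0$ for all $k\ge0$). If $Z^k_j=Z^{k+1}_j$ and $Z^k_j$ jumps right, $Z^{k+1}_j$ is simultaneously pushed right; if $Z^k_j=Z^{k+1}_{j+1}$ and $Z^k_j$ jumps left, $Z^{k+1}_{j+1}$ is simultaneously pushed left (and so on down the levels). *)

(* Defs.v *)
From HB Require Import structures.
From mathcomp Require Import all_boot all_order all_algebra all_fingroup.
From mathcomp Require Import complex.
From mathcomp Require Import all_classical all_reals all_analysis.

Set Implicit Arguments.
Unset Strict Implicit.
Unset Printing Implicit Defensive.

Import Order.TTheory GRing.Theory Num.Theory numFieldNormedType.Exports.

Local Open Scope classical_set_scope.
Local Open Scope ring_scope.
Local Open Scope complex_scope.

(* An array z lists its levels z^1, z^2, ...; levels and coordinates are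
   numbered from 1. The level z^0 is empty, and a coordinate one past the last
   is 0. The convention z^k_0 = +oo is NOT carried by entry: see qgap. *)
Definition array := seq (seq nat).

Definition level (z : array) (k : nat) : seq nat := nth [::] ([::] :: z) k.

Definition entry (z : array) (k i : nat) : nat := nth 0%N (0%N :: level z k) i.

(* The two families of interlacing inequalities (odd-even and even-odd levels)
   have the same form when indexed by the upper level k, which has
   (k.+1)./2 coordinates. *)
Definition is_pattern (n : nat) (z : array) : bool :=
  (shape z == [seq (k.+1)./2 | k <- iota 1 n.*2]) &&
  all (fun k => all (fun i => (entry z k.+1 i.+1 <= entry z k i <= entry z k.+1 i)%N)
                    (iota 1 (k.+1)./2))
      (iota 1 (n.*2).-1).

Definition pattern (n : nat) := {z : array | is_pattern n z}.

Definition is_partition (lam : seq nat) : bool := sorted geq lam.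

Section QAnalogues.
Variable F : fieldType.

Definition qpoch (x q : F) (m : nat) : F := \prod_(0 <= k < m) (1 - x * q ^+ k).

Definition qbinom (q : F) (m k : nat) : F :=
  qpoch q q m / (qpoch q q k * qpoch q q (m - k)).

(* The index k : 'I_n stands for k.+1, so that the three levels involved are
   2k.+1, 2k and 2k.+2. *)
Definition weight (n : nat) (a : 'I_n -> F) (q : F) (z : array) : F :=
  \prod_(k < n)
    (a k ^ (2 * (sumn (level z k.*2.+1))%:Z - (sumn (level z k.*2))%:Z
              - (sumn (level z k.*2.+2))%:Z)
     * (\prod_(1 <= i < k.+1)
          (qbinom q (entry z k.*2.+1 i - entry z k.*2.+1 i.+1)
                    (entry z k.*2.+1 i - entry z k.*2 i)
           * qbinom q (entry z k.*2.+2 i - entry z k.*2.+2 i.+1)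
                      (entry z k.*2.+2 i - entry z k.*2.+1 i)))
     * qbinom q (entry z k.*2.+2 k.+1)
                (entry z k.*2.+2 k.+1 - entry z k.*2.+1 k.+1)).

Definition calP (n : nat) (q : F) (lam : seq nat) (b : 'I_n -> F) : F :=
  \sum_(z \in [set z : pattern n | level (val z) n.*2 = lam]) weight b q (val z).

Definition orbit_W (n : nat) (lam : n.-tuple nat) : set (n.-tuple int) :=
  [set mu | exists (s : 'S_n) (e : 'I_n -> bool),
     forall j, tnth mu j = (-1) ^+ e j * (tnth lam (s j))%:Z].

Definition monomial_sym (n : nat) (lam : n.-tuple nat) (b : 'I_n -> F) : F :=
  \sum_(mu \in orbit_W lam) \prod_(j < n) b j ^ tnth mu j.

End QAnalogues.

Definition dominated (mu lam : seq nat) : Prop :=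
  forall i, (sumn (take i mu) <= sumn (take i lam))%N.

Section Torus.
Variable R : realType.
Local Notation C := R[i].

(* R[i]^o is R[i] with the topology of its norm. *)
Definition qpoch_inf (x q : C) : C := lim ((qpoch x q m : C^o) @[m --> \oo]).

Definition cexp (x : C) : C :=
  (expR (complex.Re x))%:C * (cos (complex.Im x) +i* sin (complex.Im x)).

Fixpoint cube_integral (n : nat) (f : seq R -> R) : R :=
  if n is m.+1
  then \int[lebesgue_measure]_(x in `[0, 2 * pi]) cube_integral m (fun s => f (x :: s))
  else f [::].

Definition torus_point (n : nat) (theta : seq R) : 'I_n -> C :=
  fun j => cos theta`_j +i* sin theta`_j.

(* (2 pi i)^-n times the integral of g(b) db_1/b_1 ... db_n/b_n over the torus:
   with b_j = e^(i theta_j) one has db_j / b_j = i dtheta_j. *)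
Definition torus_mean (n : nat) (g : ('I_n -> C) -> C) : C :=
  (((2 * pi) ^+ n)^-1)%:C *
  (cube_integral n (fun theta => complex.Re (g (@torus_point n theta)))
   +i* cube_integral n (fun theta => complex.Im (g (@torus_point n theta)))).

Definition Delta_hat (n : nat) (q : R) (b : 'I_n -> C) : C :=
  (\prod_(j < n) (qpoch_inf (b j ^+ 2) q%:C * qpoch_inf (b j ^- 2) q%:C)) *
  \prod_(j < n) \prod_(k < n | (j < k)%N)
    (qpoch_inf (b j * b k) q%:C * qpoch_inf ((b j)^-1 * b k) q%:C
     * qpoch_inf (b j * (b k)^-1) q%:C * qpoch_inf ((b j)^-1 * (b k)^-1) q%:C).

Definition torus_prod (n : nat) (q : R) (f g : ('I_n -> C) -> C) : C :=
  (n`!%:R)^-1 * torus_mean (fun b => f b * (g b)^* * Delta_hat q b).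

Definition rational_on_01 (f : R -> R) : Prop :=
  exists p d : {poly R}, forall q : R, 0 < q < 1 -> d.[q] != 0 /\ f q = p.[q] / d.[q].

(* P q lam is the q-deformed so(2n+1)-Whittaker function of index lam, for all
   q in (0,1) and all partitions lam at once; Laurent polynomials are identified
   with functions on (C \ {0})^n. *)
Record is_whittaker (n : nat)
    (P : R -> n.-tuple nat -> ('I_n -> C) -> C) : Prop := {
  whittaker_permutation : forall (q : R) (lam : n.-tuple nat) (s : 'S_n)
      (b : 'I_n -> C), 0 < q < 1 -> is_partition lam ->
    (forall j, b j != 0) -> P q lam (fun j => b (s j)) = P q lam b;
  whittaker_inversion : forall (q : R) (lam : n.-tuple nat) (e : 'I_n -> bool)
      (b : 'I_n -> C), 0 < q < 1 ->
    is_partition lam -> (forall j, b j != 0) ->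
    P q lam (fun j => if e j then (b j)^-1 else b j) = P q lam b;
  whittaker_triangular : exists c : n.-tuple nat -> n.-tuple nat -> R -> R,
    (forall lam mu, rational_on_01 (c lam mu)) /\
    forall (q : R) (lam : n.-tuple nat) (b : 'I_n -> C), 0 < q < 1 -> is_partition lam -> (forall j, b j != 0) ->
      P q lam b = monomial_sym lam b +
        \sum_(mu \in [set mu : n.-tuple nat |
                        [/\ is_partition mu, dominated mu lam & mu <> lam]])
          (c lam mu q)%:C * monomial_sym mu b;
  whittaker_orthogonal : forall (q : R) (lam mu : n.-tuple nat), 0 < q < 1 -> is_partition lam ->
    is_partition mu -> lam <> mu -> torus_prod q (P q lam) (P q mu) = 0
}.

Definition hypothesis_C (q : R) : Prop :=
  forall n : nat, (1 <= n)%N ->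
  exists2 P : R -> n.-tuple nat -> ('I_n -> C) -> C, is_whittaker P &
    forall (lam : n.-tuple nat) (b : 'I_n -> C), is_partition lam -> (forall j, b j != 0) ->
      calP q%:C lam b = P q lam b.

Definition Pi_fun (n : nat) (t : R) (a : 'I_n -> C) : C :=
  cexp ((\sum_(i < n) (a i + (a i)^-1)) * t%:C).

Definition Q_fun (n : nat) (q t : R) (lam : seq nat) : C :=
  torus_prod q (@Pi_fun n t) (calP q%:C lam) /
  torus_prod q (@calP _ n q%:C lam) (calP q%:C lam).

End Torus.

Section Dynamics.
Variables (R : realType) (q : R).

(* 1 - q^e, where the exponent e is +oo when it involves the 0-th coordinate
   of a level, i.e. when i = 0. *)
Definition qgap (i e : nat) : R := if i is 0%N then 1 else 1 - q ^+ e.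

(* r_i(z^(k+1); z^k) and l_i(z^(k+1); z^k) *)
Definition r_prob (z : array) (k i : nat) : R :=
  q ^+ (entry z k.+1 i - entry z k i)
  * (qgap i.-1 (entry z k i.-1 - entry z k.+1 i)
     / qgap i.-1 (entry z k i.-1 - entry z k i)).

Definition l_prob (z : array) (k i : nat) : R :=
  q ^+ (entry z k i - entry z k.+1 i.+1)
  * ((1 - q ^+ (entry z k.+1 i.+1 - entry z k i.+1))
     / (1 - q ^+ (entry z k i - entry z k i.+1))).

Definition shift (f : nat -> nat) (k i : nat) (y : array) : array :=
  set_nth [::] y k.-1 (set_nth 0%N (level y k) i.-1 (f (entry y k i))).

(* left_jump m z y k i z' (resp. right_attempt m z y k i z') is the probability
   that a left jump (resp. a rightward attempt) of the particle (k, i), the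
   bottom level being k + m, ends in the array z'. Here z is the array just
   before the jump time, on which all the probabilities are evaluated, and y is
   the array obtained from z by the moves already made at levels < k. Branches
   leading outside the patterns have probability 0. *)
Fixpoint left_jump (m : nat) (z y : array) (k i : nat) (z' : array) : R :=
  let y' := shift predn k i y in
  if m is m'.+1 then
    l_prob z k i * left_jump m' z y' k.+1 i.+1 z'
    + (1 - l_prob z k i) * left_jump m' z y' k.+1 i z'
  else (y' == z')%:R.

Fixpoint right_attempt (m : nat) (z y : array) (k i : nat) (z' : array) : R :=
  let y' := shift succn k i y in
  if m is m'.+1 then
    if odd k && (i == (k.+1)./2) then
      r_prob z k i * right_attempt m' z y' k.+1 i z'
      + (1 - r_prob z k i) * left_jump m' z y k.+1 i z'
    else
      r_prob z k i * right_attempt m' z y' k.+1 i z'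
      + (1 - r_prob z k i) * right_attempt m' z y' k.+1 i.+1 z'
  else (y' == z')%:R.

(* As in weight, l : 'I_n stands for l.+1: the clocks of Z^(2l.+1)_1 and
   Z^(2l.+2)_1 have rates a_l and a_l^-1. *)
Definition berele_rate (n : nat) (a : 'I_n -> R) (z z' : pattern n) : R :=
  \sum_(l < n)
    (a l * right_attempt (n.*2 - l.*2.+1) (val z) (val z) l.*2.+1 1 (val z')
     + (a l)^-1 * right_attempt (n.*2 - l.*2.+2) (val z) (val z) l.*2.+2 1 (val z')).

(* The result of a jump of particle (k, j), including the simultaneous pushes at
   the m levels below level k. *)
Fixpoint push_right (m k j : nat) (y : array) : array :=
  let y' := shift succn k j y in
  if m is m'.+1 then
    if entry y k j == entry y k.+1 j then push_right m' k.+1 j y' else y'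
  else y'.

Fixpoint push_left (m k j : nat) (y : array) : array :=
  let y' := shift predn k j y in
  if m is m'.+1 then
    if entry y k j == entry y k.+1 j.+1 then push_left m' k.+1 j.+1 y' else y'
  else y'.

Definition right_rate (abar : R) (z : array) (k j : nat) : R :=
  abar * qgap j.-1 (entry z k.-1 j.-1 - entry z k j)
  * ((1 - q ^+ (entry z k j - entry z k j.+1 + 1))
     / (1 - q ^+ (entry z k j - entry z k.-1 j + 1))).

Definition left_rate (abar : R) (z : array) (k j : nat) : R :=
  abar^-1 * (1 - q ^+ (entry z k j - entry z k.-1 j))
  * (qgap j.-1 (entry z k j.-1 - entry z k j + 1)
     / qgap j.-1 (entry z k.-1 j.-1 - entry z k j + 1)).

Definition level_rate (n : nat) (abar : R) (k : nat) (z z' : array) : R :=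
  \sum_(1 <= j < (k.+1)./2.+1)
    (right_rate abar z k j * (push_right (n.*2 - k) k j z == z')%:R
     + left_rate abar z k j * (push_left (n.*2 - k) k j z == z')%:R).

Definition randomised_rate (n : nat) (a : 'I_n -> R) (z z' : pattern n) : R :=
  \sum_(l < n)
    (level_rate n (a l) l.*2.+1 (val z) (val z')
     + level_rate n (a l)^-1 l.*2.+2 (val z) (val z')).

End Dynamics.

Section MarkovJumpProcess.
Variables (R : realType) (S : choiceType).

(* Conservative Q-matrix; the off-diagonal row sums are finite sums for the
   rates used here. *)
Definition q_matrix (rate : S -> S -> R) (x y : S) : R :=
  if x == y then - \sum_(v \in [set v | v != x]) rate x v else rate x y.

Record is_transition_function (rate : S -> S -> R) (p : R -> S -> S -> R) : Prop := {
  transition_ge0 : forall (t : R) x y, 0 <= t -> 0 <= p t x y;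
  transition_sum1 : forall (t : R) x, 0 <= t -> (\esum_(y in [set: S]) (p t x y)%:E = 1)%E;
  transition_0 : forall x y, p 0 x y = (x == y)%:R;
  transition_add : forall (s t : R) x y, 0 <= s -> 0 <= t ->
    (\esum_(v in [set: S]) (p s x v * p t v y)%:E = (p (s + t) x y)%:E)%E;
  transition_derive : forall x y,
    (p h x y - p 0 x y) / h @[h --> 0^'+] --> q_matrix rate x y
}.

Record is_markov_jump_process (rate : S -> S -> R) (d : measure_display)
    (T : measurableType d) (P : probability T R) (Z : R -> T -> S) : Prop := {
  process_measurable : forall (t : R) x, 0 <= t -> measurable [set w | Z t w = x];
  process_right_continuous : forall w (t : R), 0 <= t ->
    \forall s \near t^'+, Z s w = Z t w;
  process_markov : exists2 p, is_transition_function rate p &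
    forall (m : nat) (s : 'I_m -> R) (v : 'I_m -> S) (t h : R) x y,
      (forall i, 0 <= s i <= t) -> 0 <= t -> 0 <= h ->
      P [set w | [/\ forall i, Z (s i) w = v i, Z t w = x & Z (t + h) w = y]] =
      (P [set w | (forall i, Z (s i) w = v i) /\ Z t w = x] * (p h x y)%:E)%E
}.

End MarkovJumpProcess.

(* Main.v *)
Require Import Defs.
From HB Require Import structures.
From mathcomp Require Import all_boot all_order all_algebra all_fingroup.
From mathcomp Require Import complex.
From mathcomp Require Import all_classical all_reals all_analysis.
From mathcomp Require Import ring lra zify.

(** Let [L] be the operator [shape_op] on functions of a partition [lam]: it
    sends [f] to the sum over [i] of
    [(1 - q^(lam_(i-1) - lam_i)) f(lam + e_i) + (1 - q^(lam_i - lam_(i+1))) f(lam - e_i)],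
    with [lam_0] infinite. Write [E] for the sum of the [a_l + 1/a_l] and, for either
    chain, let [A] be its generator plus [E]. The heart of the matter is an
    intertwining, [fibre_intertwining]: for every function [g] of a pattern,
    the weighted sum of [A g] over the patterns with last level [lam] is [L] applied to
    the function sending [mu] to the weighted sum of [g] over the patterns with last
    level [mu], evaluated at [lam]. It is proved by induction on the number of levels;
    a step is a balance between the jumps of two consecutive levels ([berele_local]
    and [rand_local]), and reduces to rational identities for the q-binomial
    factors of one or two neighbouring particles.

    The intertwining is used twice. First, the origin is the only
    pattern whose last level is [0], and its weight is [1]. Hence the entry of the
    [k]-th power of [A] from the origin to [z] is the weight of [z] times
    [(L^k delta_mu)(0)], where [mu] is the last level of [z] ([mpow_origin]). The
    rates are bounded, so the transition function is the exponential series of the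
    generator ([transition_series]). This gives
    [P(Z(t) = z) = e^(-tE) weight(z) S(t)] with
    [S(t)] the sum over [k] of [t^k/k! (L^k delta_mu)(0)] ([origin_transition]).

    Secondly, [A 1] is the constant [E], and [g = 1] gives the Pieri rule:
    multiplication by [e(b)], the sum of the [b_l + 1/b_l], acts on the family [calP]
    by [L] ([pieri]). This is an algebraic identity, valid at complex
    parameters, in particular on the torus. As [calP] is [1] at the zero partition
    and the family is orthogonal by hypothesis,
    [<e^k, calP_mu> = <calP_mu, calP_mu> (L^k delta_mu)(0)] ([prod_energy_pow]).
    The exponential series of [t e(b)] converges uniformly on the torus, so
    [<Pi, calP_mu> = <calP_mu, calP_mu> S(t)] ([Pi_coefficient]). Comparing the two
    expressions of [S(t)] proves the theorem.

    Division by [<calP_mu, calP_mu>] is legitimate ([norm2_neq0]). The density of the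
    scalar product is a continuous nonnegative function that is positive at some point,
    so [<1, 1>] is not [0]. Since [e] is real on the torus,
    multiplication by [e] is symmetric, and comparing [<e calP_(mu - e_i), calP_mu>]
    with [<calP_(mu - e_i), e calP_mu>] propagates the nonvanishing from [mu - e_i]
    to [mu]. *)

Set Implicit Arguments.
Unset Strict Implicit.
Unset Printing Implicit Defensive.

Import Order.TTheory GRing.Theory Num.Theory numFieldNormedType.Exports.
Local Open Scope ring_scope.

(** * Identities between q-binomial factors *)

Section LocalIdentities.
Variables (F : fieldType) (q : F).
Hypothesis q_neq0 : q != 0.
Hypothesis q_not_root : forall m, q ^+ m.+1 != 1.

Definition qfact (d : int) : F := if d is Posz m then qpoch q q m else 1.
(** The value [0] at negative integers is the usual convention for [1/(q;q)_d]. With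
    it the sums below run over all integers and the interlacing conditions are
    enforced by the vanishing of the factors. *)
Definition qinvfact (d : int) : F := if d is Posz m then (qpoch q q m)^-1 else 0.

Lemma qpochS m : qpoch q q m.+1 = (1 - q ^ (m.+1 : int)) * qpoch q q m.
Proof. by rewrite /qpoch big_nat_recr //= -exprnP exprS mulrC. Qed.

Lemma qpoch_neq0 m : qpoch q q m != 0.
Proof.
elim: m => [|m IH]; first by rewrite /qpoch big_geq ?oner_eq0.
by rewrite qpochS mulf_neq0 // subr_eq0 eq_sym -exprnP q_not_root.
Qed.

Lemma expz_neq1 (d : int) : d != 0 -> q ^ d != 1.
Proof.
case: d => [[|m]|m] // _; rewrite ?NegzE -?exprnP ?q_not_root //.
by rewrite -exprnN -(inj_eq invr_inj) invrK invr1 q_not_root.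
Qed.

Lemma subq_neq0 (d : int) : d != 0 -> 1 - q ^ d != 0.
Proof. by move=> h; rewrite subr_eq0 eq_sym expz_neq1. Qed.

Lemma qinvfact_pred d : qinvfact (d - 1) = (1 - q ^ d) * qinvfact d.
Proof.
case: d => [[|m]|m].
- by rewrite sub0r expr0z subrr mul0r.
- rewrite (_ : Posz m.+1 - 1 = m) /= ?qpochS; last by lia.
  rewrite invfM mulrA divff ?mul1r //.
  exact: subq_neq0.
- by rewrite (_ : Negz m - 1 = Negz m.+1) ?mulr0 //= !NegzE; lia.
Qed.

Lemma qinvfact_succ d : qinvfact d = (1 - q ^ (d + 1)) * qinvfact (d + 1).
Proof. by rewrite -qinvfact_pred addrK. Qed.

Lemma qinvfact_lt0 d : d < 0 -> qinvfact d = 0.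
Proof. by case: d. Qed.

Lemma qinvfact_ge0 d : qinvfact d != 0 -> 0 <= d.
Proof. by case: d => //= m; rewrite eqxx. Qed.

Lemma qfact_succ d : 0 <= d -> qfact (d + 1) = (1 - q ^ (d + 1)) * qfact d.
Proof. by case: d => // m _; rewrite -PoszD addn1 /= qpochS. Qed.

(** The q-binomial coefficient of [y - y'] over [y - x], attached to a particle [x]
    that lies between the neighbours [y] and [y'] of the next level. Keeping the three
    integer arguments makes translations and reflections visible. *)
Definition link (x y y' : int) : F :=
  qfact (y - y') * qinvfact (y - x) * qinvfact (x - y').

Lemma qfact_pred a b : 0 <= a + b ->
  (1 - q ^ (a + b)) * (qfact (a + b - 1) * qinvfact a * qinvfact (b - 1)) =
  qfact (a + b) * qinvfact a * qinvfact (b - 1).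
Proof.
rewrite le_eqVlt => /orP[/eqP h|h].
  rewrite -h expr0z subrr mul0r.
  have [ha|ha] := ltP a 0; first by rewrite (qinvfact_lt0 ha) mulr0 mul0r.
  by rewrite [qinvfact (b - 1)]qinvfact_lt0 ?mulr0 //; lia.
rewrite -{3}[a + b](subrK 1) qfact_succ ?subrK; last by lia.
by rewrite !mulrA.
Qed.

(** A right jump of [y2] is triggered by a right jump of [x2] or of [x1] on the previous
    level. After division by the common factors this is
    [q^u (1 - q^v) + (1 - q^u) = 1 - q^(u + v)], with [u = y2 - x2 + 1] and
    [v = x2 - y3]. *)
Lemma link_right2 (x1 x2 y1 y2 y3 : int) : y2 <= y1 -> y3 <= y2 ->
  q ^ (y2 - x2 + 1) * (1 - q ^ (x1 - y2)) * (link x1 y1 y2 * link (x2 - 1) y2 y3)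
  + (1 - q ^ (y1 - x1 + 1)) * (link (x1 - 1) y1 y2 * link x2 y2 y3)
  = (1 - q ^ (y1 - y2)) * (link x1 y1 (y2 + 1) * link x2 (y2 + 1) y3).
Proof.
move=> h1 h2; rewrite /link.
set a := y1 - x1; set b := x1 - y2; set c := y2 - x2; set d := x2 - y3.
have -> : y1 - y2 = a + b by rewrite /a /b; ring.
have -> : y2 - y3 = c + d by rewrite /c /d; ring.
have -> : y2 - (x2 - 1) = c + 1 by rewrite /c; ring.
have -> : x2 - 1 - y3 = d - 1 by rewrite /d; ring.
have -> : y1 - (x1 - 1) = a + 1 by rewrite /a; ring.
have -> : x1 - 1 - y2 = b - 1 by rewrite /b; ring.
have -> : x1 - (y2 + 1) = b - 1 by rewrite /b; ring.
have -> : y2 + 1 - x2 = c + 1 by rewrite /c; ring.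
have -> : y1 - (y2 + 1) = a + b - 1 by rewrite /a /b; ring.
have -> : y2 + 1 - y3 = c + d + 1 by rewrite /c /d; ring.
rewrite [RHS]mulrA qfact_pred; last by rewrite /a /b; lia.
rewrite qfact_succ; last by rewrite /c /d; lia.
rewrite (qinvfact_succ a) (qinvfact_succ c) (qinvfact_pred b) (qinvfact_pred d).
rewrite !expfzDr //.
ring.
Qed.

Lemma link_right1 (x y y' : int) : y' <= y ->
  q ^ (y - x + 1) * link (x - 1) y y' + link x y y' = link x (y + 1) y'.
Proof.
move=> h; rewrite /link.
set a := y - x; set b := x - y'.
have -> : y - y' = a + b by rewrite /a /b; ring.
have -> : y - (x - 1) = a + 1 by rewrite /a; ring.
have -> : x - 1 - y' = b - 1 by rewrite /b; ring.
have -> : y + 1 - y' = a + b + 1 by rewrite /a /b; ring.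
have -> : y + 1 - x = a + 1 by rewrite /a; ring.
rewrite qfact_succ; last by rewrite /a /b; lia.
rewrite (qinvfact_succ a) (qinvfact_pred b) !expfzDr //.
ring.
Qed.

(** The reflection [(x1, x2, y1, y2, y3) -> (-x2, -x1, -y3, -y2, -y1)] exchanges the
    identities for right and for left jumps. *)
Lemma link_opp x y y' : link (- x) (- y') (- y) = link x y y'.
Proof.
rewrite /link [RHS]mulrAC; congr (qfact _ * qinvfact _ * qinvfact _); ring.
Qed.

Lemma link_left2 (x1 x2 y1 y2 y3 : int) : y2 <= y1 -> y3 <= y2 ->
  (1 - q ^ (x2 + 1 - y3)) * (link x1 y1 y2 * link (x2 + 1) y2 y3)
  + q ^ (x1 + 1 - y2) * (1 - q ^ (y2 - x2)) * (link (x1 + 1) y1 y2 * link x2 y2 y3)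
  = (1 - q ^ (y2 - y3)) * (link x1 y1 (y2 - 1) * link x2 (y2 - 1) y3).
Proof.
move=> h1 h2.
have := @link_right2 (- x2) (- x1) (- y3) (- y2) (- y1).
rewrite !lerN2 => /(_ h2 h1).
have e1 : - x1 - 1 = - (x1 + 1) by ring.
have e2 : - x2 - 1 = - (x2 + 1) by ring.
have e3 : - y2 + 1 = - (y2 - 1) by ring.
rewrite e1 e2 e3 !link_opp.
rewrite (_ : - y2 - - x1 + 1 = x1 + 1 - y2); last by ring.
rewrite (_ : - x2 - - y2 = y2 - x2); last by ring.
rewrite (_ : - y3 - - x2 + 1 = x2 + 1 - y3); last by ring.
rewrite (_ : - y3 - - y2 = y2 - y3); last by ring.
move=> e; rewrite addrC [link x1 y1 y2 * _]mulrC [link (x1 + 1) _ _ * _]mulrC.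
by rewrite [link x1 y1 (y2 - 1) * _]mulrC.
Qed.

Lemma link_left1 (x y y' : int) : y' <= y ->
  (1 - q ^ (x + 1 - y')) * link (x + 1) y y' = (1 - q ^ (y - y')) * link x (y - 1) y'.
Proof.
move=> h; rewrite /link.
set a := y - x; set b := x - y'.
have -> : y - y' = a + b by rewrite /a /b; ring.
have -> : y - (x + 1) = a - 1 by rewrite /a; ring.
have -> : x + 1 - y' = b + 1 by rewrite /b; ring.
have -> : y - 1 - y' = b + a - 1 by rewrite /a /b; ring.
have -> : y - 1 - x = a - 1 by rewrite /a; ring.
rewrite (mulrAC (qfact (b + a - 1))) (addrC a b) qfact_pred; last by rewrite /a /b; lia.
rewrite (qinvfact_succ b); ring.
Qed.

(** The last particle of an odd level has only one neighbour on the previous level, and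
    its left jump rate is corrected by a factor that depends on this neighbour: see
    [top_factor]. *)
Lemma link_left_top (x1 y1 y2 : int) : y2 <= y1 ->
  q ^ (x1 + 1 - y2) * link (x1 + 1) y1 y2 =
  q ^ (x1 - (y2 - 1)) * (1 - q ^ (y1 - x1)) / (1 - q ^ (y1 - (y2 - 1))) * link x1 y1 (y2 - 1).
Proof.
move=> h; rewrite /link.
set a := y1 - x1; set b := x1 - y2.
have -> : x1 + 1 - y2 = b + 1 by rewrite /b; ring.
have -> : y1 - (x1 + 1) = a - 1 by rewrite /a; ring.
have -> : x1 - (y2 - 1) = b + 1 by rewrite /b; ring.
have -> : y1 - y2 = a + b by rewrite /a /b; ring.
have -> : y1 - (y2 - 1) = a + b + 1 by rewrite /a /b; ring.
rewrite qfact_succ; last by rewrite /a /b; lia.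
rewrite (qinvfact_pred a).
have : 1 - q ^ (a + b + 1) != 0 by apply: subq_neq0; rewrite /a /b; lia.
move: (q ^ (a + b + 1)) => z hz; field; exact: hz.
Qed.

(** A suppressed right jump is turned into a left jump; this identity
    lets its contribution be absorbed by that of the genuine left jumps. *)
Lemma link_suppressed (x y : int) :
  (1 - q ^ (y - x)) * link x y 0 = (1 - q ^ (x + 1)) * link (x + 1) y 0.
Proof.
rewrite /link !subr0 (_ : y - (x + 1) = y - x - 1); last by ring.
by rewrite qinvfact_pred (qinvfact_succ x); ring.
Qed.

Lemma link_top_shift (p x1 x2 : int) : x2 < x1 ->
  link p x1 (x2 + 1) =
  (1 - q ^ (p - x2) * (1 - q ^ (x1 - p)) / (1 - q ^ (x1 - x2))) * link p x1 x2.
Proof.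
move=> h; rewrite /link.
set a := x1 - p; set b := p - x2.
have -> : x1 - x2 = a + b by rewrite /a /b; ring.
have -> : x1 - (x2 + 1) = a + b - 1 by rewrite /a /b; ring.
have -> : p - (x2 + 1) = b - 1 by rewrite /b; ring.
have nz : 1 - q ^ (a + b) != 0 by apply: subq_neq0; rewrite /a /b; lia.
have e := @qfact_pred a b.
apply: (mulfI nz); rewrite e; last by rewrite /a /b; lia.
rewrite (qinvfact_pred b); move: nz; rewrite expfzDr // => nz; field; exact: nz.
Qed.

Lemma link_own_right2 (x1 x2 y1 y2 y3 : int) : y2 <= y1 -> y3 <= y2 ->
  x2 <= y2 ->
  (1 - q ^ (x1 - y2)) * ((1 - q ^ (y2 - y3 + 1)) / (1 - q ^ (y2 - x2 + 1)))
    * (link x1 y1 y2 * link x2 y2 y3)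
  = (1 - q ^ (y1 - y2)) * (link x1 y1 (y2 + 1) * link x2 (y2 + 1) y3).
Proof.
move=> h1 h2 hx; rewrite /link.
set a := y1 - x1; set b := x1 - y2; set c := y2 - x2; set d := x2 - y3.
have -> : y1 - y2 = a + b by rewrite /a /b; ring.
have -> : y2 - y3 = c + d by rewrite /c /d; ring.
have -> : x1 - (y2 + 1) = b - 1 by rewrite /b; ring.
have -> : y2 + 1 - x2 = c + 1 by rewrite /c; ring.
have -> : y1 - (y2 + 1) = a + b - 1 by rewrite /a /b; ring.
have -> : y2 + 1 - y3 = c + d + 1 by rewrite /c /d; ring.
rewrite [RHS]mulrA qfact_pred; last by rewrite /a /b; lia.
rewrite qfact_succ; last by rewrite /c /d; lia.
rewrite (qinvfact_succ c) (qinvfact_pred b).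
have nz : 1 - q ^ (c + 1) != 0 by apply: subq_neq0; rewrite /c; lia.
move: (q ^ (c + 1)) nz => z nz; field; exact: nz.
Qed.

(** The particle [x2] jumps from [y2] to [y2 + 1] and has to push [y2] along, to preserve
    the interlacing. *)
Lemma link_push_right2 (x1 y1 y2 y3 : int) : y2 <= y1 -> y3 <= y2 ->
  (1 - q ^ (x1 - y2)) * (link x1 y1 y2 * link y2 y2 y3)
  = (1 - q ^ (y1 - y2)) * (link x1 y1 (y2 + 1) * link (y2 + 1) (y2 + 1) y3).
Proof.
move=> h1 h2; rewrite /link.
set a := y1 - x1; set b := x1 - y2; set d := y2 - y3.
have -> : y1 - y2 = a + b by rewrite /a /b; ring.
have -> : x1 - (y2 + 1) = b - 1 by rewrite /b; ring.
have -> : y1 - (y2 + 1) = a + b - 1 by rewrite /a /b; ring.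
have -> : y2 + 1 - y3 = d + 1 by rewrite /d; ring.
rewrite [RHS]mulrA qfact_pred; last by rewrite /a /b; lia.
rewrite qfact_succ; last by rewrite /d; lia.
rewrite !subrr (qinvfact_succ d) (qinvfact_pred b); ring.
Qed.

Lemma link_own_right1 (x y y' : int) : y' <= y -> x <= y ->
  ((1 - q ^ (y - y' + 1)) / (1 - q ^ (y - x + 1))) * link x y y' = link x (y + 1) y'.
Proof.
move=> h hx; rewrite /link.
set a := y - x; set b := x - y'.
have -> : y - y' = a + b by rewrite /a /b; ring.
have -> : y + 1 - y' = a + b + 1 by rewrite /a /b; ring.
have -> : y + 1 - x = a + 1 by rewrite /a; ring.
rewrite qfact_succ; last by rewrite /a /b; lia.
rewrite (qinvfact_succ a).
have nz : 1 - q ^ (a + 1) != 0 by apply: subq_neq0; rewrite /a; lia.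
move: (q ^ (a + 1)) nz => z nz; field; exact: nz.
Qed.

Lemma link_push_right1 (y y' : int) : y' <= y -> link y y y' = link (y + 1) (y + 1) y'.
Proof.
move=> h; rewrite /link !subrr (_ : y + 1 - y' = (y - y') + 1); last by ring.
by rewrite qfact_succ ?(qinvfact_succ (y - y')); [ring|lia].
Qed.

Lemma link_own_left2 (x1 x2 y1 y2 y3 : int) : y2 <= y1 -> y3 <= y2 -> y2 <= x1 ->
  (1 - q ^ (y2 - x2)) * ((1 - q ^ (y1 - y2 + 1)) / (1 - q ^ (x1 - y2 + 1)))
    * (link x1 y1 y2 * link x2 y2 y3)
  = (1 - q ^ (y2 - y3)) * (link x1 y1 (y2 - 1) * link x2 (y2 - 1) y3).
Proof.
move=> h1 h2 hx.
have := @link_own_right2 (- x2) (- x1) (- y3) (- y2) (- y1).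
rewrite !lerN2 => /(_ h2 h1 hx).
have e3 : - y2 + 1 = - (y2 - 1) by ring.
rewrite e3 !link_opp.
rewrite (_ : - y2 - - y1 + 1 = y1 - y2 + 1); last by ring.
rewrite (_ : - y2 - - x1 + 1 = x1 - y2 + 1); last by ring.
rewrite (_ : - x2 - - y2 = y2 - x2); last by ring.
rewrite (_ : - y3 - - y2 = y2 - y3); last by ring.
by move=> e; rewrite [link x1 y1 y2 * _]mulrC [link x1 y1 (y2 - 1) * _]mulrC.
Qed.

Lemma link_push_left2 (x2 y1 y2 y3 : int) : y2 <= y1 -> y3 <= y2 ->
  (1 - q ^ (y2 - x2)) * (link y2 y1 y2 * link x2 y2 y3)
  = (1 - q ^ (y2 - y3)) * (link (y2 - 1) y1 (y2 - 1) * link x2 (y2 - 1) y3).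
Proof.
move=> h1 h2.
have := @link_push_right2 (- x2) (- y3) (- y2) (- y1).
rewrite !lerN2 => /(_ h2 h1).
have e3 : - y2 + 1 = - (y2 - 1) by ring.
rewrite e3 !link_opp.
rewrite (_ : - x2 - - y2 = y2 - x2); last by ring.
rewrite (_ : - y3 - - y2 = y2 - y3); last by ring.
by move=> e; rewrite [link y2 y1 y2 * _]mulrC [link (y2 - 1) y1 (y2 - 1) * _]mulrC.
Qed.

Lemma link_own_left1 (x y y' : int) : y' <= y ->
  (1 - q ^ (y - x)) * link x y y' = (1 - q ^ (y - y')) * link x (y - 1) y'.
Proof.
move=> h; rewrite /link.
set a := y - x; set b := x - y'.
have -> : y - y' = b + a by rewrite /a /b; ring.
have -> : y - 1 - y' = b + a - 1 by rewrite /a /b; ring.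
have -> : y - 1 - x = a - 1 by rewrite /a; ring.
rewrite (mulrAC (qfact (b + a - 1))) qfact_pred; last by rewrite /a /b; lia.
rewrite (qinvfact_pred a); ring.
Qed.

Lemma link_stay_right (x y y' : int) :
  x - 1 < y ->
  link (x - 1) y y' = (1 - q ^ (x - y')) / (1 - q ^ (y - x + 1)) * link x y y'.
Proof.
move=> h; rewrite /link.
rewrite (_ : y - (x - 1) = y - x + 1) ; last by ring.
rewrite (_ : x - 1 - y' = x - y' - 1) ; last by ring.
rewrite (qinvfact_succ (y - x)) (qinvfact_pred (x - y')).
have nz : 1 - q ^ (y - x + 1) != 0 by apply: subq_neq0; lia.
move: (q ^ (y - x + 1)) nz => z nz; field; exact: nz.
Qed.

Lemma link_stay_left (x y y' : int) : y' < x + 1 ->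
  link (x + 1) y y' = (1 - q ^ (y - x)) / (1 - q ^ (x - y' + 1)) * link x y y'.
Proof.
move=> h; have := @link_stay_right (- x) (- y') (- y).
rewrite (_ : - x - 1 = - (x + 1)) ?link_opp; last by ring.
rewrite (_ : - x - - y = y - x); last by ring.
rewrite (_ : - y' - - x = x - y'); last by ring.
by apply; lia.
Qed.

(** These differences telescope along a level, which is why the total jump rate of a
    level, minus the rate at which the previous level jumps without pushing it, depends
    only on boundary terms. *)
Lemma stay_telescope_right (x0 x1 y1 y2 : int) : x1 <= y1 ->
  (1 - q ^ (x0 - x1 + 1)) * (1 - q ^ (x1 - y2)) / (1 - q ^ (y1 - x1 + 1))
  - (1 - q ^ (x0 - y1)) * ((1 - q ^ (y1 - y2 + 1)) / (1 - q ^ (y1 - x1 + 1)))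
  = q ^ (x0 - y1) - q ^ (x1 - y2).
Proof.
move=> h; have nz : 1 - q ^ (y1 - x1 + 1) != 0 by apply: subq_neq0; lia.
apply: (mulIf nz); rewrite mulrBl mulrA !divfK //.
rewrite !expfzDr // -!invr_expz; field.
by rewrite !expfz_neq0.
Qed.

Lemma stay_telescope_right_first (x1 y1 y2 : int) : x1 <= y1 ->
  (1 - q ^ (x1 - y2)) / (1 - q ^ (y1 - x1 + 1))
  - ((1 - q ^ (y1 - y2 + 1)) / (1 - q ^ (y1 - x1 + 1)))
  = - q ^ (x1 - y2).
Proof.
move=> h; have nz : 1 - q ^ (y1 - x1 + 1) != 0 by apply: subq_neq0; lia.
apply: (mulIf nz); rewrite mulrBl !divfK //.
rewrite !expfzDr // -!invr_expz; field.
by rewrite !expfz_neq0.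
Qed.

Lemma stay_telescope_left (x1 x2 y1 y2 : int) : y2 <= x1 ->
  (1 - q ^ (x1 - x2 + 1)) * (1 - q ^ (y1 - x1)) / (1 - q ^ (x1 - y2 + 1))
  - (1 - q ^ (y2 - x2)) * ((1 - q ^ (y1 - y2 + 1)) / (1 - q ^ (x1 - y2 + 1)))
  = q ^ (y2 - x2) - q ^ (y1 - x1).
Proof.
move=> h; have nz : 1 - q ^ (x1 - y2 + 1) != 0 by apply: subq_neq0; lia.
apply: (mulIf nz); rewrite mulrBl mulrA !divfK //.
rewrite !expfzDr // -!invr_expz; field.
by rewrite !expfz_neq0.
Qed.

End LocalIdentities.

(** * Coordinates, boxes and products of factors *)

(** Coordinates are numbered from [1], and read [0] beyond the end. *)
Definition crd (x : seq nat) (i : nat) : nat := nth 0%N (0%N :: x) i.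
Definition zc (x : seq nat) (i : nat) : int := (crd x i)%:Z.
Definition inc (i : nat) (x : seq nat) := set_nth 0%N x i.-1 (crd x i).+1.
Definition dec (i : nat) (x : seq nat) := set_nth 0%N x i.-1 (crd x i).-1.

Lemma crd_set_nth x i v j : (0 < i)%N ->
  crd (set_nth 0%N x i.-1 v) j = if j == i then v else crd x j.
Proof.
case: i => // i _; case: j => [|j] //=.
by rewrite /crd /= nth_set_nth /= eqSS.
Qed.

Lemma crd_inc x i j : (0 < i)%N -> crd (inc i x) j = if j == i then (crd x i).+1 else crd x j.
Proof. exact: crd_set_nth. Qed.

Lemma crd_dec x i j : (0 < i)%N -> crd (dec i x) j = if j == i then (crd x i).-1 else crd x j.
Proof. exact: crd_set_nth. Qed.

Lemma size_set_crd x i v : (0 < i <= size x)%N -> size (set_nth 0%N x i.-1 v) = size x.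
Proof. by move=> h; rewrite size_set_nth; apply/maxn_idPr; lia. Qed.

Lemma crd_ext x y : size x = size y -> (forall i, (0 < i)%N -> crd x i = crd y i) -> x = y.
Proof.
move=> hs h; apply: (@eq_from_nth _ 0%N) => // i hi.
exact: (h i.+1).
Qed.

Lemma crd_oversize x i : (size x < i)%N -> crd x i = 0%N.
Proof. by case: i => // i h; rewrite /crd /= nth_default. Qed.

Lemma dec_inc i x : (0 < i <= size x)%N -> dec i (inc i x) = x.
Proof.
move=> h; apply: crd_ext.
  by rewrite size_set_crd ?size_set_crd.
move=> j hj; rewrite crd_dec ?crd_inc ?eqxx; try lia.
by case: eqP => // ->.
Qed.

Lemma inc_dec i x : (0 < i <= size x)%N -> (0 < crd x i)%N -> inc i (dec i x) = x.
Proof.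
move=> h h'; apply: crd_ext.
  by rewrite size_set_crd ?size_set_crd.
move=> j hj; rewrite crd_inc ?crd_dec ?eqxx; try lia.
by case: eqP => // ->; rewrite prednK.
Qed.

Lemma sumn_set_crd x i v : (0 < i <= size x)%N ->
  (sumn (set_nth 0%N x i.-1 v) + crd x i)%N = (sumn x + v)%N.
Proof.
case: i => // i; rewrite /crd /=.
elim: x i => [|e x IH] [|i] //= h.
- lia.
- by have := IH i; lia.
Qed.

Lemma sumn_inc x i : (0 < i <= size x)%N -> sumn (inc i x) = (sumn x).+1.
Proof. by move=> h; have := sumn_set_crd (crd x i).+1 h; rewrite /inc; lia. Qed.

Lemma sumn_dec x i : (0 < i <= size x)%N -> (0 < crd x i)%N -> (sumn (dec i x)).+1 = sumn x.
Proof. by move=> h h'; have := sumn_set_crd (crd x i).-1 h; rewrite /dec; lia. Qed.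

(** A finite range for the levels, so that sums over levels are sums over sequences.
    The bound [M] will exceed the entries of all patterns considered. *)
Definition box (s M : nat) : seq (seq nat) :=
  [seq map val (tval t) | t <- enum {: s.-tuple 'I_M}].

Lemma uniq_box s M : uniq (box s M).
Proof.
rewrite map_inj_uniq ?enum_uniq // => t1 t2 h.
exact/val_inj/(inj_map val_inj).
Qed.

Lemma mem_box s M x : (x \in box s M) = (size x == s) && all (fun e => (e < M)%N) x.
Proof.
apply/mapP/andP => [[t _ ->]|[/eqP hs ha]].
  by rewrite size_map size_tuple; split=> //; apply/allP => e /mapP[i _ ->]; exact: ltn_ord.
have hs' : size (pmap insub x : seq 'I_M) == s.
  by rewrite size_pmap_sub -hs; move: ha; rewrite all_count.
exists (Tuple hs'); first by rewrite mem_enum.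
rewrite /= -[LHS]map_id.
elim: x ha {hs hs'} => //= e x IH /andP[he hx].
by rewrite insubT /= -IH.
Qed.

Lemma size_box s M x : x \in box s M -> size x = s.
Proof. by rewrite mem_box => /andP[/eqP]. Qed.

Lemma crd_box s M x i : (0 < M)%N -> x \in box s M -> (crd x i < M)%N.
Proof.
move=> hM; rewrite mem_box => /andP[_ /allP h]; case: i => [|i] //; rewrite /crd /=.
have [hi|hi] := ltnP i (size x); last by rewrite nth_default.
by apply: h; rewrite mem_nth.
Qed.

Lemma box_set s M x i v : (0 < i <= s)%N -> (v < M)%N -> x \in box s M ->
  set_nth 0%N x i.-1 v \in box s M.
Proof.
rewrite !mem_box => hi hv /andP[/eqP hs /allP ha].
rewrite size_set_crd ?hs // eqxx /=; apply/allP => e /(nthP 0%N)[j hj <-].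
rewrite nth_set_nth /=; case: eqP => // _.
apply/ha/mem_nth; move: hj; rewrite size_set_crd ?hs //.
Qed.

Section Reindex.
Variables (V : nmodType) (s M i : nat).
Hypothesis hi : (0 < i <= s)%N.

(** The change of variable [x -> x + e_i] sends a sum over the positions before a jump
    to one over the positions after it. *)
Lemma box_reindex (H : seq nat -> seq nat -> V) :
  \sum_(x <- box s M | ((crd x i).+1 < M)%N) H x (inc i x)
  = \sum_(x <- box s M | (0 < crd x i)%N) H (dec i x) x.
Proof.
rewrite -big_filter -[RHS]big_filter.
have hp : perm_eq (map (inc i) [seq x <- box s M | ((crd x i).+1 < M)%N])
                  [seq x <- box s M | (0 < crd x i)%N].
  apply: uniq_perm; rewrite ?filter_uniq ?uniq_box //.
    rewrite map_inj_in_uniq ?filter_uniq ?uniq_box // => x y.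
    rewrite !mem_filter => /andP[_ hx] /andP[_ hy] h.
    by rewrite -(@dec_inc i x) ?(size_box hx) // h dec_inc // (size_box hy).
  move=> x; rewrite mem_filter; apply/mapP/andP => [[y]|[h1 h2]].
    rewrite mem_filter => /andP[h1 h2] ->; split; last exact: box_set.
    by rewrite crd_inc ?eqxx //; lia.
  exists (dec i x); last by rewrite inc_dec // (size_box h2).
  rewrite mem_filter crd_dec ?eqxx; last by lia.
  have M0 : (0 < M)%N by move: h2; rewrite mem_box; case: (M) => // /andP[/eqP]; case: (x) hi => //= ; lia.
  have hM := crd_box i M0 h2.
  rewrite prednK // hM /=; apply: box_set => //; lia.
rewrite -(perm_big _ hp) /= big_map big_seq [RHS]big_seq.
apply: eq_bigr => x; rewrite mem_filter => /andP[h1 h2].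
by rewrite dec_inc // (size_box h2).
Qed.
End Reindex.

Section Products.
Variables (F : fieldType) (q : F).
Variable K : nat.
Implicit Types X Y : nat -> int.

Local Notation fac := (link q).

(** A factor [link 0 0 0] equals [1]. So one upper limit [K], at least the number of
    coordinates of every level, serves all levels. *)
Definition link_product X Y : F := \prod_(1 <= i < K.+1) fac (X i) (Y i) (Y i.+1).
Definition upd (j : nat) (d : int) X : nat -> int := fun i => if i == j then X j + d else X i.

Lemma PP_ext X X' Y Y' : (forall i, (1 <= i <= K)%N -> X i = X' i) ->
  (forall i, (1 <= i <= K.+1)%N -> Y i = Y' i) -> link_product X Y = link_product X' Y'.
Proof.
move=> hX hY; apply: eq_big_nat => i hi.
by rewrite hX ?hY //; lia.
Qed.

(** A jump of coordinate [j] of the next level [Y] only involves the factors of index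
    [j - 1] and [j]; the others form a spectator product. *)
Definition rest2 j X Y : F :=
  \prod_(1 <= i < K.+1 | (i != j) && (i != j.-1)) fac (X i) (Y i) (Y i.+1).
Definition rest1 j X Y : F := \prod_(1 <= i < K.+1 | i != j) fac (X i) (Y i) (Y i.+1).

Lemma PP_split2 j X Y : (2 <= j <= K)%N ->
  link_product X Y = fac (X j.-1) (Y j.-1) (Y j) * fac (X j) (Y j) (Y j.+1) * rest2 j X Y.
Proof.
move=> hj; rewrite /link_product (bigD1_seq j) ?mem_index_iota ?iota_uniq //=; last by lia.
rewrite -big_filter (bigD1_seq j.-1) ?filter_uniq ?iota_uniq //=; last first.
  by rewrite mem_filter mem_index_iota; lia.
rewrite big_filter_cond /= prednK; last by lia.
by rewrite mulrCA mulrA.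
Qed.

Lemma PP_split1 j X Y : (1 <= j <= K)%N ->
  link_product X Y = fac (X j) (Y j) (Y j.+1) * rest1 j X Y.
Proof. by move=> hj; rewrite /link_product (bigD1_seq j) ?mem_index_iota ?iota_uniq. Qed.

Lemma upd_same j d X : upd j d X j = X j + d.
Proof. by rewrite /upd eqxx. Qed.

Lemma upd_other j d X i : i != j -> upd j d X i = X i.
Proof. by rewrite /upd => /negPf ->. Qed.

Lemma rest2_updX j d X Y : rest2 j (upd j d X) Y = rest2 j X Y.
Proof. by apply: eq_bigr => i /andP[h1 h2]; rewrite upd_other. Qed.

Lemma rest2_updX' j d X Y : rest2 j (upd j.-1 d X) Y = rest2 j X Y.
Proof. by apply: eq_bigr => i /andP[h1 h2]; rewrite upd_other. Qed.

Lemma rest2_updY j d X Y : rest2 j X (upd j d Y) = rest2 j X Y.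
Proof. by apply: eq_bigr => i /andP[h1 h2]; rewrite !upd_other //; lia. Qed.

Lemma rest1_updX j d X Y : rest1 j (upd j d X) Y = rest1 j X Y.
Proof. by apply: eq_bigr => i h1; rewrite upd_other. Qed.

Lemma rest1_updY d X Y : rest1 1 X (upd 1 d Y) = rest1 1 X Y.
Proof.
rewrite /rest1 big_nat_cond [RHS]big_nat_cond.
by apply: eq_bigr => i h1; rewrite !upd_other //; lia.
Qed.

(** Interlacing needs no separate bookkeeping: it is detected by the product. *)
Lemma PP_neq0 X Y i : link_product X Y != 0 -> (1 <= i <= K)%N -> Y i.+1 <= X i <= Y i.
Proof.
move=> h hi; move: h; rewrite (PP_split1 _ _ hi) /link !mulf_eq0 !negb_or.
by move=> /andP[/andP[/andP[_ /qinvfact_ge0 h1] /qinvfact_ge0 h2] _]; lia.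
Qed.

Hypothesis q_neq0 : q != 0.
Hypothesis q_not_root : forall m, q ^+ m.+1 != 1.

Ltac upd2 := rewrite ?(rest2_updX, rest2_updX', rest2_updY) ?upd_same;
  repeat (rewrite upd_other; last by lia).

Lemma PP_right2 j X Y : (2 <= j <= K)%N -> Y j <= Y j.-1 -> Y j.+1 <= Y j ->
  q ^ (Y j - X j + 1) * (1 - q ^ (X j.-1 - Y j)) * link_product (upd j (-1) X) Y
  + (1 - q ^ (Y j.-1 - X j.-1 + 1)) * link_product (upd j.-1 (-1) X) Y
  = (1 - q ^ (Y j.-1 - Y j)) * link_product X (upd j 1 Y).
Proof.
move=> hj h1 h2; rewrite !(PP_split2 _ _ hj); upd2.
rewrite [RHS]mulrA -(link_right2 q_neq0 q_not_root (X j.-1) (X j) h1 h2); ring.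
Qed.

Lemma PP_right1 X Y : (1 <= K)%N -> Y 2 <= Y 1%N ->
  q ^ (Y 1%N - X 1%N + 1) * link_product (upd 1 (-1) X) Y + link_product X Y = link_product X (upd 1 1 Y).
Proof.
move=> hK h; have hj : (1 <= 1 <= K)%N by lia.
rewrite !(PP_split1 _ _ hj) ?(rest1_updX, rest1_updY) ?upd_same.
rewrite (@upd_other _ _ _ 2) // -(link_right1 q_neq0 q_not_root (X 1%N) h); ring.
Qed.

Lemma PP_left2 j X Y : (2 <= j <= K)%N -> Y j <= Y j.-1 -> Y j.+1 <= Y j ->
  (1 - q ^ (X j + 1 - Y j.+1)) * link_product (upd j 1 X) Y
  + q ^ (X j.-1 + 1 - Y j) * (1 - q ^ (Y j - X j)) * link_product (upd j.-1 1 X) Y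
  = (1 - q ^ (Y j - Y j.+1)) * link_product X (upd j (-1) Y).
Proof.
move=> hj h1 h2; rewrite !(PP_split2 _ _ hj); upd2.
rewrite [RHS]mulrA -(link_left2 q_neq0 q_not_root (X j.-1) (X j) h1 h2); ring.
Qed.

Lemma PP_left1 X Y : (1 <= K)%N -> Y 2 <= Y 1%N ->
  (1 - q ^ (X 1%N + 1 - Y 2)) * link_product (upd 1 1 X) Y = (1 - q ^ (Y 1%N - Y 2)) * link_product X (upd 1 (-1) Y).
Proof.
move=> hK h; have hj : (1 <= 1 <= K)%N by lia.
rewrite !(PP_split1 _ _ hj) ?(rest1_updX, rest1_updY) ?upd_same.
by rewrite !(@upd_other _ _ _ 2) // [LHS]mulrA (link_left1 q_neq0 q_not_root (X 1%N) h) -mulrA.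
Qed.

(** The factor that slows down the left jump of the last particle of an odd level: [x] is
    its position after the jump, [x'] its neighbour on the same level and [p] its
    neighbour on the previous level. *)
Definition top_factor (p x x' : int) : F := q ^ (p - x) * (1 - q ^ (x' - p)) / (1 - q ^ (x' - x)).

Lemma PP_left_top j X Y : (2 <= j <= K)%N -> X j = 0 -> Y j.+1 = 0 ->
  Y j <= Y j.-1 -> 0 <= Y j ->
  q ^ (X j.-1 + 1 - Y j) * (1 - q ^ (Y j - X j)) * link_product (upd j.-1 1 X) Y
  = top_factor (X j.-1) (Y j - 1) (Y j.-1) * (1 - q ^ (Y j - Y j.+1)) * link_product X (upd j (-1) Y).
Proof.
move=> hj hX hY h1 h2; rewrite !(PP_split2 _ _ hj); upd2.
rewrite hX hY !subr0.
have e := link_left_top q_neq0 q_not_root (X j.-1) h1.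
have e2 := link_own_left1 q_neq0 q_not_root 0 h2; rewrite !subr0 in e2.
transitivity (q ^ (X j.-1 + 1 - Y j) * fac (X j.-1 + 1) (Y j.-1) (Y j) *
  ((1 - q ^ Y j) * fac 0 (Y j) 0) * rest2 j X Y); first by ring.
by rewrite e e2 /top_factor; ring.
Qed.

Lemma PP_suppressed j X Y : (1 <= j <= K)%N -> Y j.+1 = 0 ->
  (1 - q ^ (Y j - X j)) * link_product X Y = (1 - q ^ (X j + 1)) * link_product (upd j 1 X) Y.
Proof.
move=> hj hY; rewrite !(PP_split1 _ _ hj) ?(rest1_updX, rest1_updY) ?upd_same hY.
by rewrite [LHS]mulrA (link_suppressed q_neq0 q_not_root) -mulrA.
Qed.

Lemma PP_top_shift j X P : (2 <= j <= K)%N -> P j = 0 -> X j.+1 = 0 -> 0 <= X j -> X j < X j.-1 ->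
  link_product P (upd j 1 X) = (1 - top_factor (P j.-1) (X j) (X j.-1)) * link_product P X.
Proof.
move=> hj hP hX h0 h1; rewrite !(PP_split2 _ _ hj); upd2.
rewrite hP hX (link_top_shift q_neq0 q_not_root (P j.-1) h1) /top_factor.
have -> : fac 0 (X j + 1) 0 = fac 0 (X j) 0; last by ring.
have f0 d : 0 <= d -> fac 0 d 0 = 1.
  have i0 : qinvfact q 0 = 1 by rewrite /= /qpoch big_geq // invr1.
  by case: d => // d _; rewrite /link !subr0 i0 mulr1 mulfV // qpoch_neq0.
by rewrite !f0 //; lia.
Qed.

Lemma PP_own_right2 j X Y : (2 <= j <= K)%N -> Y j <= Y j.-1 -> Y j.+1 <= Y j -> X j <= Y j ->
  (1 - q ^ (X j.-1 - Y j)) * ((1 - q ^ (Y j - Y j.+1 + 1)) / (1 - q ^ (Y j - X j + 1))) * link_product X Y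
  = (1 - q ^ (Y j.-1 - Y j)) * link_product X (upd j 1 Y).
Proof.
move=> hj h1 h2 h3; rewrite !(PP_split2 _ _ hj); upd2.
by rewrite [RHS]mulrA -(link_own_right2 q_neq0 q_not_root (X j.-1) h1 h2 h3) !mulrA.
Qed.

Lemma PP_push_right2 j X Y : (2 <= j <= K)%N -> Y j <= Y j.-1 -> Y j.+1 <= Y j -> X j = Y j + 1 ->
  (1 - q ^ (X j.-1 - Y j)) * link_product (upd j (-1) X) Y
  = (1 - q ^ (Y j.-1 - Y j)) * link_product X (upd j 1 Y).
Proof.
move=> hj h1 h2 h3; rewrite !(PP_split2 _ _ hj); upd2.
by rewrite [RHS]mulrA h3 addrK -(link_push_right2 q_neq0 q_not_root (X j.-1) h1 h2) !mulrA.
Qed.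

Lemma PP_own_right1 X Y : (1 <= K)%N -> Y 2 <= Y 1%N -> X 1%N <= Y 1%N ->
  ((1 - q ^ (Y 1%N - Y 2 + 1)) / (1 - q ^ (Y 1%N - X 1%N + 1))) * link_product X Y
  = link_product X (upd 1 1 Y).
Proof.
move=> hK h1 h2; have hj : (1 <= 1 <= K)%N by lia.
rewrite !(PP_split1 _ _ hj) ?(rest1_updX, rest1_updY) ?upd_same.
by rewrite (@upd_other _ _ _ 2) // -(link_own_right1 q_neq0 q_not_root h1 h2) !mulrA.
Qed.

Lemma PP_push_right1 X Y : (1 <= K)%N -> Y 2 <= Y 1%N -> X 1%N = Y 1%N + 1 ->
  link_product (upd 1 (-1) X) Y = link_product X (upd 1 1 Y).
Proof.
move=> hK h1 h2; have hj : (1 <= 1 <= K)%N by lia.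
rewrite !(PP_split1 _ _ hj) ?(rest1_updX, rest1_updY) ?upd_same.
by rewrite (@upd_other _ _ _ 2) // h2 addrK -(link_push_right1 q_neq0 q_not_root h1).
Qed.

Lemma PP_own_left2 j X Y : (2 <= j <= K)%N -> Y j <= Y j.-1 -> Y j.+1 <= Y j -> Y j <= X j.-1 ->
  (1 - q ^ (Y j - X j)) * ((1 - q ^ (Y j.-1 - Y j + 1)) / (1 - q ^ (X j.-1 - Y j + 1))) * link_product X Y
  = (1 - q ^ (Y j - Y j.+1)) * link_product X (upd j (-1) Y).
Proof.
move=> hj h1 h2 h3; rewrite !(PP_split2 _ _ hj); upd2.
by rewrite [RHS]mulrA -(link_own_left2 q_neq0 q_not_root (X j) h1 h2 h3) !mulrA.
Qed.

Lemma PP_push_left2 j X Y : (2 <= j <= K)%N -> Y j <= Y j.-1 -> Y j.+1 <= Y j -> X j.-1 = Y j - 1 ->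
  (1 - q ^ (Y j - X j)) * link_product (upd j.-1 1 X) Y
  = (1 - q ^ (Y j - Y j.+1)) * link_product X (upd j (-1) Y).
Proof.
move=> hj h1 h2 h3; rewrite !(PP_split2 _ _ hj); upd2.
by rewrite [RHS]mulrA h3 subrK -(link_push_left2 q_neq0 q_not_root (X j) h1 h2) !mulrA.
Qed.

Lemma PP_own_left1 X Y : (1 <= K)%N -> Y 2 <= Y 1%N ->
  (1 - q ^ (Y 1%N - X 1%N)) * link_product X Y = (1 - q ^ (Y 1%N - Y 2)) * link_product X (upd 1 (-1) Y).
Proof.
move=> hK h1; have hj : (1 <= 1 <= K)%N by lia.
rewrite !(PP_split1 _ _ hj) ?(rest1_updX, rest1_updY) ?upd_same.
by rewrite (@upd_other _ _ _ 2) // [LHS]mulrA (link_own_left1 q_neq0 q_not_root _ h1) -mulrA.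
Qed.

Lemma PP_stay_right j X Y : (1 <= j <= K)%N -> X j - 1 < Y j ->
  link_product (upd j (-1) X) Y = (1 - q ^ (X j - Y j.+1)) / (1 - q ^ (Y j - X j + 1)) * link_product X Y.
Proof.
move=> hj h; rewrite !(PP_split1 _ _ hj) ?rest1_updX ?upd_same.
by rewrite (link_stay_right q_neq0 q_not_root) // -[LHS]mulrA.
Qed.

Lemma PP_stay_left j X Y : (1 <= j <= K)%N -> Y j.+1 < X j + 1 ->
  link_product (upd j 1 X) Y = (1 - q ^ (Y j - X j)) / (1 - q ^ (X j - Y j.+1 + 1)) * link_product X Y.
Proof.
move=> hj h; rewrite !(PP_split1 _ _ hj) ?rest1_updX ?upd_same.
by rewrite (link_stay_left q_neq0 q_not_root) // -[LHS]mulrA.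
Qed.

End Products.

(** * Dynamics propagating from level to level, and their intertwining *)

(** [Some (true, i)] and [Some (false, i)] are the right and the left jump of
    particle [i]; [None] is no jump, needed because pushing may stop before the last
    level. *)
Definition move := option (bool * nat).
Definition mR (i : nat) : move := Some (true, i).
Definition mL (i : nat) : move := Some (false, i).

Definition jump (m : move) (x : seq nat) : seq nat :=
  match m with
  | None => x
  | Some (true, i) => inc i x
  | Some (false, i) => dec i x
  end.

Definition perform (m : move) (k : nat) (y : array) : array :=
  match m with
  | None => y
  | Some (true, i) => Defs.shift succn k i y
  | Some (false, i) => Defs.shift predn k i y
  end.

Lemma level_cat (u v : array) x : level (u ++ x :: v) (size u).+1 = x.
Proof. by rewrite /level /= nth_cat ltnn subnn. Qed.

Lemma level_catS (u v : array) x y : level (u ++ x :: y :: v) (size u).+2 = y.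
Proof. by rewrite -cat_rcons -(size_rcons u x) level_cat. Qed.

Lemma level_catl (u v : array) j : (j <= size u)%N -> level (u ++ v) j = level u j.
Proof. by case: j => // j h; rewrite /level /= nth_cat h. Qed.

Lemma perform_cat (u v : array) x m :
  perform m (size u).+1 (u ++ x :: v) = u ++ jump m x :: v.
Proof.
have h f i : Defs.shift f (size u).+1 i (u ++ x :: v) =
    u ++ set_nth 0%N x i.-1 (f (crd x i)) :: v.
  rewrite /Defs.shift /= level_cat /entry level_cat.
  by elim: u => //= e u ->.
by case: m => [[[] j]|] /=; rewrite ?h.
Qed.

Definition nparts (k : nat) : nat := (k.+1)./2.
Arguments nparts : simpl never.

Definition moves (k : nat) : seq move :=
  None :: [seq mR i | i <- iota 1 (nparts k)] ++ [seq mL i | i <- iota 1 (nparts k)].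

Lemma big_moves (V : nmodType) k (f : move -> V) :
  \sum_(m <- moves k) f m =
  f None + (\sum_(1 <= i < (nparts k).+1) f (mR i) + \sum_(1 <= i < (nparts k).+1) f (mL i)).
Proof. by rewrite big_cons big_cat !big_map /index_iota subn1. Qed.

(** No interlacing is imposed: it will be enforced by the weight. *)
Fixpoint abox (M k : nat) : seq array :=
  if k is k'.+1 then [seq rcons u x | u <- abox M k', x <- box (nparts k) M] else [:: [::]].

Lemma size_abox M k u : u \in abox M k -> size u = k.
Proof.
elim: k u => [|k IH] u /=; first by rewrite inE => /eqP ->.
by move=> /allpairsP[[v x] /= [hv hx ->]]; rewrite size_rcons (IH _ hv).
Qed.

Section Chain.
Variable F : fieldType.
(* [step k x y m] lists the outcomes of an attempt [m] at level [k], when levels [k]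
   and [k + 1] are [x] and [y]: the probability, whether the move is performed, and
   the attempt transmitted to level [k + 1]. [own k x y] lists the spontaneous
   attempts of level [k], with their rates, when levels [k - 1] and [k] are [x]
   and [y]. *)
Variable step : nat -> seq nat -> seq nat -> move -> seq (F * bool * move).
Variable own : nat -> seq nat -> seq nat -> seq (F * move).

Definition step_mean k (z : array) (phi : move -> array -> F) (s : move) (y : array) : F :=
  \sum_(o <- step k (level z k) (level z k.+1) s)
     o.1.1 * phi o.2 (if o.1.2 then perform s k y else y).

(** The attempt [s] at level [k] propagates through [m] levels. Probabilities are
    evaluated on [z], the array before the jump, while [y] records the moves made so
    far. The move that reaches level [k + m] is handed to [phi] unperformed: that is what
    allows an induction on the number of levels. *)
Fixpoint run (m : nat) (z y : array) (k : nat) (s : move) (phi : move -> array -> F) : F :=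
  if m is m'.+1 then step_mean k z (fun s' y' => run m' z y' k.+1 s' phi) s y
  else phi s y.

Definition own_mean k (z : array) (phi : move -> array -> F) : F :=
  \sum_(o <- own k (level z k.-1) (level z k)) o.1 * phi o.2 z.

(** The sum over all spontaneous attempts at levels up to [k]: the generator, up to its
    diagonal, of the chain of the first [k] levels. *)
Definition mean (k : nat) (z : array) (phi : move -> array -> F) : F :=
  \sum_(1 <= j < k.+1) own_mean j z (fun s y => run (k - j) z y j s phi).

Lemma run_last m z y k s phi :
  run m.+1 z y k s phi = run m z y k s (step_mean (k + m) z phi).
Proof.
elim: m y k s => [|m IH] y k s; first by rewrite addn0.
rewrite -[LHS]/(step_mean k z (fun s' y' => run m.+1 z y' k.+1 s' phi) s y).
by apply: eq_bigr => o _; rewrite IH addSnnS.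
Qed.

(** The first [k] levels ignore level [k + 1]: a move of the latter is either transmitted
    by level [k] or spontaneous. *)
Lemma mean_last k z phi :
  mean k.+1 z phi = mean k z (step_mean k z phi) + own_mean k.+1 z phi.
Proof.
rewrite /mean big_nat_recr //=; congr (_ + _); last first.
  by rewrite /own_mean subnn.
apply: eq_big_nat => j hj; apply: eq_bigr => o _.
rewrite subSn ?run_last ?subnKC //; lia.
Qed.

Section Intertwining.
Variable M : nat.
Variable kap : nat -> seq nat -> seq nat -> F.
Variable rate : nat -> seq nat -> move -> seq nat -> F.
Variable good : nat -> seq nat -> Prop.

Fixpoint wt (k : nat) (u : array) : F :=
  if k is k'.+1 then wt k' u * kap k' (level u k') (level u k) else 1.

Lemma wt_cat k u v : (k <= size u)%N -> wt k (u ++ v) = wt k u.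
Proof.
elim: k => //= k IH h; rewrite IH ?level_catl //; lia.
Qed.

Lemma wt_rcons u x : wt (size u).+1 (rcons u x) = wt (size u) u * kap (size u) (level u (size u)) x.
Proof. by rewrite -cats1 /= wt_cat // level_cat level_catl. Qed.

Hypothesis good_below : forall k x y, (0 < k)%N -> x \in box (nparts k) M ->
  kap k x y != 0 -> good k.+1 y -> good k x.

Hypothesis local0 : forall y (Phi : move -> F), good 1 y ->
  kap 0 [::] y * \sum_(o <- own 1 [::] y) o.1 * Phi o.2
  = \sum_(m <- moves 1) rate 1 y m [::] * kap 0 [::] (jump m y) * Phi m.

(* The balance between levels [k] and [k + 1] above a fixed level [p]. The rate of level
   [k + 1] may depend on level [k], and that of level [k] on level [p]. *)
Hypothesis local : forall k p y (Phi : move -> seq nat -> F), (0 < k)%N ->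
  size p = nparts k.-1 -> good k.+1 y ->
  \sum_(x <- box (nparts k) M) kap k x y * (\sum_(m <- moves k) rate k x m p * kap k.-1 p (jump m x) *
      (\sum_(o <- step k x y m) o.1.1 * Phi o.2 (if o.1.2 then jump m x else x)))
  + \sum_(x <- box (nparts k) M) kap k x y * kap k.-1 p x * (\sum_(o <- own k.+1 x y) o.1 * Phi o.2 x)
  = \sum_(m <- moves k.+1) \sum_(x <- box (nparts k) M)
      rate k.+1 y m x * kap k.-1 p x * kap k x (jump m y) * Phi m x.

Lemma level_abox k u : u \in abox M k -> size (level u k) = nparts k.
Proof.
case: k => [|k] /=; first by [].
move=> /allpairsP[[v x] /= [hv hx ->]].
by rewrite -cats1 -{1}(size_abox hv) level_cat (size_box hx).
Qed.

(** The first [k] levels may be summed out: given the position [x] of level [k + 1],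
    they act on it through [rate] alone. The hypothesis [local] is exactly
    what turns the statement for level [k] into the one for level [k + 1]. *)
Lemma intertwining k x rest phi : good k.+1 x ->
  \sum_(u <- abox M k) wt k u * kap k (level u k) x * mean k.+1 (u ++ x :: rest) phi
  = \sum_(m <- moves k.+1) \sum_(u <- abox M k)
      rate k.+1 x m (level u k) * wt k u * kap k (level u k) (jump m x) * phi m (u ++ x :: rest).
Proof.
elim: k x rest phi => [|k IH] y rest phi hy.
  rewrite [LHS]big_seq1 mean_last {1}/mean big_geq // add0r mul1r /own_mean /=.
  rewrite (local0 (fun m => phi m (y :: rest)) hy); apply: eq_bigr => m _.
  by rewrite big_seq1 mulr1.
rewrite [LHS]big_allpairs_dep /=.
transitivity (\sum_(x <- box (nparts k.+1) M) kap k.+1 x y *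
    (\sum_(u <- abox M k) wt k u * kap k (level u k) x *
      (mean k.+1 (u ++ x :: y :: rest) (fun s Y => \sum_(o <- step k.+1 x y s)
          o.1.1 * phi o.2 (if o.1.2 then perform s k.+1 Y else Y))
      + \sum_(o <- own k.+2 x y) o.1 * phi o.2 (u ++ x :: y :: rest)))).
  rewrite exchange_big /=; apply: eq_bigr => x _; rewrite mulr_sumr big_seq [RHS]big_seq.
  apply: eq_bigr => u hu; have su := size_abox hu.
  rewrite mean_last /step_mean /own_mean /= cat_rcons -su level_cat level_catS.
  rewrite -cats1 level_cat level_catl ?wt_cat //; ring.
transitivity (\sum_(x <- box (nparts k.+1) M) kap k.+1 x y *
    (\sum_(m <- moves k.+1) \sum_(u <- abox M k)
      rate k.+1 x m (level u k) * wt k u * kap k (level u k) (jump m x) *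
       (\sum_(o <- step k.+1 x y m)
          o.1.1 * phi o.2 (u ++ (if o.1.2 then jump m x else x) :: y :: rest))
     + \sum_(u <- abox M k) wt k u * kap k (level u k) x *
         \sum_(o <- own k.+2 x y) o.1 * phi o.2 (u ++ x :: y :: rest))).
  rewrite !big_seq; apply: eq_bigr => x hx.
  have [->|hk] := eqVneq (kap k.+1 x y) 0; first by rewrite !mul0r.
  have hgx : good k.+1 x by apply: good_below hk hy.
  congr (_ * _).
  under eq_bigr do rewrite mulrDr.
  rewrite big_split /=; congr (_ + _).
  rewrite IH //; apply: eq_bigr => m _; rewrite !big_seq; apply: eq_bigr => u hu.
  congr (_ * _); apply: eq_bigr => o _; congr (_ * phi _ _).
  by rewrite -(size_abox hu) perform_cat; case: (o.1.2).
transitivity (\sum_(u <- abox M k) wt k u *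
  \sum_(m <- moves k.+2) \sum_(x <- box (nparts k.+1) M)
      rate k.+2 y m x * kap k (level u k) x * kap k.+1 x (jump m y) * phi m (u ++ x :: y :: rest)).
  transitivity (\sum_(u <- abox M k) wt k u *
    (\sum_(x <- box (nparts k.+1) M) kap k.+1 x y * (\sum_(m <- moves k.+1)
        rate k.+1 x m (level u k) * kap k (level u k) (jump m x) *
      (\sum_(o <- step k.+1 x y m) o.1.1 * phi o.2 (u ++ (if o.1.2 then jump m x else x) :: y :: rest)))
  + \sum_(x <- box (nparts k.+1) M) kap k.+1 x y * kap k (level u k) x *
      (\sum_(o <- own k.+2 x y) o.1 * phi o.2 (u ++ x :: y :: rest)))).
    under eq_bigr do rewrite mulrDr.
    under [RHS]eq_bigr do rewrite mulrDr.
    rewrite !big_split /=; congr (_ + _).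
      under [RHS]eq_bigr do rewrite mulr_sumr.
      rewrite [RHS]exchange_big /=; apply: eq_bigr => x _.
      rewrite exchange_big /= mulr_sumr; apply: eq_bigr => u _.
      rewrite !mulr_sumr; apply: eq_bigr => m _; ring.
    under [RHS]eq_bigr do rewrite mulr_sumr.
    rewrite [RHS]exchange_big /=; apply: eq_bigr => x _.
    rewrite mulr_sumr; apply: eq_bigr => u _; ring.
  rewrite !big_seq; apply: eq_bigr => u hu; congr (_ * _).
  exact: (@local k.+1 (level u k) y (fun m x => phi m (u ++ x :: y :: rest)) _ (level_abox hu) hy).
under [LHS]eq_bigr do rewrite mulr_sumr.
rewrite [LHS]exchange_big /=; apply: eq_bigr => m _; rewrite big_allpairs_dep /= !big_seq.
apply: eq_bigr => u hu; rewrite mulr_sumr; apply: eq_bigr => x _.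
rewrite cat_rcons -cats1 -!(size_abox hu) level_cat level_catl ?wt_cat //; ring.
Qed.

End Intertwining.
End Chain.

(** * The weight of two consecutive levels *)

Section LevelWeights.
Variables (F : fieldType) (q : F).
Variables K M : nat.
Variable c : nat -> F.

Local Notation PP := (link_product q K).

(** The contribution to the weight of the passage from level [k] to level [k + 1]. *)
Definition slice_kernel (k : nat) (x y : seq nat) : F :=
  c k.+1 ^ ((sumn y)%:Z - (sumn x)%:Z) * PP (zc x) (zc y).

(** The entries stay below [M] even after one jump, so that summing over a box loses
    no term. *)
Definition good (k : nat) (y : seq nat) : Prop :=
  [/\ size y = nparts k, (nparts k <= K)%N, sorted geq y & all (fun e => (e.+1 < M)%N) y].

Lemma crd_sorted y i : sorted geq y -> (1 <= i)%N -> (crd y i.+1 <= crd y i)%N.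
Proof.
case: i => // i hy _; rewrite /crd /=.
have [h|h] := ltnP i.+1 (size y); last by rewrite (nth_default 0%N h).
have tr : transitive geq by move=> a b d; rewrite /geq /= => h1 h2; exact: (leq_trans h2 h1).
exact: (sorted_leq_nth tr leqnn 0%N hy i i.+1 (ltnW h) h (leqnSn i)).
Qed.

Lemma good_sorted k y i : good k y -> (1 <= i)%N -> zc y i.+1 <= zc y i.
Proof. by move=> [_ _ h _] hi; rewrite /zc lez_nat crd_sorted. Qed.

Lemma good_sortedp k y i : good k y -> (2 <= i)%N -> zc y i <= zc y i.-1.
Proof.
move=> h hi; have := @good_sorted k y i.-1 h; rewrite prednK; last by lia.
by apply; lia.
Qed.

Lemma good_oversize k y i : good k y -> (nparts k < i)%N -> zc y i = 0.
Proof. by move=> [h _ _ _] hi; rewrite /zc crd_oversize ?h. Qed.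

Lemma box_oversize k y i : y \in box (nparts k) M -> (nparts k < i)%N -> zc y i = 0.
Proof. by move=> /size_box h hi; rewrite /zc crd_oversize ?h. Qed.

Lemma good_bound k y i : good k y -> (1 <= i <= nparts k)%N -> ((crd y i).+1 < M)%N.
Proof.
move=> [h _ _ /allP hM] hi; apply: hM; case: i hi => // i hi.
by rewrite /crd /=; apply: mem_nth; rewrite h.
Qed.

Lemma zc_ge0 x i : 0 <= zc x i.
Proof. by []. Qed.

Lemma kap_neq0 k x y i : slice_kernel k x y != 0 -> (1 <= i <= K)%N -> zc y i.+1 <= zc x i <= zc y i.
Proof. by rewrite /slice_kernel mulf_eq0 negb_or => /andP[_ h] hi; exact: PP_neq0 h hi. Qed.

Lemma leq_sz k : (nparts k <= nparts k.+1)%N.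
Proof. by rewrite /nparts; lia. Qed.

Lemma leq_szS k : (nparts k.+1 <= (nparts k).+1)%N.
Proof. by rewrite /nparts; lia. Qed.

Lemma good_below k x y : (0 < k)%N -> x \in box (nparts k) M -> slice_kernel k x y != 0 -> good k.+1 y -> good k x.
Proof.
move=> hk hx hkap hy.
have hs := size_box hx; have hsz := leq_sz k; have [hy1 hy2 hy3 hy4] := hy.
split=> //; first by lia.
  apply/(path.sortedP 0%N) => i; rewrite hs => hi.
  have h1 : (1 <= i.+1 <= K)%N by lia.
  have h2 : (1 <= i.+2 <= K)%N by lia.
  have := kap_neq0 hkap h1; have := kap_neq0 hkap h2.
  rewrite /zc /crd /geq /=; lia.
apply/(all_nthP 0%N) => i; rewrite hs => hi.
have h1 : (1 <= i.+1 <= K)%N by lia.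
have h2 : (1 <= i.+1 <= nparts k.+1)%N by lia.
have := kap_neq0 hkap h1; have := good_bound hy h2.
rewrite /zc /crd /=; lia.
Qed.

Lemma zc_dec x i : (0 < i)%N -> (0 < crd x i)%N -> zc (dec i x) =1 upd i (-1) (zc x).
Proof. by move=> h1 h2 j; rewrite /zc /upd crd_dec //; case: eqP => // _; lia. Qed.

Lemma zc_inc x i : (0 < i)%N -> zc (inc i x) =1 upd i 1 (zc x).
Proof. by move=> h1 j; rewrite /zc /upd crd_inc //; case: eqP => // _; lia. Qed.

Lemma PP_eqX X X' Y : X =1 X' -> PP X Y = PP X' Y.
Proof. by move=> h; apply: PP_ext. Qed.
Lemma PP_eqY X Y Y' : Y =1 Y' -> PP X Y = PP X Y'.
Proof. by move=> h; apply: PP_ext. Qed.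

(** A particle at [0] cannot have jumped right. *)
Lemma PP_low x y i : (1 <= i <= K)%N -> crd x i = 0%N -> PP (upd i (-1) (zc x)) (zc y) = 0.
Proof.
move=> hi hx; apply/eqP; apply: contraT => h.
have := PP_neq0 h hi; rewrite upd_same /zc hx; lia.
Qed.

Lemma PP_high x k y i : good k.+1 y -> (1 <= i <= nparts k)%N -> (M <= (crd x i).+1)%N ->
  PP (upd i 1 (zc x)) (zc y) = 0.
Proof.
move=> hy hi hx; have hsz := leq_sz k; have [_ hK _ _] := hy.
apply/eqP; apply: contraT => h.
have h1 : (1 <= i <= K)%N by lia.
have h2 : (1 <= i <= nparts k.+1)%N by lia.
have := PP_neq0 h h1; rewrite upd_same /zc.
have := good_bound hy h2; lia.
Qed.

(** Reindexing by the position after the jump. The boundary terms vanish because of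
    the interlacing with [y]. *)
Lemma sum_inc k y i (G : seq nat -> seq nat -> F) : good k.+1 y -> (1 <= i <= nparts k)%N ->
  \sum_(x <- box (nparts k) M) slice_kernel k x y * G x (inc i x)
  = \sum_(x <- box (nparts k) M) c k.+1 ^ ((sumn y)%:Z - (sumn x)%:Z + 1)
      * PP (upd i (-1) (zc x)) (zc y) * G (dec i x) x.
Proof.
move=> hy hi; have hsz := leq_sz k; have [_ hK _ _] := hy.
rewrite (bigID (fun x => ((crd x i).+1 < M)%N)) /= [X in _ + X]big1 ?addr0; last first.
  move=> x hM; have [->|h] := eqVneq (slice_kernel k x y) 0; first by rewrite mul0r.
  have h1 : (1 <= i <= K)%N by lia.
  have h2 : (1 <= i <= nparts k.+1)%N by lia.
  have := kap_neq0 h h1; have := good_bound hy h2; rewrite /zc; lia.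
rewrite (@box_reindex _ (nparts k) M i hi (fun x x' => slice_kernel k x y * G x x')).
rewrite big_mkcond /= !big_seq; apply: eq_bigr => x hx; case: ltnP => h; last first.
  by rewrite PP_low ?mulr0 ?mul0r //; lia.
rewrite /slice_kernel (PP_eqX _ (zc_dec _ h)); last by lia.
congr (c _ ^ _ * _ * _); have := @sumn_dec x i; rewrite (size_box hx) => /(_ hi h); lia.
Qed.

Lemma sum_dec k y i (G : seq nat -> seq nat -> F) : good k.+1 y -> (1 <= i <= nparts k)%N ->
  (forall x, x \in box (nparts k) M -> crd x i = 0%N -> slice_kernel k x y * G x (dec i x) = 0) ->
  \sum_(x <- box (nparts k) M) slice_kernel k x y * G x (dec i x)
  = \sum_(x <- box (nparts k) M) c k.+1 ^ ((sumn y)%:Z - (sumn x)%:Z - 1)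
      * PP (upd i 1 (zc x)) (zc y) * G (inc i x) x.
Proof.
move=> hy hi h0.
rewrite (bigID (fun x => (0 < crd x i)%N)) /= [X in _ + X]big_seq_cond.
rewrite [X in _ + X]big1 ?addr0; last first.
  by move=> x /andP[hx]; rewrite lt0n negbK => /eqP; exact: h0.
rewrite -(@box_reindex _ (nparts k) M i hi (fun x x' => slice_kernel k x' y * G x' x)).
rewrite big_mkcond /= !big_seq; apply: eq_bigr => x hx; case: ltnP => h; last first.
  by rewrite (PP_high hy hi h) ?mulr0 ?mul0r.
rewrite /slice_kernel (PP_eqX _ (@zc_inc _ _ _)); last by lia.
congr (c _ ^ _ * _ * _); have := @sumn_inc x i; rewrite (size_box hx) => /(_ hi); lia.
Qed.

Lemma kap_incY k x y j : (1 <= j <= size y)%N ->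
  slice_kernel k x (inc j y) = c k.+1 ^ ((sumn y)%:Z - (sumn x)%:Z + 1) * PP (zc x) (upd j 1 (zc y)).
Proof.
move=> h; rewrite /slice_kernel (PP_eqY _ (@zc_inc _ _ _)); last by lia.
congr (c _ ^ _ * _); rewrite sumn_inc //; lia.
Qed.

Lemma kap_decY k x y j : (1 <= j <= size y)%N -> (0 < crd y j)%N ->
  slice_kernel k x (dec j y) = c k.+1 ^ ((sumn y)%:Z - (sumn x)%:Z - 1) * PP (zc x) (upd j (-1) (zc y)).
Proof.
move=> h h0; rewrite /slice_kernel (PP_eqY _ (@zc_dec _ _ _ h0)); last by lia.
congr (c _ ^ _ * _); have := @sumn_dec y j h h0; lia.
Qed.

(** [1 - q^e] for the gap [e] between coordinates [i] and [i + 1], the 0-th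
    coordinate being infinite. *)
Definition edge_gap (i e : nat) : F := if i is 0%N then 1 else 1 - q ^+ e.
Definition edge_gapz (i : nat) (e : int) : F := if i is 0%N then 1 else 1 - q ^ e.
(** These are the rates of the last level: with them as coefficients,
    multiplication by the sum of the [a_l + 1/a_l] acts on the weighted sums over
    patterns. *)
Definition rate_right (x : seq nat) (i : nat) : F := edge_gap i.-1 (crd x i.-1 - crd x i).
Definition rate_left (x : seq nat) (i : nat) : F := 1 - q ^+ (crd x i - crd x i.+1).

Lemma gap_gapz i (a b : nat) : (b <= a)%N -> edge_gap i (a - b) = edge_gapz i (a%:Z - b%:Z).
Proof. by case: i => // i h; rewrite /edge_gap /edge_gapz subzn. Qed.

Lemma expn_expz (a b : nat) : (b <= a)%N -> q ^+ (a - b) = q ^ (a%:Z - b%:Z).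
Proof. by move=> h; rewrite subzn. Qed.

Lemma rate_rightE x i : sorted geq x -> (1 <= i)%N -> rate_right x i = edge_gapz i.-1 (zc x i.-1 - zc x i).
Proof.
rewrite /rate_right; case: i => // -[//|i] h _.
by rewrite gap_gapz //= crd_sorted.
Qed.

Lemma rate_leftE x i : sorted geq x -> (1 <= i)%N -> rate_left x i = 1 - q ^ (zc x i - zc x i.+1).
Proof. by move=> h hi; rewrite /rate_left expn_expz // crd_sorted. Qed.

(** If [y_j = 0] the jump is impossible, and both sides vanish. *)
Lemma rate_kap_dec k x y j : good k.+1 y -> (1 <= j <= nparts k.+1)%N ->
  rate_left y j * slice_kernel k x (dec j y)
  = (1 - q ^ (zc y j - zc y j.+1)) *
    (c k.+1 ^ ((sumn y)%:Z - (sumn x)%:Z - 1) * PP (zc x) (upd j (-1) (zc y))).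
Proof.
move=> hy hj; have [hys hK hsy _] := hy.
rewrite rate_leftE //; last by lia.
have [y0|y0] := posnP (crd y j); last by rewrite kap_decY ?hys.
have -> : zc y j - zc y j.+1 = 0.
  have := @crd_sorted y j hsy; rewrite /zc y0; lia.
by rewrite expr0z subrr !mul0r.
Qed.

End LevelWeights.

Lemma sum_from2 (V : nmodType) N (f : nat -> V) : (1 <= N)%N ->
  \sum_(1 <= j < N.+1) (if j == 1%N then 0 else f j) = \sum_(1 <= i < N) f i.+1.
Proof.
move=> hN; rewrite big_ltn // eqxx add0r big_add1 /=.
by apply: eq_big_nat => i hi; rewrite ifF //; lia.
Qed.

Lemma sum_only1 (V : nmodType) N (f : nat -> V) : (1 <= N)%N ->
  \sum_(1 <= j < N.+1) (if j == 1%N then f j else 0) = f 1%N.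
Proof.
move=> hN; rewrite big_ltn // big_nat big1 ?addr0 // => j hj.
by rewrite ifF //; lia.
Qed.

Lemma sum_sz (V : nmodType) k (f : nat -> V) : ((nparts k < nparts k.+1)%N -> f (nparts k.+1) = 0) ->
  \sum_(1 <= i < (nparts k).+1) f i = \sum_(1 <= i < (nparts k.+1).+1) f i.
Proof.
have h1 := leq_sz k; have h2 := leq_szS k.
case: ltnP => h h0; last by congr (\sum_(1 <= i < _) f i); lia.
rewrite [RHS]big_nat_recr /=; last by lia.
by rewrite h0 // addr0; congr (\sum_(1 <= i < _) f i); lia.
Qed.

(** A sum over the particles of level [k] shifted by one is a sum over those of level
    [k + 1] except the first: for odd [k] the last term has to vanish. *)
Lemma sum_sz_pred (V : nmodType) k (f : nat -> V) : (0 < k)%N -> (odd k -> f (nparts k) = 0) ->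
  \sum_(1 <= i < (nparts k).+1) f i = \sum_(1 <= i < nparts k.+1) f i.
Proof.
move=> hk h0; case: (boolP (odd k)) => ho.
  rewrite big_nat_recr /= ?h0 // ?addr0; last by rewrite /nparts; lia.
  by congr (\sum_(1 <= i < _) f i); rewrite /nparts; lia.
by congr (\sum_(1 <= i < _) f i); rewrite /nparts; lia.
Qed.

(** * Local balance for the Berele dynamics *)

Section Berele.
Variables (F : fieldType) (q : F).
Hypothesis q_neq0 : q != 0.
Hypothesis q_not_root : forall m, q ^+ m.+1 != 1.
Variables K M : nat.
Variable c : nat -> F.
Hypothesis c_neq0 : forall k, c k != 0.
Hypothesis c_odd : forall k, odd k -> c k * c k.+1 = 1.

Local Notation PP := (link_product q K).
Local Notation kap := (slice_kernel q K c).
Local Notation good := (good K M).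
Local Notation top_factor := (top_factor q).
Local Notation gap := (edge_gap q).
Local Notation gapz := (edge_gapz q).
Local Notation rate_right := (rate_right q).
Local Notation rate_left := (rate_left q).

Definition prob_right (x y : seq nat) (i : nat) : F :=
  q ^+ (crd y i - crd x i) * (gap i.-1 (crd x i.-1 - crd y i) / gap i.-1 (crd x i.-1 - crd x i)).
Definition prob_left (x y : seq nat) (i : nat) : F :=
  q ^+ (crd x i - crd y i.+1)
  * ((1 - q ^+ (crd y i.+1 - crd x i.+1)) / (1 - q ^+ (crd x i - crd x i.+1))).

(** The transmission rule; when the right jump of the last particle of an odd level is
    suppressed, a left jump is emitted instead. *)
Definition berele_step (k : nat) (x y : seq nat) (m : move) : seq (F * bool * move) :=
  match m with
  | None => [:: (1, true, None)]
  | Some (true, i) =>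
      let suppressible := odd k && (i == nparts k) in
      [:: (prob_right x y i, true, mR i);
          (1 - prob_right x y i, ~~ suppressible, if suppressible then mL i else mR i.+1)]
  | Some (false, i) =>
      [:: (prob_left x y i, true, mL i.+1); (1 - prob_left x y i, true, mL i)]
  end.

Definition berele_own (k : nat) (x y : seq nat) : seq (F * move) := [:: (c k, mR 1)].

(** The left jump of the last particle of an odd level is triggered from the previous
    level, whose position then enters the rate. Even levels, in particular the last one,
    have no such correction. *)
Definition berele_top (k : nat) (x p : seq nat) (i : nat) : F :=
  if odd k && (i == nparts k) then
    if i == 1%N then 0 else top_factor (zc p i.-1) (zc x i - 1) (zc x i.-1)
  else 1.

Definition berele_level_rate (k : nat) (x : seq nat) (m : move) (p : seq nat) : F :=
  match m with
  | None => 0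
  | Some (true, i) => rate_right x i
  | Some (false, i) => rate_left x i * berele_top k x p i
  end.

(** Multiplication by the jump rate clears the denominators of the transmission
    probabilities. *)
Lemma rate_prob_right k x y i : (0 < k)%N -> x \in box (nparts k) M -> good k.+1 y ->
  kap k x y != 0 -> (1 <= i <= nparts k)%N ->
  rate_right x i * prob_right x y i = q ^ (zc y i - zc x i) * gapz i.-1 (zc x i.-1 - zc y i)
  /\ rate_right x i * (1 - prob_right x y i) = 1 - q ^ (zc y i - zc x i).
Proof.
move=> hk hx hy hkap hi.
have [hxs hK hsx _] := good_below hk hx hkap hy.
have hiK : (1 <= i <= K)%N by lia.
have := kap_neq0 hkap hiK; rewrite /zc !lez_nat => /andP[h1 h2].
rewrite mulrBr mulr1 (rate_rightE q hsx); last by lia.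
rewrite /prob_right (expn_expz q h2).
case: i hi hiK h1 h2 => [|[|i]] hi hiK h1 h2; first by lia.
  by rewrite /= divr1 mulr1 mul1r.
have hiK' : (1 <= i.+1 <= K)%N by lia.
have := kap_neq0 hkap hiK'; rewrite /zc !lez_nat => /andP[h3 _].
rewrite [i.+2.-1]/= !(gap_gapz q) //; last by lia.
rewrite /edge_gapz /zc; set X := crd x i.+1; set X' := crd x i.+2; set Y := crd y i.+2.
have [e|ne] := eqVneq X X'.
  have eY : Y = X by rewrite /Y /X /X' in e *; lia.
  have -> : Y%:Z - X'%:Z = 0 by lia.
  have -> : X%:Z - Y%:Z = 0 by lia.
  have -> : X%:Z - X'%:Z = 0 by lia.
  by rewrite !expr0z !subrr; split; ring.
have nz : 1 - q ^ (X%:Z - X'%:Z) != 0 by apply: subq_neq0 => //; rewrite subr_eq0 eqz_nat.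
have -> : 1 - q ^ (X%:Z - X'%:Z) = 1 - q ^ (Y%:Z - X'%:Z) * q ^ (X%:Z - Y%:Z).
  by rewrite -expfzDr //; congr (1 - q ^ _); ring.
have nz' : 1 - q ^ (Y%:Z - X'%:Z) * q ^ (X%:Z - Y%:Z) != 0.
  by rewrite -expfzDr //; apply: subq_neq0 => //; apply: contra ne => /eqP h; apply/eqP; lia.
move: nz'; set u := q ^ (Y%:Z - X'%:Z); set v := q ^ (X%:Z - Y%:Z) => nz'.
by split; field.
Qed.

Lemma rate_prob_left k x y i : (0 < k)%N -> x \in box (nparts k) M -> good k.+1 y ->
  kap k x y != 0 -> (1 <= i <= nparts k)%N ->
  rate_left x i * prob_left x y i = q ^ (zc x i - zc y i.+1) * (1 - q ^ (zc y i.+1 - zc x i.+1))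
  /\ rate_left x i * (1 - prob_left x y i) = 1 - q ^ (zc x i - zc y i.+1).
Proof.
move=> hk hx hy hkap hi.
have [hxs hK hsx _] := good_below hk hx hkap hy; have [hys hK' _ _] := hy.
have hiK : (1 <= i <= K)%N by lia.
have := kap_neq0 hkap hiK; rewrite /zc !lez_nat => /andP[h1 h2].
have h3 : (crd x i.+1 <= crd y i.+1)%N.
  have [h|h] := leqP i.+1 K; last by rewrite crd_oversize // hxs; lia.
  have hiK' : (1 <= i.+1 <= K)%N by lia.
  by have := kap_neq0 hkap hiK'; rewrite /zc !lez_nat => /andP[].
rewrite mulrBr mulr1 (rate_leftE q hsx); last by lia.
rewrite /prob_left !(expn_expz q) //; last by lia.
rewrite /zc; set X := crd x i; set X' := crd x i.+1; set Y := crd y i.+1.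
have [e|ne] := eqVneq X X'.
  have eY : Y = X by rewrite /Y /X /X' in e *; lia.
  have -> : Y%:Z - X'%:Z = 0 by lia.
  have -> : X%:Z - Y%:Z = 0 by lia.
  have -> : X%:Z - X'%:Z = 0 by lia.
  by rewrite !expr0z !subrr; split; ring.
have -> : 1 - q ^ (X%:Z - X'%:Z) = 1 - q ^ (X%:Z - Y%:Z) * q ^ (Y%:Z - X'%:Z).
  by rewrite -expfzDr //; congr (1 - q ^ _); ring.
have nz' : 1 - q ^ (X%:Z - Y%:Z) * q ^ (Y%:Z - X'%:Z) != 0.
  by rewrite -expfzDr //; apply: subq_neq0 => //; apply: contra ne => /eqP h; apply/eqP; lia.
move: nz'; set u := q ^ (X%:Z - Y%:Z); set v := q ^ (Y%:Z - X'%:Z) => nz'.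
by split; field.
Qed.

Section Local.
Variables (k : nat) (p y : seq nat) (Phi : move -> seq nat -> F).
Hypothesis hk : (0 < k)%N.
Hypothesis hp : size p = nparts k.-1.
Hypothesis hy : good k.+1 y.

Local Notation kp := (kap k.-1 p).
Local Notation Y := (zc y).
Let e (x : seq nat) : int := (sumn y)%:Z - (sumn x)%:Z.
Let last_odd i := odd k && (i == nparts k).

(* The four contributions of level [k]: a right jump of particle [i] transmitted to
   particle [i] ([termA]) or [i + 1] ([termB]), a left jump transmitted to particle
   [i + 1] ([termC]) or [i] ([termD]); [supp] is that of a suppressed right jump. *)
Let termA x i := c k.+1 ^ (e x + 1) * PP (upd i (-1) (zc x)) Y * kp x
  * (q ^ (Y i - zc x i + 1) * gapz i.-1 (zc x i.-1 - Y i)).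
Let termB x i := c k.+1 ^ (e x + 1) * PP (upd i (-1) (zc x)) Y * kp x
  * (1 - q ^ (Y i - zc x i + 1)).
Let supp x i := kap k x y * (1 - q ^ (Y i - zc x i)) * kp (inc i x).
Let termC x i := c k.+1 ^ (e x - 1) * PP (upd i 1 (zc x)) Y * kp x * berele_top k (inc i x) p i
  * (q ^ (zc x i + 1 - Y i.+1) * (1 - q ^ (Y i.+1 - zc x i.+1))).
Let termD x i := c k.+1 ^ (e x - 1) * PP (upd i 1 (zc x)) Y * kp x * berele_top k (inc i x) p i
  * (1 - q ^ (zc x i + 1 - Y i.+1)).

Lemma sum_right i : (1 <= i <= nparts k)%N ->
  \sum_(x <- box (nparts k) M) kap k x y * (berele_level_rate k x (mR i) p * kp (jump (mR i) x)
     * \sum_(o <- berele_step k x y (mR i)) o.1.1 * Phi o.2 (if o.1.2 then jump (mR i) x else x))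
  = \sum_(x <- box (nparts k) M) (termA x i * Phi (mR i) x
     + (if last_odd i then supp x i * Phi (mL i) x else termB x i * Phi (mR i.+1) x)).
Proof.
move=> hi; have [_ hK _ _] := hy; have hsz := leq_sz k.
(* [x] is the position of level [k] before the jump, and [x'] the one after *)
pose G x x' := kp x' * ((q ^ (Y i - zc x i) * gapz i.-1 (zc x i.-1 - Y i)) * Phi (mR i) x'
   + if last_odd i then 0 else (1 - q ^ (Y i - zc x i)) * Phi (mR i.+1) x').
transitivity (\sum_(x <- box (nparts k) M) (kap k x y * G x (inc i x)
   + (if last_odd i then supp x i * Phi (mL i) x else 0))).
  rewrite !big_seq; apply: eq_bigr => x hx.
  rewrite /berele_step /= -/(last_odd i) !big_cons big_nil /= addr0 /G /supp.
  have [e0|hkap] := eqVneq (kap k x y) 0.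
    by rewrite e0 !mul0r add0r; case: ifP => _; rewrite ?mul0r.
  have [h1 h2] := rate_prob_right hk hx hy hkap hi.
  rewrite -h1 -h2; case: (last_odd i) => /=; ring.
rewrite big_split (sum_inc _ _ G hy hi) -big_split /=.
rewrite !big_seq; apply: eq_bigr => x hx.
have [x0|x0] := posnP (crd x i).
  rewrite /termA /termB PP_low //; last by lia.
  rewrite !(mulr0, mul0r) !add0r; by case: ifP.
have zi : zc (dec i x) i = zc x i - 1 by rewrite zc_dec ?upd_same //; lia.
have zi' : zc (dec i x) i.-1 = zc x i.-1 by rewrite zc_dec ?upd_other //; lia.
rewrite /G zi zi' /termA /termB /e.
have -> : Y i - (zc x i - 1) = Y i - zc x i + 1 by ring.
case: (last_odd i); ring.
Qed.

Lemma sum_left i : (1 <= i <= nparts k)%N ->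
  \sum_(x <- box (nparts k) M) kap k x y * (berele_level_rate k x (mL i) p * kp (jump (mL i) x)
     * \sum_(o <- berele_step k x y (mL i)) o.1.1 * Phi o.2 (if o.1.2 then jump (mL i) x else x))
  = \sum_(x <- box (nparts k) M) (termC x i * Phi (mL i.+1) x + termD x i * Phi (mL i) x).
Proof.
move=> hi; have [_ hK _ _] := hy; have hsz := leq_sz k.
pose G x x' := kp x' * berele_top k x p i *
  ((q ^ (zc x i - Y i.+1) * (1 - q ^ (Y i.+1 - zc x i.+1))) * Phi (mL i.+1) x'
   + (1 - q ^ (zc x i - Y i.+1)) * Phi (mL i) x').
transitivity (\sum_(x <- box (nparts k) M) kap k x y * G x (dec i x)).
  rewrite !big_seq; apply: eq_bigr => x hx.
  rewrite /berele_step /= !big_cons big_nil /= addr0 /G.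
  have [e0|hkap] := eqVneq (kap k x y) 0; first by rewrite e0 !mul0r.
  have [h1 h2] := rate_prob_left hk hx hy hkap hi.
  rewrite -h1 -h2; ring.
rewrite (@sum_dec F q K M c k y i G hy hi).
  rewrite !big_seq; apply: eq_bigr => x hx.
  have zi : zc (inc i x) i = zc x i + 1 by rewrite zc_inc ?upd_same //; lia.
  have zi' : zc (inc i x) i.+1 = zc x i.+1 by rewrite zc_inc ?upd_other //; lia.
  rewrite /G zi zi' /termC /termD /e; ring.
move=> x hxb hx; have [->|hkap] := eqVneq (kap k x y) 0; first by rewrite mul0r.
have h1 : (1 <= i <= K)%N by lia.
have h2 := kap_neq0 hkap h1.
have Y0 : Y i.+1 = 0 by move: h2; rewrite /zc hx; lia.
have x0 : zc x i.+1 = 0.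
  have [h3|h3] := leqP i.+1 K; last by rewrite /zc crd_oversize // (size_box hxb); lia.
  have h4 : (1 <= i.+1 <= K)%N by lia.
  by have := kap_neq0 hkap h4; move: Y0; rewrite /zc; lia.
have xi : zc x i = 0 by rewrite /zc hx.
by rewrite /G x0 Y0 xi subrr expr0z subrr !(mulr0, mul0r, addr0).
Qed.

(** A right jump of particle [j] comes from particles [j] and [j - 1] of the previous
    level, or is spontaneous if [j = 1]. *)
Lemma point_right x j : (1 <= j <= nparts k.+1)%N ->
  termA x j + (if j == 1%N then kap k x y * kp x * c k.+1 else termB x j.-1)
  = rate_right y j * kp x * kap k x (inc j y).
Proof.
move=> hj; have [hys hK hsy _] := hy.
have hjK : (1 <= j <= K)%N by lia.
have h1 : Y j.+1 <= Y j by apply: good_sorted hy _; lia.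
rewrite kap_incY ?hys // -/(e x) (rate_rightE q hsy); last by lia.
have -> : kap k x y = c k.+1 ^ e x * PP (zc x) Y by [].
rewrite /termA /termB.
have [j1|j1] := eqVneq j 1%N.
  subst j; rewrite /= mulr1 mul1r expfzDr // expr1z.
  have hK1 : (1 <= K)%N by lia.
  by rewrite -(PP_right1 q_neq0 q_not_root (zc x) hK1 h1); ring.
have hj2 : (2 <= j <= K)%N by lia.
have h2 : Y j <= Y j.-1 by apply: good_sortedp hy _; lia.
have -> : gapz j.-1 (zc x j.-1 - Y j) = 1 - q ^ (zc x j.-1 - Y j).
  by case: j hj j1 {hjK h1 hj2 h2} => [|[|j]].
have -> : gapz j.-1 (Y j.-1 - Y j) = 1 - q ^ (Y j.-1 - Y j).
  by case: j hj j1 {hjK h1 hj2 h2} => [|[|j]].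
have E := PP_right2 q_neq0 q_not_root (zc x) hj2 h2 h1.
transitivity (c k.+1 ^ (e x + 1) * kp x * ((1 - q ^ (Y j.-1 - Y j)) * PP (zc x) (upd j 1 Y))).
  rewrite -E; ring.
ring.
Qed.

Lemma berele_top1 x i : ~~ last_odd i -> berele_top k x p i = 1.
Proof. by rewrite /berele_top -/(last_odd i) => /negPf ->. Qed.

(** The suppressed right jumps fill the deficit left by [top_factor] in the rate of the
    genuine left jumps. *)
Lemma point_supp x l : x \in box (nparts k) M -> odd k -> l = nparts k ->
  termD x l + supp x l
  = kp x * c k.+1 ^ (e x - 1) * ((1 - q ^ (zc x l + 1)) * PP (upd l 1 (zc x)) Y).
Proof.
move=> hx ho hl; have [hys hK hsy _] := hy; have hsz := leq_sz k.
have hl1 : (1 <= l)%N by rewrite hl /nparts; lia.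
have hlK : (1 <= l <= K)%N by lia.
have Yl : Y l.+1 = 0 by rewrite (good_oversize hy) //; rewrite hl /nparts; move: ho; lia.
have E := PP_suppressed q_neq0 q_not_root (zc x) hlK Yl.
have zl : zc (inc l x) l = zc x l + 1 by rewrite zc_inc ?upd_same.
have zl' : zc (inc l x) l.-1 = zc x l.-1 by rewrite zc_inc ?upd_other //; lia.
have hlo : odd k && (l == nparts k) by rewrite ho hl eqxx.
rewrite /termD /supp /berele_top hlo zl zl' Yl subr0 addrK.
have -> : kap k x y * (1 - q ^ (Y l - zc x l)) * kp (inc l x) =
   c k.+1 ^ e x * ((1 - q ^ (Y l - zc x l)) * PP (zc x) Y) * kp (inc l x).
  by rewrite {1}/slice_kernel -/(e x); ring.
rewrite E kap_incY; last by rewrite (size_box hx); lia.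
rewrite prednK //.
have ec : c k.+1 ^ e x = c k.+1 ^ (e x - 1) * c k.+1.
  transitivity (c k.+1 ^ (e x - 1 + 1)); first by rewrite subrK.
  by rewrite expfzDr.
rewrite ec (@expfzDr _ (c k) _ 1 (c_neq0 k)) expr1z.
have co : c k.+1 * c k = 1 by rewrite mulrC c_odd.
set pw := c k ^ _; set T := PP (upd l 1 (zc x)) Y.
have -> : kp x = pw * PP (zc p) (zc x) by rewrite /slice_kernel prednK.
set cm := c k.+1 ^ (e x - 1).
transitivity (cm * pw * (1 - q ^ (zc x l + 1)) *
    ((if l == 1%N then 0 else top_factor (zc p l.-1) (zc x l) (zc x l.-1)) * PP (zc p) (zc x) * T
     + (c k.+1 * c k) * T * PP (zc p) (upd l 1 (zc x)))); first ring.
rewrite co mul1r.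
have [->|T0] := eqVneq T 0; first by rewrite !(mulr0, mul0r, addr0).
have pl : zc p l = 0 by rewrite /zc crd_oversize // hp hl /nparts; lia.
have xl : zc x l.+1 = 0 by rewrite (box_oversize hx) // hl.
have [l1|l1] := eqVneq l 1%N.
  have -> : PP (zc p) (upd l 1 (zc x)) = PP (zc p) (zc x).
    have hK1 : (1 <= K)%N by lia.
    have xl1 : zc x 2 = 0 by rewrite -xl l1.
    have := PP_right1 q_neq0 q_not_root (zc p) (Y := zc x) hK1.
    rewrite xl1 => /(_ (zc_ge0 _ _)) E1; rewrite l1 -E1 PP_low ?mulr0 ?add0r //.
    by rewrite crd_oversize // hp; move: l1; rewrite hl /nparts; lia.
  ring.
have hl2 : (2 <= l <= K)%N by lia.
have lt : zc x l < zc x l.-1.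
  have h3 : (1 <= l.-1 <= K)%N by lia.
  have := PP_neq0 T0 hlK; have := PP_neq0 T0 h3.
  rewrite upd_same upd_other ?prednK //; lia.
rewrite (PP_top_shift q_neq0 q_not_root hl2 pl xl (zc_ge0 _ _) lt); ring.
Qed.

(** A left jump of particle [j] comes from particles [j - 1] and [j] of the previous
    level. For the last particle of an odd level only the first source exists, which
    produces the correction [berele_top]. *)
Lemma point_left x j : x \in box (nparts k) M -> (1 <= j <= nparts k.+1)%N ->
  (if j == 1%N then 0 else termC x j.-1)
  + (if (j <= nparts k)%N then termD x j + (if last_odd j then supp x j else 0) else 0)
  = berele_level_rate k.+1 y (mL j) x * kp x * kap k x (dec j y).
Proof.
move=> hx hj; have [hys hK hsy _] := hy.
have hjK : (1 <= j <= K)%N by lia.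
have h1 : Y j.+1 <= Y j by apply: good_sorted hy _; lia.
have -> : berele_level_rate k.+1 y (mL j) x * kp x * kap k x (dec j y) =
  berele_top k.+1 y x j * kp x * (rate_left y j * kap k x (dec j y)).
  by rewrite /=; ring.
rewrite (rate_kap_dec q c x hy hj) -/(e x).
have hDD : (j <= nparts k)%N -> termD x j + (if last_odd j then supp x j else 0) =
   kp x * c k.+1 ^ (e x - 1) * ((1 - q ^ (zc x j + 1 - Y j.+1)) * PP (upd j 1 (zc x)) Y).
  move=> hjs; case: ifP => ho.
    move: ho => /andP[ho /eqP ej]; rewrite (point_supp hx ho ej).
    rewrite (_ : Y j.+1 = 0) ?subr0 // (good_oversize hy) // ej /nparts; move: ho; lia.
  by rewrite addr0 /termD berele_top1 ?ho //; ring.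
have hCC : j != 1%N -> termC x j.-1 = kp x * c k.+1 ^ (e x - 1) *
   (q ^ (zc x j.-1 + 1 - Y j) * (1 - q ^ (Y j - zc x j)) * PP (upd j.-1 1 (zc x)) Y).
  move=> j1; rewrite /termC berele_top1 ?prednK //; first by ring.
    by lia.
  by rewrite /last_odd; apply/negP => /andP[ho /eqP ej]; move: hj ho ej; rewrite /nparts; lia.
have [j1|j1] := eqVneq j 1%N.
  have hs1 : (j <= nparts k)%N by rewrite j1 /nparts; lia.
  rewrite hs1 hDD // add0r.
  have -> : berele_top k.+1 y x j = 1.
    by rewrite /berele_top; case: ifP => // /andP[ho /eqP ej]; move: hk ho ej j1; rewrite /nparts; lia.
  move: h1; rewrite j1 => h1.
  by rewrite (PP_left1 q_neq0 q_not_root (zc x)) //; [ring|lia].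
have hj2 : (2 <= j <= K)%N by lia.
have h2 : Y j <= Y j.-1 by apply: good_sortedp hy _; lia.
rewrite hCC //; case: leqP => hjs.
  rewrite hDD // /berele_top ifF; last first.
    by apply/negP => /andP[ho /eqP ej]; move: ho ej hjs; rewrite /nparts; lia.
  have E := PP_left2 q_neq0 q_not_root (zc x) hj2 h2 h1.
  transitivity (kp x * c k.+1 ^ (e x - 1) * ((1 - q ^ (Y j - Y j.+1)) * PP (zc x) (upd j (-1) Y))).
    by rewrite -E; ring.
  ring.
have ej : j = nparts k.+1 by have := leq_szS k; lia.
have ho : odd k.+1 by move: hjs; rewrite ej /nparts; lia.
have hjo : odd k.+1 && (j == nparts k.+1) by rewrite ho ej eqxx.
rewrite /berele_top hjo (negPf j1) addr0.
have x0 : zc x j = 0 by rewrite (box_oversize hx).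
have y0 : Y j.+1 = 0 by rewrite (good_oversize hy) // ej.
by rewrite (PP_left_top q_neq0 q_not_root hj2 x0 y0 h2 (zc_ge0 _ _)); ring.
Qed.

(** After reindexing, both sides are sums over the same moves of level [k + 1] and the
    same positions of level [k], and agree term by term by [point_right] and
    [point_left]. *)
Lemma berele_local :
  \sum_(x <- box (nparts k) M) kap k x y * (\sum_(m <- moves k)
      berele_level_rate k x m p * kp (jump m x) *
      (\sum_(o <- berele_step k x y m) o.1.1 * Phi o.2 (if o.1.2 then jump m x else x)))
  + \sum_(x <- box (nparts k) M) kap k x y * kp x * (\sum_(o <- berele_own k.+1 x y) o.1 * Phi o.2 x)
  = \sum_(m <- moves k.+1) \sum_(x <- box (nparts k) M)
      berele_level_rate k.+1 y m x * kp x * kap k x (jump m y) * Phi m x.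
Proof.
have hsz := leq_sz k; have hszS := leq_szS k.
rewrite big_moves /= [X in _ = X + _]big1 ?add0r; last by move=> x _; rewrite !mul0r.
pose fR i x := kap k x y * (berele_level_rate k x (mR i) p * kp (jump (mR i) x)
     * \sum_(o <- berele_step k x y (mR i)) o.1.1 * Phi o.2 (if o.1.2 then jump (mR i) x else x)).
pose fL i x := kap k x y * (berele_level_rate k x (mL i) p * kp (jump (mL i) x)
     * \sum_(o <- berele_step k x y (mL i)) o.1.1 * Phi o.2 (if o.1.2 then jump (mL i) x else x)).
transitivity (\sum_(x <- box (nparts k) M) (\sum_(1 <= j < (nparts k.+1).+1)
   (termA x j + (if j == 1%N then kap k x y * kp x * c k.+1 else termB x j.-1)) * Phi (mR j) x
  + \sum_(1 <= j < (nparts k.+1).+1)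
   ((if j == 1%N then 0 else termC x j.-1)
  + (if (j <= nparts k)%N then termD x j + (if last_odd j then supp x j else 0) else 0)) * Phi (mL j) x)).
  transitivity (\sum_(x <- box (nparts k) M) (\sum_(1 <= i < (nparts k).+1)
      (termA x i * Phi (mR i) x
     + (if last_odd i then supp x i * Phi (mL i) x else termB x i * Phi (mR i.+1) x))
    + \sum_(1 <= i < (nparts k).+1) (termC x i * Phi (mL i.+1) x + termD x i * Phi (mL i) x)
    + kap k x y * kp x * c k.+1 * Phi (mR 1) x)).
    rewrite !big_split /=; congr (_ + _); last first.
      by apply: eq_bigr => x _; rewrite /berele_own big_seq1 /= !mulrA.
    transitivity (\sum_(x <- box (nparts k) M) (\sum_(1 <= i < (nparts k).+1) fR i x
       + \sum_(1 <= i < (nparts k).+1) fL i x)).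
      by apply: eq_bigr => x _; rewrite big_moves !mul0r add0r mulrDr !mulr_sumr.
    rewrite big_split /= exchange_big [X in _ + X]exchange_big /=.
    rewrite [X in _ = X + _]exchange_big [X in _ = _ + X]exchange_big /=.
    by congr (_ + _); apply: eq_big_nat => i hi; [exact: sum_right|exact: sum_left].
  rewrite !big_seq; apply: eq_bigr => x hx.
  have hN : (1 <= nparts k.+1)%N by rewrite /nparts; lia.
  have sR : \sum_(1 <= i < (nparts k).+1) (if last_odd i then 0 else termB x i * Phi (mR i.+1) x)
      = \sum_(1 <= j < (nparts k.+1).+1) (if j == 1%N then 0 else termB x j.-1 * Phi (mR j) x).
    rewrite sum_from2 // sum_sz_pred //; last by move=> ho; rewrite /last_odd ho eqxx.
    apply: eq_big_nat => i hi; rewrite ifF //.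
    by apply/negP => /andP[ho /eqP ej]; move: hi ho ej; rewrite /nparts; lia.
  have sA : \sum_(1 <= i < (nparts k).+1) termA x i * Phi (mR i) x
      = \sum_(1 <= j < (nparts k.+1).+1) termA x j * Phi (mR j) x.
    apply: sum_sz => hlt; have [_ hK _ _] := hy; rewrite /termA PP_low ?(mulr0, mul0r) //.
    by rewrite crd_oversize // (size_box hx).
  have sC : \sum_(1 <= i < (nparts k).+1) termC x i * Phi (mL i.+1) x
      = \sum_(1 <= j < (nparts k.+1).+1) (if j == 1%N then 0 else termC x j.-1 * Phi (mL j) x).
    rewrite sum_from2 // sum_sz_pred // => ho.
    have x0 : zc x (nparts k).+1 = 0 by rewrite (box_oversize hx).
    have y0 : Y (nparts k).+1 = 0 by rewrite (good_oversize hy) //; move: ho; rewrite /nparts; lia.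
    have h0 : 1 - q ^ (Y (nparts k).+1 - zc x (nparts k).+1) = 0 by rewrite x0 y0 expr0z subrr.
    by rewrite /termC h0 !(mulr0, mul0r).
  have sD : \sum_(1 <= i < (nparts k).+1) (termD x i + (if last_odd i then supp x i else 0)) * Phi (mL i) x
      = \sum_(1 <= j < (nparts k.+1).+1) (if (j <= nparts k)%N
           then termD x j + (if last_odd j then supp x j else 0) else 0) * Phi (mL j) x.
    rewrite -sum_sz; last by move=> hlt; rewrite leqNgt hlt mul0r.
    apply: eq_big_nat => j hj; by have -> : (j <= nparts k)%N by lia.
  have s1 : kap k x y * kp x * c k.+1 * Phi (mR 1) x =
      \sum_(1 <= j < (nparts k.+1).+1) (if j == 1%N then kap k x y * kp x * c k.+1 * Phi (mR j) x else 0).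
    by rewrite sum_only1.
  rewrite s1.
  transitivity (\sum_(1 <= j < (nparts k.+1).+1) termA x j * Phi (mR j) x
    + \sum_(1 <= j < (nparts k.+1).+1) (if j == 1%N then 0 else termB x j.-1 * Phi (mR j) x)
    + \sum_(1 <= j < (nparts k.+1).+1) (if j == 1%N then kap k x y * kp x * c k.+1 * Phi (mR j) x else 0)
    + (\sum_(1 <= j < (nparts k.+1).+1) (if j == 1%N then 0 else termC x j.-1 * Phi (mL j) x)
     + \sum_(1 <= j < (nparts k.+1).+1) (if (j <= nparts k)%N
           then termD x j + (if last_odd j then supp x j else 0) else 0) * Phi (mL j) x)).
    rewrite -sA -sR -sC -sD.
    have -> : \sum_(1 <= i < (nparts k).+1) (termD x i + (if last_odd i then supp x i else 0)) * Phi (mL i) x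
      = \sum_(1 <= i < (nparts k).+1) termD x i * Phi (mL i) x
      + \sum_(1 <= i < (nparts k).+1) (if last_odd i then supp x i else 0) * Phi (mL i) x.
      by rewrite -big_split; apply: eq_bigr => i _; rewrite mulrDl.
    rewrite !big_split /=.
    have -> : \sum_(1 <= i < (nparts k).+1)
        (if last_odd i then supp x i * Phi (mL i) x else termB x i * Phi (mR i.+1) x)
      = \sum_(1 <= i < (nparts k).+1) (if last_odd i then 0 else termB x i * Phi (mR i.+1) x)
      + \sum_(1 <= i < (nparts k).+1) (if last_odd i then supp x i else 0) * Phi (mL i) x.
      by rewrite -big_split; apply: eq_bigr => i _; case: (last_odd i); rewrite /= ?mul0r ?add0r ?addr0.
    ring.
  by congr (_ + _); rewrite -!big_split /=; apply: eq_bigr => j _; case: (j == 1%N); ring.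
rewrite big_split /= exchange_big [X in _ + X]exchange_big /=; congr (_ + _).
  apply: eq_big_nat => j hj; apply: eq_bigr => x _; by rewrite point_right.
apply: eq_big_nat => j hj; rewrite !big_seq; apply: eq_bigr => x hx; by rewrite point_left.
Qed.
End Local.

Lemma berele_local0 y (Phi : move -> F) : good 1 y ->
  kap 0 [::] y * \sum_(o <- berele_own 1 [::] y) o.1 * Phi o.2
  = \sum_(m <- moves 1) berele_level_rate 1 y m [::] * kap 0 [::] (jump m y) * Phi m.
Proof.
move=> hy; have [hys hK hsy _] := hy; have hj : (1 <= 1 <= K)%N by rewrite /nparts in hK; lia.
rewrite big_moves !big_nat1 /= !mul0r add0r {1}/berele_top /= !(mulr0, mul0r) addr0 mul1r.
rewrite /berele_own big_seq1 /= kap_incY ?hys //.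
have h1 : zc y 2 <= zc y 1%N by rewrite (good_oversize hy).
have hK1 : (1 <= K)%N by lia.
rewrite -(PP_right1 q_neq0 q_not_root (zc [::]) hK1 h1).
rewrite PP_low ?crd_oversize // mulr0 add0r expfzDr // expr1z /slice_kernel /=; ring.
Qed.

End Berele.

(** * Local balance for the randomised dynamics *)

Section Randomised.
Variables (F : fieldType) (q : F).
Hypothesis q_neq0 : q != 0.
Hypothesis q_not_root : forall m, q ^+ m.+1 != 1.
Variables K M : nat.
Variable c : nat -> F.
Hypothesis c_neq0 : forall k, c k != 0.
Hypothesis c_odd : forall k, odd k -> c k * c k.+1 = 1.

Local Notation PP := (link_product q K).
Local Notation kap := (slice_kernel q K c).
Local Notation good := (good K M).
Local Notation gap := (edge_gap q).
Local Notation gapz := (edge_gapz q).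
Local Notation rate_right := (rate_right q).
Local Notation rate_left := (rate_left q).

Definition own_right (k : nat) (x y : seq nat) (j : nat) : F :=
  c k * gap j.-1 (crd x j.-1 - crd y j)
  * ((1 - q ^+ (crd y j - crd y j.+1 + 1)) / (1 - q ^+ (crd y j - crd x j + 1))).
Definition own_left (k : nat) (x y : seq nat) (j : nat) : F :=
  (c k)^-1 * (1 - q ^+ (crd y j - crd x j))
  * (gap j.-1 (crd y j.-1 - crd y j + 1) / gap j.-1 (crd x j.-1 - crd y j + 1)).

(** At an even level the real and the fictitious attempts balance out; an odd level
    [2l - 1] contributes [a_l + 1/a_l]. *)
Definition rand_const (k : nat) : F := if odd k then c k + (c k)^-1 else 0.

(** A fictitious attempt that moves nothing, whose rate may be negative. It
    makes the total rate of each level constant, as the intertwining requires; it only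
    affects the diagonal of the generator. *)
Definition rand_stay (k : nat) (x y : seq nat) : F :=
  rand_const k - \sum_(1 <= j < (nparts k).+1) own_right k x y j
  - \sum_(1 <= j < (nparts k).+1) own_left k x y j.

Definition rand_own (k : nat) (x y : seq nat) : seq (F * move) :=
  (rand_stay k x y, None)
  :: [seq (own_right k x y j, mR j) | j <- iota 1 (nparts k)]
  ++ [seq (own_left k x y j, mL j) | j <- iota 1 (nparts k)].

Definition rand_step (k : nat) (x y : seq nat) (m : move) : seq (F * bool * move) :=
  [:: (1, true, match m with
    | None => None
    | Some (true, i) => if crd x i == crd y i then mR i else None
    | Some (false, i) => if crd x i == crd y i.+1 then mL i.+1 else None
    end)].

(** The rate of [None] at an odd level is what the telescoping sums of
    [point_rand_stay] leave at the wall [0]. *)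
Definition rand_level_rate (k : nat) (x : seq nat) (m : move) (p : seq nat) : F :=
  match m with
  | None => if odd k then (c k)^-1 * q ^ zc x (nparts k) else 0
  | Some (true, i) => rate_right x i
  | Some (false, i) => rate_left x i
  end.

Lemma expn_expz1 (a b : nat) : (b <= a)%N -> q ^+ (a - b + 1) = q ^ (a%:Z - b%:Z + 1).
Proof. by move=> h; rewrite subzn. Qed.

Lemma gap_gapz1 i (a b : nat) : (b <= a)%N -> gap i (a - b + 1) = gapz i (a%:Z - b%:Z + 1).
Proof. by case: i => // i h; rewrite /edge_gap /edge_gapz -expn_expz1. Qed.

Section Local.
Variables (k : nat) (y : seq nat).
Hypothesis hy : good k.+1 y.
Local Notation Y := (zc y).
Let e (x : seq nat) : int := (sumn y)%:Z - (sumn x)%:Z.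

Let rho x j := gapz j.-1 (zc x j.-1 - Y j)
  * ((1 - q ^ (Y j - Y j.+1 + 1)) / (1 - q ^ (Y j - zc x j + 1))).
Let lam x j := (1 - q ^ (Y j - zc x j))
  * (gapz j.-1 (Y j.-1 - Y j + 1) / gapz j.-1 (zc x j.-1 - Y j + 1)).

Lemma own_rightE x j : kap k x y != 0 -> (1 <= j <= nparts k.+1)%N ->
  own_right k.+1 x y j = c k.+1 * rho x j.
Proof.
move=> hkap hj; have [hys hK hsy _] := hy.
have hjK : (1 <= j <= K)%N by lia.
have := kap_neq0 hkap hjK; rewrite /zc !lez_nat => /andP[h1 h2].
rewrite /own_right /rho !expn_expz1 //; last by apply: crd_sorted; lia.
rewrite [RHS]mulrA; congr (_ * _ * _).
case: j hj hjK {h1 h2} => [|[|j]] // hj hjK.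
rewrite gap_gapz //=.
have hjK' : (1 <= j.+1 <= K)%N by lia.
by have := kap_neq0 hkap hjK'; rewrite /zc !lez_nat => /andP[].
Qed.

Lemma own_leftE x j : kap k x y != 0 -> (1 <= j <= nparts k.+1)%N ->
  own_left k.+1 x y j = (c k.+1)^-1 * lam x j.
Proof.
move=> hkap hj; have [hys hK hsy _] := hy.
have hjK : (1 <= j <= K)%N by lia.
have := kap_neq0 hkap hjK; rewrite /zc !lez_nat => /andP[h1 h2].
rewrite /own_left /lam expn_expz // [RHS]mulrA; congr (_ * _ * _).
case: j hj hjK {h1 h2} => [|[|j]] // hj hjK.
have hjK' : (1 <= j.+1 <= K)%N by lia.
rewrite !gap_gapz1 //=; last by apply: crd_sorted.
by have := kap_neq0 hkap hjK'; rewrite /zc !lez_nat => /andP[].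
Qed.

Lemma kapE x : kap k x y = c k.+1 ^ e x * PP (zc x) Y.
Proof. by []. Qed.

Lemma powS x : c k.+1 ^ (e x + 1) = c k.+1 ^ e x * c k.+1.
Proof. by rewrite (@expfzDr _ _ _ 1) // expr1z. Qed.

Lemma powP x : c k.+1 ^ (e x - 1) = c k.+1 ^ e x * (c k.+1)^-1.
Proof. by rewrite (@expfzDr _ _ _ (-1)) // exprN1. Qed.

Lemma kap_own_right x j : (1 <= j <= nparts k.+1)%N ->
  kap k x y * own_right k.+1 x y j = c k.+1 ^ (e x + 1) * (rho x j * PP (zc x) Y).
Proof.
move=> hj; have [h|h] := eqVneq (kap k x y) 0.
  rewrite h mul0r; move/eqP: h; rewrite kapE mulf_eq0 expfz_eq0 (negPf (c_neq0 _)) andbF /=.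
  by move=> /eqP ->; rewrite !mulr0.
by rewrite own_rightE // powS kapE; ring.
Qed.

Lemma kap_own_left x j : (1 <= j <= nparts k.+1)%N ->
  kap k x y * own_left k.+1 x y j = c k.+1 ^ (e x - 1) * (lam x j * PP (zc x) Y).
Proof.
move=> hj; have [h|h] := eqVneq (kap k x y) 0.
  rewrite h mul0r; move/eqP: h; rewrite kapE mulf_eq0 expfz_eq0 (negPf (c_neq0 _)) andbF /=.
  by move=> /eqP ->; rewrite !mulr0.
by rewrite own_leftE // powP kapE; ring.
Qed.

Lemma PP_gt0 X j : (1 <= j <= K)%N -> ~~ (Y j.+1 <= X j <= Y j) -> PP X Y = 0.
Proof. by move=> hj h; apply/eqP; apply: contraNT h => /PP_neq0; apply. Qed.

(** A right jump of particle [j] is either spontaneous, which requires [x_j <= y_j],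
    or a push by a jump of [x_j], which requires [x_j = y_j + 1]. The two cases exclude
    each other and give the same total rate. *)
Lemma point_rand_right x j : (1 <= j <= nparts k.+1)%N ->
  kap k x y * own_right k.+1 x y j
  + (if zc x j - 1 == Y j then c k.+1 ^ (e x + 1) * PP (upd j (-1) (zc x)) Y
       * gapz j.-1 (zc x j.-1 - zc x j + 1) else 0)
  = rate_right y j * kap k x (inc j y).
Proof.
move=> hj; have [hys hK hsy _] := hy.
have hjK : (1 <= j <= K)%N by lia.
have h1 : Y j.+1 <= Y j by apply: good_sorted hy _; lia.
have hK1 : (1 <= K)%N by lia.
rewrite kap_own_right // kap_incY ?hys // -/(e x) (rate_rightE q hsy); last by lia.
have [hx|hx] := leP (zc x j) (Y j).
  rewrite ifF ?addr0; last by apply/eqP; lia.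
  rewrite [RHS]mulrCA; congr (_ * _).
  have [j1|j1] := eqVneq j 1%N.
    by subst j; rewrite /rho /= !mul1r PP_own_right1.
  have hj2 : (2 <= j <= K)%N by lia.
  have h2 : Y j <= Y j.-1 by apply: good_sortedp hy _; lia.
  have g z : gapz j.-1 z = 1 - q ^ z by case: (j) hj2 => [|[|?]].
  by rewrite /rho !g; exact: PP_own_right2.
rewrite [PP (zc x) Y](@PP_gt0 _ j) //; last by lia.
rewrite !mulr0 add0r; case: eqP => ex; last first.
  rewrite (_ : PP (zc x) (upd j 1 Y) = 0) ?mulr0 //; apply/eqP; apply: contraT => h.
  by have := PP_neq0 h hjK; rewrite upd_same; lia.
have exj : zc x j = Y j + 1 by lia.
have [j1|j1] := eqVneq j 1%N.
  by subst j; rewrite /= mulr1 mul1r PP_push_right1.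
have hj2 : (2 <= j <= K)%N by lia.
have h2 : Y j <= Y j.-1 by apply: good_sortedp hy _; lia.
have := PP_push_right2 q_neq0 q_not_root hj2 h2 h1 exj.
have -> : zc x j.-1 - zc x j + 1 = zc x j.-1 - Y j by lia.
have g z : gapz j.-1 z = 1 - q ^ z by case: (j) hj2 => [|[|?]].
rewrite !g => E; transitivity (c k.+1 ^ (e x + 1) * ((1 - q ^ (zc x j.-1 - Y j)) * PP (upd j (-1) (zc x)) Y)).
  ring.
by rewrite E; ring.
Qed.

Lemma point_rand_left x j : (1 <= j <= nparts k.+1)%N ->
  kap k x y * own_left k.+1 x y j
  + (if (j != 1%N) && (zc x j.-1 + 1 == Y j) then c k.+1 ^ (e x - 1) * PP (upd j.-1 1 (zc x)) Y
       * (1 - q ^ (zc x j.-1 + 1 - zc x j)) else 0)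
  = rate_left y j * kap k x (dec j y).
Proof.
move=> hj; have [hys hK hsy _] := hy.
have hjK : (1 <= j <= K)%N by lia.
have h1 : Y j.+1 <= Y j by apply: good_sorted hy _; lia.
have hK1 : (1 <= K)%N by lia.
rewrite kap_own_left // (rate_kap_dec q c x hy hj) -/(e x) [RHS]mulrCA.
have [j1|j1] := eqVneq j 1%N.
  subst j; rewrite /= addr0 /lam /= divr1 mulr1; congr (_ * _).
  by rewrite PP_own_left1.
have hj2 : (2 <= j <= K)%N by lia.
have h2 : Y j <= Y j.-1 by apply: good_sortedp hy _; lia.
have hj1 : (1 <= j.-1 <= K)%N by lia.
have g z : gapz j.-1 z = 1 - q ^ z by case: (j) hj2 => [|[|?]].
rewrite /lam !g /=.
have [hx|hx] := leP (Y j) (zc x j.-1).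
  rewrite ifF ?addr0; last by apply/eqP; lia.
  by congr (_ * _); exact: PP_own_left2.
rewrite [PP (zc x) Y](@PP_gt0 _ j.-1) //; last by rewrite prednK; lia.
rewrite !mulr0 add0r; case: eqP => ex; last first.
  rewrite (_ : PP (zc x) (upd j (-1) Y) = 0) ?mulr0 //; apply/eqP; apply: contraT => h.
  have := PP_neq0 h hj1; rewrite prednK; last by lia.
  by rewrite upd_same; lia.
have exj : zc x j.-1 = Y j - 1 by lia.
have := PP_push_left2 q_neq0 q_not_root hj2 h2 h1 exj.
rewrite ex => <-; ring.
Qed.

Let stayR x i := gapz i.-1 (zc x i.-1 - zc x i + 1) * ((1 - q ^ (zc x i - Y i.+1)) / (1 - q ^ (Y i - zc x i + 1))).
Let stayL x i := (1 - q ^ (zc x i + 1 - zc x i.+1)) * ((1 - q ^ (Y i - zc x i)) / (1 - q ^ (zc x i - Y i.+1 + 1))).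

Lemma stay_right x i : (1 <= i <= K)%N -> zc x i - 1 != Y i ->
  PP (upd i (-1) (zc x)) Y * gapz i.-1 (zc x i.-1 - zc x i + 1) = stayR x i * PP (zc x) Y.
Proof.
move=> hi hx; have [h|h] := ltP (zc x i - 1) (Y i).
  by rewrite PP_stay_right // /stayR; ring.
rewrite (@PP_gt0 (zc x) i) ?mulr0 //; last by lia.
by rewrite (@PP_gt0 _ i) ?mul0r // upd_same; lia.
Qed.

Lemma stay_left x i : (1 <= i <= K)%N -> zc x i + 1 != Y i.+1 ->
  PP (upd i 1 (zc x)) Y * (1 - q ^ (zc x i + 1 - zc x i.+1)) = stayL x i * PP (zc x) Y.
Proof.
move=> hi hx; have [h|h] := ltP (Y i.+1) (zc x i + 1).
  by rewrite PP_stay_left // /stayL; ring.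
rewrite (@PP_gt0 (zc x) i) ?mulr0 //; last by lia.
by rewrite (@PP_gt0 _ i) ?mul0r // upd_same; lia.
Qed.

Lemma telescope_right x N : (N <= K)%N -> kap k x y != 0 ->
  \sum_(1 <= j < N.+1) (stayR x j - rho x j)
  = if N is 0%N then 0 else - q ^ (zc x N - Y N.+1).
Proof.
move=> hN hkap; elim: N hN => [|N IH] hN; first by rewrite big_geq.
rewrite big_nat_recr //= IH; last by lia.
have hN1 : (1 <= N.+1 <= K)%N by lia.
have /andP[_ h] := kap_neq0 hkap hN1.
case: N hN hN1 h {IH} => [|N] hN hN1 h.
  by rewrite add0r /stayR /rho /= !mul1r stay_telescope_right_first.
rewrite /stayR /rho [N.+2.-1]/= /edge_gapz.
have := stay_telescope_right q_neq0 q_not_root (zc x N.+1) (Y N.+3) h.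
rewrite -[_ * _ / _]mulrA => ->; ring.
Qed.

Lemma telescope_left x N : (N <= K)%N -> kap k x y != 0 ->
  \sum_(1 <= j < N.+1) (stayL x j - lam x j.+1)
  = q ^ (Y N.+1 - zc x N.+1) - q ^ (Y 1%N - zc x 1%N).
Proof.
move=> hN hkap; elim: N hN => [|N IH] hN; first by rewrite big_geq // subrr.
rewrite big_nat_recr //= IH; last by lia.
have hN1 : (1 <= N.+1 <= K)%N by lia.
have /andP[h _] := kap_neq0 hkap hN1.
rewrite /stayL /lam [N.+2.-1]/= /edge_gapz.
have := stay_telescope_left q_neq0 q_not_root (zc x N.+2) (Y N.+1) h.
have -> : zc x N.+1 - zc x N.+2 + 1 = zc x N.+1 + 1 - zc x N.+2 by ring.
rewrite -[_ * _ / _]mulrA => ->; ring.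
Qed.

(** The jumps of level [k] that push nothing, together with the fictitious attempts,
    contribute in total only the boundary term [rand_level_rate] at [None]. *)
Lemma point_rand_stay x p : (0 < k)%N -> x \in box (nparts k) M ->
  \sum_(1 <= i < (nparts k).+1) (if zc x i - 1 != Y i then c k.+1 ^ (e x + 1) * PP (upd i (-1) (zc x)) Y
       * gapz i.-1 (zc x i.-1 - zc x i + 1) else 0)
  + \sum_(1 <= i < (nparts k).+1) (if zc x i + 1 != Y i.+1 then c k.+1 ^ (e x - 1) * PP (upd i 1 (zc x)) Y
       * (1 - q ^ (zc x i + 1 - zc x i.+1)) else 0)
  + kap k x y * rand_level_rate k x None p + kap k x y * rand_stay k.+1 x y
  = rand_level_rate k.+1 y None x * kap k x y.
Proof.
move=> hk hx; have [hys hK hsy _] := hy; have hsz := leq_sz k.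
have hs1 : (1 <= nparts k)%N by rewrite /nparts; lia.
transitivity (kap k x y * (c k.+1 * \sum_(1 <= i < (nparts k).+1) stayR x i
  + (c k.+1)^-1 * \sum_(1 <= i < (nparts k).+1) stayL x i + rand_level_rate k x None p + rand_stay k.+1 x y)).
  rewrite !mulrDr !mulr_sumr; congr (_ + _ + _ + _); apply: eq_big_nat => i hi.
    have hiK : (1 <= i <= K)%N by lia.
    rewrite kapE powS; case: eqP => h /=.
      rewrite (@PP_gt0 _ i) ?(mulr0, mul0r) //; lia.
    by rewrite -mulrA stay_right //; [ring|apply/eqP].
  have hiK : (1 <= i <= K)%N by lia.
  rewrite kapE powP; case: eqP => h /=.
    rewrite (@PP_gt0 _ i) ?(mulr0, mul0r) //; lia.
  by rewrite -mulrA stay_left //; [ring|apply/eqP].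
have [->|hkap] := eqVneq (kap k x y) 0; first by rewrite mul0r mulr0.
rewrite mulrC; congr (_ * _).
have eR : \sum_(1 <= i < (nparts k).+1) stayR x i = \sum_(1 <= i < (nparts k.+1).+1) stayR x i.
  apply: sum_sz => hlt; rewrite /stayR (box_oversize hx hlt) (good_oversize hy (ltnSn _)).
  by rewrite [X in 1 - q ^ X]subrr expr0z subrr mul0r mulr0.
have eoR : \sum_(1 <= j < (nparts k.+1).+1) own_right k.+1 x y j = c k.+1 * \sum_(1 <= j < (nparts k.+1).+1) rho x j.
  by rewrite mulr_sumr; apply: eq_big_nat => i hi; rewrite own_rightE.
have eoL : \sum_(1 <= j < (nparts k.+1).+1) own_left k.+1 x y j =
    (c k.+1)^-1 * (lam x 1 + \sum_(1 <= i < (nparts k).+1) lam x i.+1).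
  transitivity ((c k.+1)^-1 * \sum_(1 <= j < (nparts k.+1).+1) lam x j).
    by rewrite mulr_sumr; apply: eq_big_nat => i hi; rewrite own_leftE.
  congr (_ * _); rewrite big_ltn; last by lia.
  rewrite big_add1 /= sum_sz_pred // => ho.
  have Y0 : Y (nparts k).+1 = 0 by rewrite (good_oversize hy) //; move: ho; rewrite /nparts; lia.
  have X0 : zc x (nparts k).+1 = 0 by rewrite (box_oversize hx).
  by rewrite /lam Y0 X0 [X in 1 - q ^ X]subrr expr0z subrr mul0r.
rewrite /rand_stay eoR eoL eR.
have hKs : (nparts k <= K)%N by lia.
have TR := telescope_right hK hkap; have TL := telescope_left hKs hkap.
have X0 : zc x (nparts k).+1 = 0 by rewrite (box_oversize hx).
have Y0 : Y (nparts k.+1).+1 = 0 by rewrite (good_oversize hy).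
move: TR TL; rewrite !sumrB Y0 X0 !subr0 => TR TL.
have TR' : \sum_(1 <= j < (nparts k.+1).+1) rho x j = \sum_(1 <= j < (nparts k.+1).+1) stayR x j + q ^ zc x (nparts k.+1).
  move: TR; case: (nparts k.+1) (leq_trans hs1 hsz) => // N _ /eqP; rewrite subr_eq => /eqP ->; ring.
have TL' : \sum_(1 <= j < (nparts k).+1) stayL x j =
    \sum_(1 <= i < (nparts k).+1) lam x i.+1 + q ^ Y (nparts k).+1 - q ^ (Y 1%N - zc x 1%N).
  by move/eqP: TL; rewrite subr_eq => /eqP ->; ring.
rewrite TR' TL' /rand_const /=; case: (boolP (odd k)) => ho /=.
  have es : nparts k.+1 = nparts k by move: ho; rewrite /nparts; lia.
  have -> : Y (nparts k).+1 = 0 by rewrite -es.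
  have -> : (c k)^-1 = c k.+1 by apply: (mulfI (c_neq0 k)); rewrite c_odd ?mulfV.
  by rewrite es expr0z /lam /= divr1; ring.
have es : nparts k.+1 = (nparts k).+1 by move: ho; rewrite /nparts; lia.
by rewrite es X0 expr0z /lam /= divr1; ring.
Qed.

Section Sum.
Variables (p : seq nat) (Phi : move -> seq nat -> F).
Hypothesis hk : (0 < k)%N.
Local Notation kp := (kap k.-1 p).

Lemma rand_sum_right i : (1 <= i <= nparts k)%N ->
  \sum_(x <- box (nparts k) M) kap k x y * (rand_level_rate k x (mR i) p * kp (jump (mR i) x)
     * \sum_(o <- rand_step k x y (mR i)) o.1.1 * Phi o.2 (if o.1.2 then jump (mR i) x else x))
  = \sum_(x <- box (nparts k) M) c k.+1 ^ (e x + 1) * PP (upd i (-1) (zc x)) Y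
       * gapz i.-1 (zc x i.-1 - zc x i + 1) * kp x * Phi (if zc x i - 1 == Y i then mR i else None) x.
Proof.
move=> hi; have [_ hK _ _] := hy; have hsz := leq_sz k.
pose G x x' := gapz i.-1 (zc x i.-1 - zc x i) * kp x' * Phi (if crd x i == crd y i then mR i else None) x'.
transitivity (\sum_(x <- box (nparts k) M) kap k x y * G x (inc i x)).
  rewrite !big_seq; apply: eq_bigr => x hx.
  rewrite /rand_step big_seq1 /= mul1r /G.
  have [->|hkap] := eqVneq (kap k x y) 0; first by rewrite !mul0r.
  have [_ _ hsx _] := good_below hk hx hkap hy.
  rewrite (rate_rightE q hsx); [ring|lia].
rewrite (sum_inc _ _ G hy hi) !big_seq; apply: eq_bigr => x hx.
have [x0|x0] := posnP (crd x i).
  by rewrite PP_low ?(mulr0, mul0r) //; lia.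
have zi : zc (dec i x) i = zc x i - 1 by rewrite zc_dec ?upd_same //; lia.
have zi' : zc (dec i x) i.-1 = zc x i.-1 by rewrite zc_dec ?upd_other //; lia.
have ci : (crd (dec i x) i == crd y i) = (zc x i - 1 == Y i) by rewrite -eqz_nat -!/(zc _ _) zi.
rewrite /G zi zi' ci /e (_ : zc x i.-1 - (zc x i - 1) = zc x i.-1 - zc x i + 1); ring.
Qed.

Lemma rand_sum_left i : (1 <= i <= nparts k)%N ->
  \sum_(x <- box (nparts k) M) kap k x y * (rand_level_rate k x (mL i) p * kp (jump (mL i) x)
     * \sum_(o <- rand_step k x y (mL i)) o.1.1 * Phi o.2 (if o.1.2 then jump (mL i) x else x))
  = \sum_(x <- box (nparts k) M) c k.+1 ^ (e x - 1) * PP (upd i 1 (zc x)) Y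
       * (1 - q ^ (zc x i + 1 - zc x i.+1)) * kp x * Phi (if zc x i + 1 == Y i.+1 then mL i.+1 else None) x.
Proof.
move=> hi; have [_ hK _ _] := hy; have hsz := leq_sz k.
pose G x x' := (1 - q ^ (zc x i - zc x i.+1)) * kp x' * Phi (if crd x i == crd y i.+1 then mL i.+1 else None) x'.
transitivity (\sum_(x <- box (nparts k) M) kap k x y * G x (dec i x)).
  rewrite !big_seq; apply: eq_bigr => x hx.
  rewrite /rand_step big_seq1 /= mul1r /G.
  have [->|hkap] := eqVneq (kap k x y) 0; first by rewrite !mul0r.
  have [_ _ hsx _] := good_below hk hx hkap hy.
  rewrite (rate_leftE q hsx); [ring|lia].
rewrite (@sum_dec F q K M c k y i G hy hi).
  rewrite !big_seq; apply: eq_bigr => x hx.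
  have zi : zc (inc i x) i = zc x i + 1 by rewrite zc_inc ?upd_same //; lia.
  have zi' : zc (inc i x) i.+1 = zc x i.+1 by rewrite zc_inc ?upd_other //; lia.
  have ci : (crd (inc i x) i == crd y i.+1) = (zc x i + 1 == Y i.+1) by rewrite -eqz_nat -!/(zc _ _) zi.
  by rewrite /G zi zi' ci /e; ring.
move=> x hxb hx; have [->|hkap] := eqVneq (kap k x y) 0; first by rewrite mul0r.
have [_ _ hsx _] := good_below hk hxb hkap hy.
have x0 : zc x i - zc x i.+1 = 0 by have := @crd_sorted x i hsx; rewrite /zc hx; lia.
by rewrite /G x0 expr0z subrr !(mulr0, mul0r).
Qed.

Lemma rand_local :
  \sum_(x <- box (nparts k) M) kap k x y * (\sum_(m <- moves k)
      rand_level_rate k x m p * kp (jump m x) *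
      (\sum_(o <- rand_step k x y m) o.1.1 * Phi o.2 (if o.1.2 then jump m x else x)))
  + \sum_(x <- box (nparts k) M) kap k x y * kp x * (\sum_(o <- rand_own k.+1 x y) o.1 * Phi o.2 x)
  = \sum_(m <- moves k.+1) \sum_(x <- box (nparts k) M)
      rand_level_rate k.+1 y m x * kp x * kap k x (jump m y) * Phi m x.
Proof.
have hsz := leq_sz k; have hszS := leq_szS k; have [_ hK _ _] := hy.
pose tR i x := c k.+1 ^ (e x + 1) * PP (upd i (-1) (zc x)) Y * gapz i.-1 (zc x i.-1 - zc x i + 1).
pose tL i x := c k.+1 ^ (e x - 1) * PP (upd i 1 (zc x)) Y * (1 - q ^ (zc x i + 1 - zc x i.+1)).
pose fR i x := kap k x y * (rand_level_rate k x (mR i) p * kp (jump (mR i) x)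
     * \sum_(o <- rand_step k x y (mR i)) o.1.1 * Phi o.2 (if o.1.2 then jump (mR i) x else x)).
pose fL i x := kap k x y * (rand_level_rate k x (mL i) p * kp (jump (mL i) x)
     * \sum_(o <- rand_step k x y (mL i)) o.1.1 * Phi o.2 (if o.1.2 then jump (mL i) x else x)).
transitivity (\sum_(x <- box (nparts k) M) kp x * (
   (kap k x y * rand_level_rate k x None p * Phi None x
    + (\sum_(1 <= i < (nparts k).+1) tR i x * Phi (if zc x i - 1 == Y i then mR i else None) x
       + \sum_(1 <= i < (nparts k).+1) tL i x * Phi (if zc x i + 1 == Y i.+1 then mL i.+1 else None) x))
   + (kap k x y * rand_stay k.+1 x y * Phi None x
      + (\sum_(1 <= j < (nparts k.+1).+1) kap k x y * own_right k.+1 x y j * Phi (mR j) x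
        + \sum_(1 <= j < (nparts k.+1).+1) kap k x y * own_left k.+1 x y j * Phi (mL j) x)))).
  under [RHS]eq_bigr => x do rewrite (mulrDr (kp x)).
  rewrite [RHS]big_split /=; congr (_ + _); last first.
    apply: eq_bigr => x _; rewrite /rand_own big_cons big_cat !big_map /=.
    rewrite /index_iota !subn1 /= -mulrA mulrCA; congr (_ * _).
    move: (rand_stay _ _ _) => st; rewrite !mulrDr !mulr_sumr mulrA; congr (_ + (_ + _)).
      by apply: eq_bigr => j _; ring.
    by apply: eq_bigr => j _; ring.

  transitivity (\sum_(x <- box (nparts k) M) (kp x * (kap k x y * rand_level_rate k x None p * Phi None x)
       + (\sum_(1 <= i < (nparts k).+1) fR i x + \sum_(1 <= i < (nparts k).+1) fL i x))).
    apply: eq_bigr => x _; rewrite big_moves /rand_step big_seq1 mul1r mulrDr [in LHS]mulrDr !mulr_sumr.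
    by congr (_ + _); ring.
  under [RHS]eq_bigr do rewrite mulrDr.
  rewrite !big_split /=; congr (_ + _).
  under [RHS]eq_bigr do rewrite mulrDr !mulr_sumr.
  rewrite big_split /= exchange_big [X in _ + X]exchange_big /=.
  rewrite [X in _ = X + _]exchange_big [X in _ = _ + X]exchange_big /=.
  congr (_ + _); apply: eq_big_nat => i hi.
    by rewrite rand_sum_right //; apply: eq_bigr => x _; rewrite /tR; ring.
  by rewrite rand_sum_left //; apply: eq_bigr => x _; rewrite /tL; ring.
transitivity (\sum_(x <- box (nparts k) M) kp x * (
   rand_level_rate k.+1 y None x * kap k x y * Phi None x
   + (\sum_(1 <= j < (nparts k.+1).+1) rate_right y j * kap k x (inc j y) * Phi (mR j) x
    + \sum_(1 <= j < (nparts k.+1).+1) rate_left y j * kap k x (dec j y) * Phi (mL j) x))); last first.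
  rewrite big_moves.
  under eq_bigr do rewrite mulrDr.
  rewrite big_split /=; congr (_ + _).
    by apply: eq_bigr => x _; ring.
  under eq_bigr do rewrite mulrDr !mulr_sumr.
  rewrite big_split /= exchange_big [X in _ + X]exchange_big /=.
  by congr (_ + _); apply: eq_big_nat => i hi; apply: eq_bigr => x _; ring.
rewrite !big_seq; apply: eq_bigr => x hx; congr (_ * _).
rewrite -(point_rand_stay p hk hx).
have sR : \sum_(1 <= i < (nparts k).+1) tR i x * Phi (if zc x i - 1 == Y i then mR i else None) x
  = \sum_(1 <= i < (nparts k).+1) (if zc x i - 1 != Y i then tR i x else 0) * Phi None x
  + \sum_(1 <= j < (nparts k.+1).+1) (if zc x j - 1 == Y j then tR j x else 0) * Phi (mR j) x.
  rewrite -sum_sz.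
    rewrite -big_split; apply: eq_bigr => i _; case: (zc x i - 1 == Y i); rewrite /= ?mul0r ?add0r ?addr0 //.
  move=> hlt; have x0 : zc x (nparts k.+1) = 0 by rewrite (box_oversize hx).
  have hF : (zc x (nparts k.+1) - 1 == Y (nparts k.+1)) = false.
    by apply/eqP => h; have := zc_ge0 y (nparts k.+1); lia.
  by rewrite hF mul0r.
have sL : \sum_(1 <= i < (nparts k).+1) tL i x * Phi (if zc x i + 1 == Y i.+1 then mL i.+1 else None) x
  = \sum_(1 <= i < (nparts k).+1) (if zc x i + 1 != Y i.+1 then tL i x else 0) * Phi None x
  + \sum_(1 <= j < (nparts k.+1).+1) (if (j != 1%N) && (zc x j.-1 + 1 == Y j) then tL j.-1 x else 0) * Phi (mL j) x.
  transitivity (\sum_(1 <= i < (nparts k).+1) (if zc x i + 1 != Y i.+1 then tL i x else 0) * Phi None x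
   + \sum_(1 <= i < (nparts k).+1) (if zc x i + 1 == Y i.+1 then tL i x else 0) * Phi (mL i.+1) x).
    rewrite -big_split; apply: eq_bigr => i _; case: (zc x i + 1 == Y i.+1); rewrite /= ?mul0r ?add0r ?addr0 //.
  congr (_ + _); rewrite sum_sz_pred //.
    rewrite [RHS]big_ltn ?eqxx /= ?mul0r ?add0r ?big_add1 /=; last by rewrite /nparts; lia.
    by apply: eq_big_nat => -[|i] hi.
  move=> ho; have y0 : Y (nparts k).+1 = 0 by rewrite (good_oversize hy) //; move: ho; rewrite /nparts; lia.
  have hF : (zc x (nparts k) + 1 == Y (nparts k).+1) = false.
    by apply/eqP => h; have := zc_ge0 x (nparts k); lia.
  by rewrite hF mul0r.
rewrite sR sL !mulrDl !mulr_suml.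
have eR : \sum_(1 <= j < (nparts k.+1).+1) rate_right y j * kap k x (inc j y) * Phi (mR j) x
  = \sum_(1 <= j < (nparts k.+1).+1) kap k x y * own_right k.+1 x y j * Phi (mR j) x
  + \sum_(1 <= j < (nparts k.+1).+1) (if zc x j - 1 == Y j then tR j x else 0) * Phi (mR j) x.
  by rewrite -big_split; apply: eq_big_nat => j hj; rewrite -point_rand_right // mulrDl.
have eL : \sum_(1 <= j < (nparts k.+1).+1) rate_left y j * kap k x (dec j y) * Phi (mL j) x
  = \sum_(1 <= j < (nparts k.+1).+1) kap k x y * own_left k.+1 x y j * Phi (mL j) x
  + \sum_(1 <= j < (nparts k.+1).+1) (if (j != 1%N) && (zc x j.-1 + 1 == Y j) then tL j.-1 x else 0) * Phi (mL j) x.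
  rewrite -big_split; apply: eq_big_nat => j hj; rewrite -point_rand_left // mulrDl /tL.
  by rewrite prednK //; case/andP: hj.
rewrite eR eL /tR /tL; ring.
Qed.
End Sum.
End Local.

Lemma rand_local0 y (Phi : move -> F) : good 1 y ->
  kap 0 [::] y * \sum_(o <- rand_own 1 [::] y) o.1 * Phi o.2
  = \sum_(m <- moves 1) rand_level_rate 1 y m [::] * kap 0 [::] (jump m y) * Phi m.
Proof.
move=> hy; have [hys hK hsy _] := hy.
have hj : (1 <= 1 <= nparts 1)%N by [].
have y2 : crd y 2 = 0%N by rewrite crd_oversize // hys.
rewrite big_moves /rand_own big_cons big_cat !big_map !big_nat1 !big_seq1 /=.
rewrite -[in RHS](point_rand_right hy) // -[in RHS](point_rand_left hy) //= addr0.
have nz : 1 - q ^+ (crd y 1 + 1) != 0 by rewrite subr_eq0 eq_sym addn1 q_not_root.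
have -> : rand_stay 1 [::] y = (c 1)^-1 * q ^ zc y (nparts 1).
  rewrite /rand_stay /rand_const /= !big_nat1 /own_right /own_left /= y2 !subn0.
  by rewrite !divff ?oner_eq0 // !mulr1 /zc -exprnP; ring.
rewrite ?addr0; ring.
Qed.

End Randomised.

Local Open Scope classical_set_scope.
Local Open Scope ring_scope.

(** * Patterns with a given last level *)

Lemma uniq_abox M k : uniq (abox M k).
Proof.
elim: k => //= k IH; apply: allpairs_uniq; rewrite ?uniq_box //.
by move=> [u x] [v y] _ _ /= /rcons_inj[-> ->].
Qed.

Lemma sizes_rcons k : [seq nparts j | j <- iota 1 k.+1] = rcons [seq nparts j | j <- iota 1 k] (nparts k.+1).
Proof. by rewrite -[in LHS](addn1 k) iotaD map_cat cats1 add1n. Qed.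

Lemma shape_abox M k u : u \in abox M k -> shape u = [seq nparts j | j <- iota 1 k].
Proof.
elim: k u => [|k IH] u; first by rewrite /= inE => /eqP ->.
move=> /allpairsP[[v x] /= [hv hx ->]].
rewrite -[nparts 1 :: _]/(map nparts (iota 1 k.+1)).
by rewrite sizes_rcons /shape map_rcons -(IH _ hv) (size_box hx).
Qed.

Lemma mem_abox M k u : shape u = [seq nparts j | j <- iota 1 k] ->
  all (all (fun e => (e < M)%N)) u -> u \in abox M k.
Proof.
elim: k u => [|k IH] u; first by case: u.
case/lastP: u => [|v x]; first by [].
rewrite sizes_rcons /shape map_rcons => /rcons_inj[hv hx].
rewrite all_rcons => /andP[hax hav].
apply/allpairsP; exists (v, x); split=> //=; first exact: IH.
by rewrite mem_box hx eqxx.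
Qed.

Lemma entryE z k i : entry z k i = crd (level z k) i.
Proof. by []. Qed.

Lemma sz_double n : nparts n.*2 = n.
Proof. by rewrite /nparts; lia. Qed.

Section LevelParameters.
Variables (F : fieldType) (n : nat) (a : 'I_n -> F).

(** The parameter of level [k]: [a_l] at level [2l - 1] and its inverse at level [2l]. *)
Definition level_par (k : nat) : F :=
  let b := if insub (k.-1)./2 is Some i then a i else 1 in
  if odd k then b else b^-1.

Lemma level_parE (l : 'I_n) : (level_par l.*2.+1 = a l) * (level_par l.*2.+2 = (a l)^-1).
Proof.
rewrite /level_par /= odd_double /= doubleK (_ : uphalf l.*2 = l); last by lia.
by rewrite (insubT (fun i => (i < n)%N) (ltn_ord l)); rewrite (_ : Sub _ _ = l) //; exact: val_inj.
Qed.

Hypothesis a_neq0 : forall i, a i != 0.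

Lemma level_par_neq0 k : level_par k != 0.
Proof.
rewrite /level_par; case: insub => [i|]; case: (odd k); rewrite ?invr_eq0 ?oner_eq0 //.
Qed.

Lemma level_par_odd k : odd k -> level_par k * level_par k.+1 = 1.
Proof.
move=> ho; rewrite /level_par ho /= ho /= (_ : k./2 = (k.-1)./2); last by lia.
by case: insub => [i|]; rewrite mulfV // oner_eq0.
Qed.

End LevelParameters.

Section PatternFacts.
Variable n : nat.

Lemma pattern_shape (z : array) : is_pattern n z -> shape z = [seq nparts j | j <- iota 1 n.*2].
Proof. by case/andP => /eqP. Qed.

Lemma pattern_size (z : array) : is_pattern n z -> size z = n.*2.
Proof. by move=> h; rewrite -(size_map size) -/(shape z) (pattern_shape h) size_map size_iota. Qed.

Lemma pattern_level_size (z : array) k : is_pattern n z -> (k <= n.*2)%N -> size (level z k) = nparts k.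
Proof.
move=> h hk; case: k hk => // k hk; rewrite /level /=.
rewrite -(nth_map _ 0%N) ?(pattern_size h) // -/(shape z) (pattern_shape h).
by rewrite (nth_map 0%N) ?size_iota // nth_iota // add1n.
Qed.

Lemma pattern_interlace (z : array) k i : is_pattern n z -> (k < n.*2)%N -> (0 < i)%N ->
  (crd (level z k.+1) i.+1 <= crd (level z k) i <= crd (level z k.+1) i)%N || (nparts k < i)%N.
Proof.
move=> h hk hi; case: ltnP => his; rewrite ?orbT // orbF.
case: k hk his => [|k] hk his; first by move: his; rewrite /nparts; lia.
case/andP: h => _ /allP /(_ k.+1); rewrite mem_iota => /(_ _)/allP h.
by apply: h; rewrite ?mem_iota //; move: his; rewrite /nparts; lia.
Qed.

Lemma pattern_crd (z : array) k i : is_pattern n z -> (k < n.*2)%N -> (0 < i)%N ->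
  (crd (level z k.+1) i.+1 <= crd (level z k) i)%N /\
  ((crd (level z k) i <= crd (level z k.+1) i)%N).
Proof.
move=> h hk hi; have hs1 := pattern_level_size h (ltnW hk); have hs2 := pattern_level_size h hk.
have := leq_szS k; case/orP: (pattern_interlace h hk hi) => [/andP[]//|his] h1.
by rewrite (@crd_oversize (level z k)) ?hs1 // crd_oversize // hs2; lia.
Qed.

Hypothesis n_gt0 : (0 < n)%N.

Lemma pattern_sorted (z : array) : is_pattern n z -> sorted geq (level z n.*2).
Proof.
move=> h; apply/(path.sortedP 0%N) => j hj.
have h1 : (n.*2.-1 < n.*2)%N by lia.
have [h2 _] := @pattern_crd z n.*2.-1 j.+1 h h1 isT.
have [_ h3] := @pattern_crd z n.*2.-1 j.+1 h h1 isT.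
by move: (leq_trans h2 h3); rewrite prednK ?double_gt0 //.
Qed.

Lemma pattern_bound (z : array) k i : is_pattern n z -> (k <= n.*2)%N ->
  (crd (level z k) i <= crd (level z n.*2) 1)%N.
Proof.
move=> h hk.
have hmono j : (0 < j)%N -> (crd (level z k) j <= crd (level z n.*2) j)%N.
  move=> hj; have [m hm] : exists m, (k + m)%N = n.*2 by exists (n.*2 - k)%N; lia.
  elim: m k hk hm => [|m IH] l hl hm; first by rewrite -hm addn0.
  have hl1 : (l < n.*2)%N by lia.
  have [_ h1] := pattern_crd h hl1 hj.
  by apply: leq_trans h1 (IH _ hl1 _); lia.
case: i => [|i] //; apply: leq_trans (hmono i.+1 isT) _.
have hs := pattern_sorted h.
elim: i => [|i IH] //; apply: leq_trans IH; exact: crd_sorted.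
Qed.

Lemma pattern_rcons (z : array) : is_pattern n z ->
  z = rcons (take n.*2.-1 z) (level z n.*2).
Proof.
move=> h; have hs := pattern_size h.
have e2 : n.*2 = n.*2.-1.+1 by lia.
rewrite -[LHS](cat_take_drop n.*2.-1 z) -cats1; congr (_ ++ _).
rewrite (drop_nth [::]) ?hs; last by lia.
rewrite -e2 drop_oversize ?hs // /level; congr [:: _].
by rewrite [X in _ = nth _ _ X]e2.
Qed.

Definition fibre (M : nat) (lam : seq nat) : seq (pattern n) :=
  pmap insub [seq rcons u lam | u <- abox M n.*2.-1].

Lemma uniq_fibre M lam : uniq (fibre M lam).
Proof.
apply: (pmap_uniq (@insubK _ _ _)).
by rewrite map_inj_uniq ?uniq_abox // => u v /rcons_inj[].
Qed.

(** By interlacing, every entry of a pattern is at most the first entry of its last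
    level: the set is finite. *)
Lemma fibre_set M lam : size lam = n -> all (fun e => (e < M)%N) lam ->
  [set z : pattern n | level (val z) n.*2 = lam] = [set` fibre M lam].
Proof.
move=> hlam hM; have e2 : n.*2 = n.*2.-1.+1 by lia.
apply/seteqP; split=> z /=.
  move=> hz; rewrite mem_pmap_sub; apply/mapP; exists (take n.*2.-1 (val z)).
    apply: mem_abox.
      rewrite /shape map_take -/(shape _) (pattern_shape (valP z)) -map_take.
      by rewrite take_iota; congr (map _ (iota _ _)); lia.
    apply/allP => x /mem_take hx; apply/allP => e he.
    have [k hk hxk] := nthP [::] hx.
    have [i hi hei] := nthP 0%N he.
    have hk1 : (k.+1 <= n.*2)%N by rewrite -(pattern_size (valP z)).
    have hb : (e <= crd lam 1)%N.
      rewrite -hz -hei (_ : nth 0%N x i = crd (level (val z) k.+1) i.+1); last first.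
        by rewrite /crd /level /= hxk.
      exact: (pattern_bound _ (valP z) hk1).
    apply: leq_ltn_trans hb _.
    case: lam hlam hM {hz} => [|l0 l] /=; first by lia.
    by move=> _ /andP[].
  by rewrite -hz; exact: pattern_rcons (valP z).
rewrite mem_pmap_sub => /mapP[u hu] ->.
have hs := size_abox hu.
by rewrite [X in level _ X]e2 -hs -cats1 level_cat.
Qed.

End PatternFacts.

Section Patterns.
Variables (F : fieldType) (q : F).
Variable n : nat.
Hypothesis n_gt0 : (0 < n)%N.
Variable a : 'I_n -> F.

Definition fibre_sum (lam : seq nat) (g : array -> F) : F :=
  \sum_(z \in [set z : pattern n | level (val z) n.*2 = lam]) weight a q (val z) * g (val z).

Lemma fibre_sum_seq M lam g : size lam = n -> all (fun e => (e < M)%N) lam ->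
  fibre_sum lam g = \sum_(z <- fibre n M lam) weight a q (val z) * g (val z).
Proof.
by move=> hlam hM; rewrite /fibre_sum (fibre_set n_gt0 hlam hM) -fsbig_seq // uniq_fibre.
Qed.

Hypothesis q_neq0 : q != 0.
Hypothesis q_not_root : forall m, q ^+ m.+1 != 1.
Hypothesis a_neq0 : forall i, a i != 0.

Local Notation kap := (slice_kernel q n (level_par a)).
Local Notation wt := (wt kap).
Local Notation PP := (link_product q n).

Lemma link_qbinom (x y y' : nat) : (y' <= x <= y)%N ->
  link q x y y' = qbinom q (y - y') (y - x).
Proof.
move=> /andP[h1 h2]; rewrite /link /qbinom !subzn //; last by exact: leq_trans h1 h2.
by rewrite /= (_ : (y - y' - (y - x) = x - y')%N) ?invfM ?mulrA //; lia.
Qed.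

Lemma link0 (y : nat) : link q 0 y 0 = 1.
Proof.
have i0 : qinvfact q 0 = 1 by rewrite /= /qpoch big_geq // invr1.
by rewrite /link !subr0 i0 mulr1 mulfV // qpoch_neq0.
Qed.

Lemma pattern_PP (z : array) k : is_pattern n z -> (k < n.*2)%N ->
  PP (zc (level z k)) (zc (level z k.+1)) =
  \prod_(1 <= i < (nparts k).+1)
    qbinom q (crd (level z k.+1) i - crd (level z k.+1) i.+1) (crd (level z k.+1) i - crd (level z k) i).
Proof.
move=> h hk.
have hkn : (nparts k <= n)%N by rewrite /nparts; lia.
rewrite /link_product (big_cat_nat _ (n := (nparts k).+1)) //=.
rewrite [X in _ * X]big_nat [X in _ * X]big1 ?mulr1; last first.
  move=> i /andP[hi1 hi2]; rewrite /zc.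
  rewrite (@crd_oversize (level z k) i) ?(pattern_level_size h (ltnW hk)) //.
  rewrite (@crd_oversize (level z k.+1) i.+1) ?link0 // (pattern_level_size h hk).
  by have := leq_szS k; lia.
apply: eq_big_nat => i hi; rewrite /zc link_qbinom //.
by have [|-> ->] := @pattern_crd n z k i h hk; case/andP: hi.
Qed.

(** The exponents of the parameters [a_l] regroup into differences of sizes of
    consecutive levels. *)
Lemma weight_wt (z : array) : is_pattern n z -> weight a q z = wt n.*2 z.
Proof.
move=> h; rewrite /weight.
pose G k := kap k.*2 (level z k.*2) (level z k.*2.+1) * kap k.*2.+1 (level z k.*2.+1) (level z k.*2.+2).
transitivity (\prod_(k < n) G k).
  apply: eq_bigr => k _; rewrite /G /slice_kernel !level_parE.
  have hk := ltn_ord k.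
  rewrite !pattern_PP //; [|lia|lia].
  rewrite exprz_inv.
  have -> : nparts k.*2 = k by rewrite sz_double.
  have -> : nparts k.*2.+1 = k.+1 by rewrite /nparts -doubleS doubleK.
  rewrite [X in _ = _ * (_ * X)]big_nat_recr //=.
  have -> : crd (level z k.*2.+2) k.+2 = 0%N.
    rewrite crd_oversize // (pattern_level_size h) //; last by lia.
    by rewrite /nparts; lia.
  rewrite subn0 big_split /=.
  set s1 := sumn _; set s0 := sumn _; set s2 := sumn _.
  have -> : 2 * s1%:Z - s0%:Z - s2%:Z = (s1%:Z - s0%:Z) + - (s2%:Z - s1%:Z) by ring.
  rewrite expfzDr // !entryE; ring.
rewrite -(big_mkord xpredT G).
have H m : \prod_(0 <= i < m) G i = wt m.*2 z; last exact: H.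
elim: m => [|m IH]; first by rewrite big_geq.
by rewrite big_nat_recr //= IH /G mulrA.
Qed.

Lemma wt_pattern M (u : array) lam : u \in abox M n.*2.-1 -> size lam = n ->
  wt n.*2 (rcons u lam) != 0 -> is_pattern n (rcons u lam).
Proof.
move=> hu hlam hw.
have en : n.*2 = n.*2.-1.+1 by lia.
have hkap k : (k < n.*2)%N -> kap k (level (rcons u lam) k) (level (rcons u lam) k.+1) != 0.
  elim: (n.*2) hw => // m IH /=; rewrite mulf_eq0 negb_or => /andP[h1 h2].
  by rewrite ltnS leq_eqVlt => /orP[/eqP ->|]; [|exact: IH].
apply/andP; split.
  have -> : [seq (k.+1)./2 | k <- iota 1 n.*2] = rcons [seq nparts j | j <- iota 1 n.*2.-1] n.
    by rewrite [in LHS]en -/(map nparts _) sizes_rcons -en sz_double.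
  by rewrite /shape map_rcons -/(shape u) (shape_abox hu) hlam.
apply/allP => k; rewrite mem_iota => hk; apply/allP => i; rewrite mem_iota => hi.
have hk' : (k < n.*2)%N by lia.
have hi' : (1 <= i <= n)%N by lia.
by have := kap_neq0 (hkap k hk') hi'; rewrite /zc !lez_nat.
Qed.

(** Arrays that do not interlace have weight [0], so a sum over patterns is one over
    all arrays in a box. *)
Lemma fibre_sumE M (lam : seq nat) (g : array -> F) : size lam = n -> all (fun e => (e < M)%N) lam ->
  fibre_sum lam g =
  \sum_(u <- abox M n.*2.-1) wt n.*2.-1 u * kap n.*2.-1 (level u n.*2.-1) lam * g (rcons u lam).
Proof.
move=> hlam hM; have e2 : n.*2 = n.*2.-1.+1 by lia.
rewrite (fibre_sum_seq g hlam hM) /fibre big_pmap big_map !big_seq; apply: eq_bigr => u hu.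
have hs := size_abox hu.
have hw : wt n.*2.-1 u * kap n.*2.-1 (level u n.*2.-1) lam = wt n.*2 (rcons u lam).
  by rewrite [in RHS]e2 -hs (wt_rcons _ u lam).
rewrite hw; case: insubP => [z hz hzu|hz] /=; first by rewrite hzu weight_wt.
have [->|h] := eqVneq (wt n.*2 (rcons u lam)) 0; first by rewrite mul0r.
by rewrite (wt_pattern hu hlam h) in hz.
Qed.

End Patterns.

(** * Intertwining with the last level, and the Pieri rule *)

Section ShapeOperator.
Variables (F : fieldType) (q : F) (n : nat).

(** The operator [L] of the introduction. *)
Definition shape_op (f : seq nat -> F) (lam : seq nat) : F :=
  \sum_(1 <= i < n.+1)
    (rate_right q lam i * f (inc i lam) + rate_left q lam i * f (dec i lam)).

Definition is_shape (lam : seq nat) : Prop := size lam = n /\ sorted geq lam.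

End ShapeOperator.

Section Fibres.
Variables (F : fieldType) (q : F).
Hypothesis q_neq0 : q != 0.
Hypothesis q_not_root : forall m, q ^+ m.+1 != 1.
Variable n : nat.
Hypothesis n_gt0 : (0 < n)%N.
Variable a : 'I_n -> F.
Hypothesis a_neq0 : forall i, a i != 0.

Local Notation c := (level_par a).
Local Notation kap := (slice_kernel q n c).
Local Notation fibre_sum := (fibre_sum q a).

Variable step : nat -> seq nat -> seq nat -> move -> seq (F * bool * move).
Variable own : nat -> seq nat -> seq nat -> seq (F * move).

(** The generator plus the total rate, as an operator on functions of all arrays. *)
Definition transition (g : array -> F) (z : array) : F :=
  mean step own n.*2 z (fun m y => g (perform m n.*2 y)).

Section Intertwining.
Variable rate : nat -> seq nat -> move -> seq nat -> F.

Hypothesis local0 : forall M y (Phi : move -> F), good n M 1 y ->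
  kap 0 [::] y * \sum_(o <- own 1 [::] y) o.1 * Phi o.2
  = \sum_(m <- moves 1) rate 1 y m [::] * kap 0 [::] (jump m y) * Phi m.

Hypothesis local : forall M k p y (Phi : move -> seq nat -> F), (0 < k)%N ->
  size p = nparts k.-1 -> good n M k.+1 y ->
  \sum_(x <- box (nparts k) M) kap k x y * (\sum_(m <- moves k) rate k x m p * kap k.-1 p (jump m x) *
      (\sum_(o <- step k x y m) o.1.1 * Phi o.2 (if o.1.2 then jump m x else x)))
  + \sum_(x <- box (nparts k) M) kap k x y * kap k.-1 p x * (\sum_(o <- own k.+1 x y) o.1 * Phi o.2 x)
  = \sum_(m <- moves k.+1) \sum_(x <- box (nparts k) M)
      rate k.+1 y m x * kap k.-1 p x * kap k x (jump m y) * Phi m x.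

(* The last level is even and its rates depend on nothing else. *)
Hypothesis rate_last : forall x m p, rate n.*2 x m p =
  match m with None => 0 | Some (true, i) => rate_right q x i | Some (false, i) => rate_left q x i end.

(** Both dynamics are covered at once: only the local balances and the rates of the last
    level matter. *)
Lemma fibre_intertwining lam g : is_shape n lam ->
  fibre_sum lam (transition g) = shape_op q n (fun mu => fibre_sum mu g) lam.
Proof.
move=> [hs hsort].
(* room for the largest part to grow and still be [good] *)
pose M := (crd lam 1).+3.
have e2 : n.*2 = n.*2.-1.+1 by lia.
have hb i : (0 < i)%N -> (crd lam i <= crd lam 1)%N.
  case: i => // i _; elim: i => [|i IH] //; apply: leq_trans IH; exact: crd_sorted.
have hall : all (fun e => (e.+2 < M)%N) lam.
  by apply/(all_nthP 0%N) => i hi; rewrite !ltnS; exact: (hb i.+1).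
have hgood : good n M n.*2.-1.+1 lam.
  rewrite -e2; split; rewrite ?sz_double //.
  by apply: sub_all hall => e /=; lia.
have hallM : all (fun e => (e < M)%N) lam by apply: sub_all hall => e /=; lia.
have hset i v : (0 < i <= n)%N -> (v < M)%N -> all (fun e => (e < M)%N) (set_nth 0%N lam i.-1 v).
  move=> hi hv; have := @box_set n M lam i v hi hv.
  by rewrite !mem_box hs eqxx /= hallM => /(_ isT) /andP[].
have hsz i v : (0 < i <= n)%N -> size (set_nth 0%N lam i.-1 v) = n.
  by move=> hi; rewrite size_set_crd hs.
rewrite (fibre_sumE n_gt0 q_neq0 q_not_root a_neq0 _ hs hallM).
rewrite /transition.
have H := @intertwining F step own M kap rate (good n M) (@good_below F q n M c)
   (@local0 M) (@local M) n.*2.-1 lam [::] (fun m y => g (perform m n.*2 y)) hgood.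
transitivity (\sum_(u <- abox M n.*2.-1) wt kap n.*2.-1 u * kap n.*2.-1 (level u n.*2.-1) lam *
   mean step own n.*2.-1.+1 (u ++ [:: lam]) (fun m y => g (perform m n.*2 y))).
  by apply: eq_bigr => u _; rewrite -e2 cats1.
rewrite H big_moves -e2 sz_double.
rewrite [X in X + _]big1 ?add0r; last by move=> u _; rewrite rate_last !mul0r.
have hterm m : (forall p, rate n.*2 lam m p = rate n.*2 lam m [::]) ->
    size (jump m lam) = n -> all (fun e => (e < M)%N) (jump m lam) ->
   \sum_(u <- abox M n.*2.-1) rate n.*2 lam m (level u n.*2.-1) * wt kap n.*2.-1 u *
     kap n.*2.-1 (level u n.*2.-1) (jump m lam) * g (perform m n.*2 (u ++ [:: lam]))
   = rate n.*2 lam m [::] * fibre_sum (jump m lam) g.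
  move=> hr h1 h2; rewrite (fibre_sumE n_gt0 q_neq0 q_not_root a_neq0 _ h1 h2) mulr_sumr !big_seq.
  apply: eq_bigr => u hu; rewrite hr.
  have -> : perform m n.*2 (u ++ [:: lam]) = rcons u (jump m lam).
    by rewrite [X in perform _ X]e2 -(size_abox hu) perform_cat cats1.
  ring.
rewrite -big_split; apply: eq_big_nat => i hi /=.
have hi' : (0 < i <= n)%N by lia.
have hbi : (crd lam i <= crd lam 1)%N by apply: hb; lia.
rewrite (hterm (mR i)) ?(hterm (mL i)) ?rate_last //=; try (by move=> p; rewrite !rate_last);
  try (by apply: hsz); by apply: hset => //; rewrite /M; lia.
Qed.

End Intertwining.

Lemma mean_const (C : nat -> F) z :
  (forall k x y s, \sum_(o <- step k x y s) o.1.1 = 1) ->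
  (forall k x y, \sum_(o <- own k x y) o.1 = C k) ->
  transition (fun=> 1) z = \sum_(1 <= j < n.*2.+1) C j.
Proof.
move=> hstep hown.
have hrun m y k s : run step m z y k s (fun _ _ => 1) = 1.
  elim: m y k s => //= m IH y k s; rewrite /step_mean.
  by under eq_bigr do rewrite IH mulr1.
rewrite /transition /mean; apply: eq_bigr => j _; rewrite /own_mean.
by under eq_bigr do rewrite hrun mulr1.
Qed.

End Fibres.

Section Pieri.
Variables (F : fieldType) (q : F).
Hypothesis q_neq0 : q != 0.
Hypothesis q_not_root : forall m, q ^+ m.+1 != 1.
Variable n : nat.
Hypothesis n_gt0 : (0 < n)%N.
Variable a : 'I_n -> F.
Hypothesis a_neq0 : forall i, a i != 0.
Local Notation c := (level_par a).

Definition rand_transition := transition n (rand_step F) (rand_own q c).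

Lemma sum_levels (V : nmodType) (f : nat -> V) :
  \sum_(1 <= j < n.*2.+1) f j = \sum_(l < n) (f l.*2.+1 + f l.*2.+2).
Proof.
rewrite -(big_mkord xpredT (fun l => f l.*2.+1 + f l.*2.+2)).
elim: (n) => [|m IH]; first by rewrite !big_geq.
by rewrite doubleS [LHS]big_nat_recr //= [X in X + _]big_nat_recr //= IH [RHS]big_nat_recr //= addrA.
Qed.

Lemma rand_intertwining lam g : is_shape n lam ->
  fibre_sum q a lam (rand_transition g) = shape_op q n (fun mu => fibre_sum q a mu g) lam.
Proof.
have c0 := level_par_neq0 a_neq0; have c1 := level_par_odd a_neq0.
apply: (fibre_intertwining q_neq0 q_not_root n_gt0 a_neq0 (rate := rand_level_rate q c)).
- by move=> M y Phi hy; exact: (rand_local0 q_neq0 q_not_root c0 Phi hy).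
- by move=> M k p y Phi hk hp hy; exact: (rand_local q_neq0 q_not_root c0 c1 hy p Phi hk).
- by move=> x [[[] i]|] p //=; rewrite odd_double.
Qed.

Lemma rand_mass z : rand_transition (fun=> 1) z = \sum_(l < n) (a l + (a l)^-1).
Proof.
rewrite /rand_transition (@mean_const _ _ _ _ (rand_const c)).
- rewrite sum_levels; apply: eq_bigr => l _.
  by rewrite /rand_const /= odd_double /= !level_parE addr0.
- by move=> k x y s; rewrite /rand_step big_seq1.
move=> k x y; rewrite /rand_own big_cons big_cat !big_map /= /rand_stay /index_iota !subn1 /=; ring.
Qed.

Lemma calP_fibre lam : calP q lam a = fibre_sum q a lam (fun=> 1).
Proof. by apply: eq_fsbigr => z _; rewrite mulr1. Qed.

(** The intertwining of the randomised dynamics, applied to the constant [1]. Being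
    algebraic, it holds at the points of the torus, where the rates have no probabilistic
    meaning. *)
Theorem pieri lam : is_shape n lam ->
  (\sum_(l < n) (a l + (a l)^-1)) * calP q lam a = shape_op q n (fun mu => calP q mu a) lam.
Proof.
move=> hl; have := rand_intertwining (fun=> 1) hl.
have -> : fibre_sum q a lam (rand_transition (fun=> 1)) =
   (\sum_(l < n) (a l + (a l)^-1)) * calP q lam a.
  have [hs _] := hl.
  pose M := (\max_(e <- lam) e).+1.
  have hM : all (fun e => (e < M)%N) lam.
    by apply/allP => e he; rewrite ltnS; apply: (@leq_bigmax_seq _ _ xpredT id e he).
  rewrite calP_fibre !(fibre_sumE n_gt0 q_neq0 q_not_root a_neq0 _ hs hM) mulr_sumr.
  by apply: eq_bigr => u _; rewrite rand_mass mulr1 mulrC.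
by move=> ->; apply: eq_bigr => i _; rewrite -!calP_fibre.
Qed.

End Pieri.

(** * The jump rates of the two chains *)

Section Rates.
Variables (R : realType) (q : R).
Variable n : nat.
Variable a : 'I_n -> R.
Local Notation c := (level_par a).

Definition berele_transition := transition n (berele_step q) (berele_own c).

Lemma left_jump_run m z y k i z' :
  left_jump q m z y k i z'
  = run (berele_step q) m z y k (mL i) (fun s y' => (perform s (k + m) y' == z')%:R).
Proof.
elim: m y k i => [|m IH] y k i; first by rewrite addn0.
rewrite -addSnnS /= /step_mean /= !big_cons big_nil /= addr0.
by rewrite !IH.
Qed.

Lemma right_attempt_run m z y k i z' :
  right_attempt q m z y k i z'
  = run (berele_step q) m z y k (mR i) (fun s y' => (perform s (k + m) y' == z')%:R).
Proof.
elim: m y k i => [|m IH] y k i; first by rewrite addn0.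
rewrite -addSnnS /= /step_mean /= !big_cons big_nil /= addr0.
rewrite -[(uphalf k)]/((k.+1)./2) -/(nparts k).
by case: (odd k && (i == nparts k)); rewrite /= !IH ?left_jump_run.
Qed.

Lemma berele_rateE (z z' : pattern n) :
  berele_rate q a z z' = berele_transition (fun y => (y == val z')%:R) (val z).
Proof.
rewrite /berele_transition /transition /mean sum_levels; apply: eq_bigr => l _.
rewrite /own_mean /berele_own !big_seq1 /= !level_parE !right_attempt_run.
have h1 : (l.*2.+1 + (n.*2 - l.*2.+1) = n.*2)%N by have := ltn_ord l; lia.
have h2 : (l.*2.+2 + (n.*2 - l.*2.+2) = n.*2)%N by have := ltn_ord l; lia.
by rewrite h1 h2.
Qed.

Lemma level_shift_gt f k i y l : (0 < k)%N -> (k < l)%N -> level (Defs.shift f k i y) l = level y l.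
Proof.
case: k => // k _; case: l => // l hl.
by rewrite /level /Defs.shift /= nth_set_nth /= ifF //; apply/eqP; lia.
Qed.

Lemma run_stop m z y k (phi : move -> array -> R) :
  run (rand_step R) m z y k None phi = phi None y.
Proof.
elim: m y k => //= m IH y k.
by rewrite /step_mean big_seq1 /= mul1r IH.
Qed.

(** The levels after that of the jumping particle have not moved yet, so the pushing
    condition can be read on the initial array. *)
Lemma push_left_run m z y k j z' : (0 < k)%N -> (forall l, (k <= l)%N -> level y l = level z l) ->
  run (rand_step R) m z y k (mL j) (fun s y' => (perform s (k + m) y' == z')%:R)
  = (push_left m k j y == z')%:R.
Proof.
elim: m y k j => [|m IH] y k j hk hz; first by rewrite addn0.
rewrite -addSnnS /= /step_mean /= big_seq1 /= mul1r.
rewrite /entry (hz k) // (hz k.+1) // -/(crd _ _) -/(crd _ _).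
case: ifP => _; last by rewrite run_stop.
by apply: IH => // l hl; rewrite level_shift_gt ?hz //; lia.
Qed.

Lemma push_right_run m z y k j z' : (0 < k)%N -> (forall l, (k <= l)%N -> level y l = level z l) ->
  run (rand_step R) m z y k (mR j) (fun s y' => (perform s (k + m) y' == z')%:R)
  = (push_right m k j y == z')%:R.
Proof.
elim: m y k j => [|m IH] y k j hk hz; first by rewrite addn0.
rewrite -addSnnS /= /step_mean /= big_seq1 /= mul1r.
rewrite /entry (hz k) // (hz k.+1) // -/(crd _ _) -/(crd _ _).
case: ifP => _; last by rewrite run_stop.
by apply: IH => // l hl; rewrite level_shift_gt ?hz //; lia.
Qed.

(** Off the diagonal only: the fictitious attempts contribute at [z' = z]. *)
Lemma randomised_rateE (z z' : pattern n) : z' != z ->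
  randomised_rate q a z z' = rand_transition q a (fun y => (y == val z')%:R) (val z).
Proof.
move=> hzz; rewrite /rand_transition /transition /mean sum_levels; apply: eq_bigr => l _.
have hl := ltn_ord l.
have H k : (0 < k <= n.*2)%N -> own_mean (rand_own q c) k (val z)
   (fun s y => run (rand_step R) (n.*2 - k) (val z) y k s (fun m y0 => (perform m n.*2 y0 == val z')%:R))
   = level_rate q n (c k) k (val z) (val z').
  move=> hk; rewrite /own_mean /rand_own big_cons big_cat !big_map /=.
  rewrite run_stop /= (_ : val z == val z' = false) ?mulr0 ?add0r; last first.
    by rewrite (inj_eq val_inj) eq_sym (negPf hzz).
  have e2 : n.*2 = (k + (n.*2 - k))%N by lia.
  rewrite /level_rate big_split /= /index_iota !subn1 /= -/(nparts k).
  congr (_ + _); apply: eq_bigr => j _; rewrite {2}e2.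
    by rewrite push_right_run //; lia.
  by rewrite push_left_run //; lia.
by rewrite !H ?level_parE //; lia.
Qed.

End Rates.

(** * Positivity and boundedness of the rates *)

Section FiniteFunctional.
Variable R : realType.

Definition finite_functional (Phi : (array -> R) -> R) : Prop :=
  exists os : seq (R * array), forall g, Phi g = \sum_(o <- os) o.1 * g o.2.

Lemma ff_eval y : finite_functional (fun g => g y).
Proof. by exists [:: (1, y)] => g; rewrite big_seq1 mul1r. Qed.

Lemma ff_scale r Phi : finite_functional Phi -> finite_functional (fun g => r * Phi g).
Proof.
move=> [os h]; exists [seq (r * o.1, o.2) | o <- os] => g.
by rewrite big_map h mulr_sumr; apply: eq_bigr => o _; rewrite mulrA.
Qed.

Lemma ff_sum (I : Type) (l : seq I) (Phi : I -> (array -> R) -> R) :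
  (forall i, finite_functional (Phi i)) -> finite_functional (fun g => \sum_(i <- l) Phi i g).
Proof.
move=> h; elim: l => [|i l [os hos]]; first by exists [::] => g; rewrite !big_nil.
have [os' hos'] := h i; exists (os' ++ os) => g.
by rewrite big_cons big_cat hos hos'.
Qed.

Lemma ff_run step m z y k s K :
  finite_functional (fun g => run step m z y k s (fun s' y' => g (perform s' K y'))).
Proof.
elim: m y k s => [|m IH] y k s /=; first exact: ff_eval.
by apply: ff_sum => o; apply: ff_scale.
Qed.

Lemma ff_transition n step own z : finite_functional (fun g => transition n step own g z).
Proof. by apply: ff_sum => j; apply: ff_sum => o; apply: ff_scale; exact: ff_run. Qed.

End FiniteFunctional.

Section Positivity.
Variables (R : realType) (n : nat) (step : nat -> seq nat -> seq nat -> move -> seq (R * bool * move)).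

(** A move of an actual particle, numbered from [1]; transmission preserves this. *)
Definition proper (s : move) : bool := if s is Some (_, i) then (0 < i)%N else true.

Variable z : array.
Hypothesis step_ge0 : forall k s o, (0 < k < n.*2)%N -> proper s ->
  o \in step k (level z k) (level z k.+1) s -> 0 <= o.1.1 /\ proper o.2.

Lemma run_ge0 m y k s phi : (0 < k)%N -> (k + m <= n.*2)%N -> proper s ->
  (forall s' y', 0 <= phi s' y') -> 0 <= run step m z y k s phi.
Proof.
move=> hk hm hs hphi; elim: m y k s hk hm hs => [|m IH] y k s hk hm hs //=.
rewrite /step_mean big_seq; apply: sumr_ge0 => o ho.
have [h1 h2] : 0 <= o.1.1 /\ proper o.2 by apply: (step_ge0 _ hs ho); lia.
by apply: mulr_ge0 => //; apply: IH => //; lia.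
Qed.
End Positivity.

Section Dynamics.
Variables (R : realType) (q : R) (n : nat) (a : 'I_n -> R).
Hypothesis q01 : 0 < q < 1.
Hypothesis n_gt0 : (0 < n)%N.
Hypothesis a_gt0 : forall i, 0 < a i.
Local Notation c := (level_par a).

Lemma q_neq0 : q != 0.
Proof. by case/andP: q01 => h _; rewrite gt_eqF. Qed.

Lemma expq_lt1 m : q ^+ m.+1 < 1.
Proof. by case/andP: q01 => h1 h2; apply: exprn_ilt1 => //; exact: ltW. Qed.

Lemma q_not_root m : q ^+ m.+1 != 1.
Proof. by rewrite lt_eqF // expq_lt1. Qed.

Lemma a_neq0 i : a i != 0.
Proof. by rewrite gt_eqF. Qed.

Lemma level_par_gt0 k : 0 < c k.
Proof. by rewrite /level_par; case: insub => [i|]; case: (odd k); rewrite ?invr_gt0 // ltr01. Qed.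

Lemma subexpq_ge0 m : 0 <= 1 - q ^+ m.
Proof. by case/andP: q01 => h1 h2; rewrite subr_ge0 exprn_ile1 // ltW. Qed.

Lemma subexpq_le1 m : 1 - q ^+ m <= 1.
Proof. by case/andP: q01 => h1 h2; rewrite gerBl exprn_ge0 // ltW. Qed.

Lemma expq_01 m : 0 <= q ^+ m <= 1.
Proof. by have := subexpq_ge0 m; have := subexpq_le1 m; lra. Qed.

Lemma ratio_01 m k : (m <= k)%N -> 0 <= (1 - q ^+ m) / (1 - q ^+ k) <= 1.
Proof.
case: k => [|k] hm; first by rewrite expr0 subrr invr0 mulr0 lexx ler01.
have h : 0 < 1 - q ^+ k.+1 by rewrite subr_gt0 expq_lt1.
rewrite divr_ge0 ?subexpq_ge0 //= ler_pdivrMr // mul1r lerD2l lerN2.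
by case/andP: q01 => h1 h2; apply: ler_wiXn2l => //; exact: ltW.
Qed.

Lemma mul_01 (x y : R) : 0 <= x <= 1 -> 0 <= y <= 1 -> 0 <= x * y <= 1.
Proof.
move=> /andP[x0 x1] /andP[y0 y1]; rewrite mulr_ge0 //=.
by rewrite -[1]mulr1; apply: ler_pM.
Qed.

Lemma prob_right_01 (z : array) k i : is_pattern n z -> (0 < k < n.*2)%N -> (0 < i)%N ->
  0 <= prob_right q (level z k) (level z k.+1) i <= 1.
Proof.
move=> hz /andP[hk0 hk]; case: i => [|[|i]] // _; apply: mul_01; try exact: expq_01.
  by rewrite /= divr1 ler01 lexx.
have [h1 h2] := pattern_crd hz hk (isT : (0 < i.+2)%N).
by apply: ratio_01; apply: leq_sub2l.
Qed.

Lemma prob_left_01 (z : array) k i : is_pattern n z -> (0 < k < n.*2)%N -> (0 < i)%N ->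
  0 <= prob_left q (level z k) (level z k.+1) i <= 1.
Proof.
move=> hz /andP[hk0 hk] hi; apply: mul_01; first exact: expq_01.
have [h1 h2] := pattern_crd hz hk hi.
by apply: ratio_01; apply: leq_sub2r.
Qed.

(** What the two chains have in common. [A] is the generator plus the total rate, as a
    finite combination of evaluations; its diagonal may be
    negative, hence the condition [g (val z) = 0] in the positivity clause. *)
Record dynamics (rate : pattern n -> pattern n -> R) (A : (array -> R) -> array -> R) (C : R) : Prop := {
  dyn_finite : forall z : pattern n, finite_functional (fun g => A g (val z));
  dyn_rate : forall z v : pattern n, v != z -> rate z v = A (fun y => (y == val v)%:R) (val z);
  dyn_mass : forall z : pattern n, A (fun=> 1) (val z) = \sum_(l < n) (a l + (a l)^-1);
  dyn_ge0 : forall (z : pattern n) g, (forall y, 0 <= g y) -> g (val z) = 0 -> 0 <= A g (val z);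
  dyn_le : forall (z : pattern n) g, (forall y, 0 <= g y <= 1) -> g (val z) = 0 -> A g (val z) <= C;
  dyn_intertwining : forall lam g, is_shape n lam ->
    fibre_sum q a lam (A g) = shape_op q n (fun mu => fibre_sum q a mu g) lam
}.

Lemma berele_ge0 (z : pattern n) g : (forall y, 0 <= g y) -> 0 <= berele_transition q a g (val z).
Proof.
move=> hg; rewrite /berele_transition /transition /mean big_nat; apply: sumr_ge0 => j hj.
rewrite /own_mean /berele_own big_seq1; apply: mulr_ge0; first exact: ltW (level_par_gt0 _).
apply: (run_ge0 (n := n)) => //; try lia.
move=> k [[[] i]|] o hk hs /=; rewrite !inE; last by move=> /eqP -> /=; rewrite ler01.
- have hp := prob_right_01 (valP z) hk hs.
  move=> /orP[] /eqP -> /=; first by case/andP: hp.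
  by case: ifP => _; split=> //; lra.
- have hp := prob_left_01 (valP z) hk hs.
  move=> /orP[] /eqP -> /=; first by case/andP: hp.
  by split=> //; lra.
Qed.

Lemma berele_mass z : berele_transition q a (fun=> 1) z = \sum_(l < n) (a l + (a l)^-1).
Proof.
rewrite /berele_transition (@mean_const _ _ _ _ c).
- by rewrite sum_levels; apply: eq_bigr => l _; rewrite !level_parE.
- move=> k x y [[[] i]|] /=; rewrite ?big_seq1 // !big_cons big_nil /=; ring.
- by move=> k x y; rewrite /berele_own big_seq1.
Qed.

Lemma berele_dynamics : dynamics (@berele_rate R q n a) (berele_transition q a)
  (\sum_(l < n) (a l + (a l)^-1)).
Proof.
have c0 := level_par_neq0 a_neq0; have c1 := level_par_odd a_neq0.
split.
- by move=> z; exact: ff_transition.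
- by move=> z v _; exact: berele_rateE.
- by move=> z; exact: berele_mass.
- by move=> z g hg _; exact: berele_ge0.
- move=> z g hg _; rewrite -(berele_mass (val z)).
  have [os hos] : finite_functional (fun g => berele_transition q a g (val z)) by exact: ff_transition.
  rewrite -subr_ge0 !hos -sumrB.
  have : 0 <= berele_transition q a (fun y => 1 - g y) (val z).
    by apply: berele_ge0 => y; rewrite subr_ge0; case/andP: (hg y).
  by rewrite hos; congr (0 <= _); apply: eq_bigr => o _; rewrite mulrBr.
- move=> lam g; rewrite /berele_transition.
  apply: (fibre_intertwining (step := berele_step q) (own := berele_own c) q_neq0 q_not_root n_gt0 a_neq0 (rate := berele_level_rate q)).
  + by move=> M y Phi hy; exact: (berele_local0 q_neq0 q_not_root c0 Phi hy).
  + by move=> M k p y Phi hk hp hy; exact: (berele_local q_neq0 q_not_root c0 c1 Phi hk hp hy).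
  + by move=> x [[[] i]|] p //=; rewrite /berele_top odd_double mulr1.
Qed.

Lemma gap_01 i m : 0 <= edge_gap q i m <= 1.
Proof. by case: i => [|i] /=; rewrite ?ler01 ?lexx // subexpq_ge0 subexpq_le1. Qed.

Lemma ratio1_bound i m k : 0 <= edge_gap q i m / edge_gap q i (k + 1) <= (1 - q)^-1.
Proof.
have [h0 h1] := andP q01.
have hq : 0 < 1 - q by rewrite subr_gt0.
have hi : 1 <= (1 - q)^-1 by rewrite invf_ge1 // gerBl ltW.
case: i => [|i] /=; first by rewrite divr1 ler01.
have hk : 1 - q <= 1 - q ^+ (k + 1).
  by rewrite lerD2l lerN2 addn1 exprS ger_pMr // exprn_ile1 // ltW.
have hk0 : 0 < 1 - q ^+ (k + 1) by exact: lt_le_trans hk.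
rewrite divr_ge0 ?subexpq_ge0 ?(ltW hk0) //=.
apply: (@le_trans _ _ (1 - q ^+ (k + 1))^-1); last by rewrite lef_pV2.
by rewrite ger_pMl ?invr_gt0 // subexpq_le1.
Qed.

Lemma own_right_bound k x y j : 0 <= own_right q c k x y j <= c k / (1 - q).
Proof.
rewrite /own_right; have hc := level_par_gt0 k; have /andP[g0 g1] := gap_01 j.-1 (crd x j.-1 - crd y j).
have := ratio1_bound 1 (crd y j - crd y j.+1 + 1) (crd y j - crd x j); rewrite /= => /andP[r0 r1].
rewrite -mulrA; apply/andP; split; first by apply: mulr_ge0; [exact: ltW|exact: mulr_ge0].
rewrite ler_pM2l //; apply: le_trans r1; exact: ler_piMl.
Qed.

Lemma own_left_bound k x y j : 0 <= own_left q c k x y j <= (c k)^-1 / (1 - q).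
Proof.
rewrite /own_left; have hc := level_par_gt0 k.
have /andP[r0 r1] := ratio1_bound j.-1 (crd y j.-1 - crd y j + 1) (crd x j.-1 - crd y j).
have s0 := subexpq_ge0 (crd y j - crd x j); have s1 := subexpq_le1 (crd y j - crd x j).
have hc' : 0 < (c k)^-1 by rewrite invr_gt0.
rewrite -mulrA; apply/andP; split; first by apply: mulr_ge0; [exact: ltW|exact: mulr_ge0].
rewrite ler_pM2l ?invr_gt0 //; apply: le_trans r1; exact: ler_piMl.
Qed.

Lemma rand_step_ge0 z k s o : (0 < k < n.*2)%N -> proper s ->
  o \in rand_step R k (level z k) (level z k.+1) s -> 0 <= o.1.1 /\ proper o.2.
Proof.
move=> _ hs; rewrite /rand_step inE => /eqP -> /=; split; first exact: ler01.
by case: s hs => [[[] i]|] //= hi; case: ifP.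
Qed.

Lemma rand_run_le1 m z y k s (phi : move -> array -> R) :
  (forall s' y', phi s' y' <= 1) -> run (rand_step R) m z y k s phi <= 1.
Proof.
move=> hphi; elim: m y k s => //= m IH y k s.
by rewrite /step_mean /rand_step big_seq1 /= mul1r.
Qed.

Lemma rand_transitionE z (g : array -> R) : g z = 0 ->
  rand_transition q a g z = \sum_(1 <= k < n.*2.+1) \sum_(1 <= j < (nparts k).+1)
   (own_right q c k (level z k.-1) (level z k) j *
      run (rand_step R) (n.*2 - k) z z k (mR j) (fun s y => g (perform s n.*2 y))
    + own_left q c k (level z k.-1) (level z k) j *
      run (rand_step R) (n.*2 - k) z z k (mL j) (fun s y => g (perform s n.*2 y))).
Proof.
move=> hg; apply: eq_big_nat => k _.
rewrite /own_mean /rand_own big_cons big_cat !big_map /= run_stop /= hg mulr0 add0r.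
by rewrite -big_split /index_iota subn1.
Qed.

(** Ratios of the form [(1 - q^m) / (1 - q^(k + 1))] are at most [1 / (1 - q)]. *)
Definition rand_bound : R :=
  \sum_(1 <= k < n.*2.+1) \sum_(1 <= j < (nparts k).+1) (c k / (1 - q) + (c k)^-1 / (1 - q)).

Lemma rand_dynamics : dynamics (@randomised_rate R q n a) (rand_transition q a) rand_bound.
Proof.
split.
- by move=> z; exact: ff_transition.
- by move=> z v hv; exact: randomised_rateE.
- by move=> z; exact: rand_mass.
- move=> z g hg hgz; rewrite rand_transitionE // big_nat; apply: sumr_ge0 => k hk.
  rewrite big_nat; apply: sumr_ge0 => j hj.
  have /andP[h1 _] := own_right_bound k (level (val z) k.-1) (level (val z) k) j.
  have /andP[h2 _] := own_left_bound k (level (val z) k.-1) (level (val z) k) j.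
  by apply: addr_ge0; apply: mulr_ge0 => //; apply: (run_ge0 (@rand_step_ge0 (val z))) => //=; lia.
- move=> z g hg hgz; rewrite rand_transitionE // /rand_bound.
  apply: ler_sum_nat => k hk; apply: ler_sum_nat => j hj.
  have /andP[h1 h1'] := own_right_bound k (level (val z) k.-1) (level (val z) k) j.
  have /andP[h2 h2'] := own_left_bound k (level (val z) k.-1) (level (val z) k) j.
  by apply: lerD; (apply: le_trans; last by [eassumption]); apply: ler_piMr => //;
     apply: rand_run_le1 => s y; case/andP: (hg (perform s n.*2 y)).
- by move=> lam g; apply: rand_intertwining => //; [exact: q_neq0|exact: q_not_root|exact: a_neq0].
Qed.

End Dynamics.

(** * Linear differential systems with bounded coefficients *)

Section TaylorGrowth.
Variable R : realType.

Lemma right_limit_delta (f : R -> R) (l eps : R) : 0 < eps -> f h @[h --> 0^'+] --> l ->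
  exists2 d : R, 0 < d & forall h, 0 < h < d -> `|f h - l| <= eps.
Proof.
move=> e0 /cvgrPdist_le /(_ _ e0) [d /= d0 H]; exists d => // h /andP[h0 hd].
rewrite distrC; apply: H => //=.
by rewrite sub0r normrN gtr0_norm.
Qed.

Lemma derive_continuous (f g : R -> R) : (forall t : R, is_derive t 1 f (g t)) -> continuous f.
Proof.
by move=> h t; apply/differentiable_continuous/derivable1_diffP; have [] := h t.
Qed.

Lemma ge0_derive_le (f g : R -> R) (T : R) : continuous f ->
  (forall t : R, 0 < t < T -> is_derive t 1 f (g t)) -> (forall t, 0 < t < T -> 0 <= g t) ->
  forall t, 0 <= t <= T -> f 0 <= f t.
Proof.
move=> cf df hg t /andP[]; rewrite le_eqVlt => /orP[/eqP <- //|t0] tT.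
have hin x : x \in `]0, t[ -> 0 < x < T.
  by rewrite in_itv /= => /andP[x0 xt]; rewrite x0 (lt_le_trans xt).
have [x hx e] := @MVT R f g 0 t t0 (fun x hx => df x (hin x hx)) (continuous_subspaceT cf).
by rewrite -subr_ge0 e mulr_ge0 ?hg ?hin // subr0 ltW.
Qed.

Lemma is_derive_pow (K : nat) (s : R) :
  is_derive s 1 (fun s : R => s ^+ K.+1 / K.+1`!%:R) (s ^+ K / K`!%:R).
Proof.
have -> : (fun s : R => s ^+ K.+1 / K.+1`!%:R) = (K.+1`!%:R)^-1 \*: (id ^+ K.+1 : R -> R).
  by apply/funext => x; rewrite mulrC -[RHS]/(_ * (id ^+ K.+1 : R -> R) x) exprfctE.
apply: is_derive_eq; rewrite /= -[LHS]/(_ * (_ * _)) mulr1 factS natrM.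
have h1 : K`!%:R != 0 :> R by rewrite pnatr_eq0 -lt0n fact_gt0.
have h2 : K.+1%:R != 0 :> R by rewrite pnatr_eq0.
by field; rewrite h1 nat1r h2.
Qed.

(** Integration of the bound on the derivative. *)
Lemma growth_bound (f g : R -> R) (T c : R) (K : nat) : f 0 = 0 -> continuous f ->
  (forall t : R, 0 < t < T -> is_derive t 1 f (g t)) ->
  (forall t, 0 < t < T -> `|g t| <= c * (t ^+ K / K`!%:R)) ->
  forall t, 0 <= t <= T -> `|f t| <= c * (t ^+ K.+1 / K.+1`!%:R).
Proof.
move=> f0 cf df hg t ht.
pose m : R -> R := c \*: (fun s : R => s ^+ K.+1 / K.+1`!%:R).
have dm (s : R) : is_derive s 1 m (c * (s ^+ K / K`!%:R)).
  by apply: is_deriveZ; exact: is_derive_pow.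
have cm : continuous m by apply: derive_continuous dm.
have m0 : m 0 = 0 by rewrite -[LHS]/(c * (0 ^+ K.+1 / K.+1`!%:R)) expr0n /= mul0r mulr0.
rewrite -[leRHS]/(m t) ler_norml; apply/andP; split.
  suff H : (m + f) 0 <= (m + f) t.
    move: H; rewrite -[(m + f) 0]/(m 0 + f 0) -[(m + f) t]/(m t + f t) m0 f0; lra.
  apply: (@ge0_derive_le (m + f) (fun s => c * (s ^+ K / K`!%:R) + g s) T _ _ _ t ht).
  - by move=> s; apply: cvgD; [exact: cm|exact: cf].
  - by move=> s hs; have H1 := dm s; have H2 := df s hs; exact: is_deriveD.
  - by move=> s hs; have := hg s hs; rewrite ler_norml => /andP[h _]; lra.
suff H : (m - f) 0 <= (m - f) t.
  move: H; rewrite -[(m - f) 0]/(m 0 - f 0) -[(m - f) t]/(m t - f t) m0 f0; lra.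
apply: (@ge0_derive_le (m - f) (fun s => c * (s ^+ K / K`!%:R) - g s) T _ _ _ t ht).
- by move=> s; apply: cvgB; [exact: cm|exact: cf].
- by move=> s hs; have H1 := dm s; have H2 := df s hs; exact: is_deriveB.
- by move=> s hs; have := hg s hs; rewrite ler_norml => /andP[_ h]; lra.
Qed.

End TaylorGrowth.

Section Expansion.
Variables (R : realType) (S : eqType).
Variables (supp : S -> seq S) (A : S -> S -> R).

(** The entry [(x, y)] of the [K]-th power of the matrix [A], whose row [x] is supported
    on [supp x]. *)
Fixpoint mpow (K : nat) (x y : S) : R :=
  if K is K'.+1 then \sum_(v <- supp x) A x v * mpow K' v y else (x == y)%:R.

Variables (f : S -> R -> R) (y : S) (T B M : R).
Hypothesis f_cont : forall x, continuous (f x).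
Hypothesis f_derive : forall x (t : R), 0 < t < T -> is_derive t 1 (f x) (\sum_(v <- supp x) A x v * f v t).
Hypothesis f_init : forall x, f x 0 = (x == y)%:R.
Hypothesis f_bound : forall x t, 0 <= t <= T -> `|f x t| <= B.
Hypothesis A_bound : forall x, \sum_(v <- supp x) `|A x v| <= M.

Definition taylor (K : nat) (x : S) (t : R) : R :=
  \sum_(0 <= k < K) t ^+ k / k`!%:R * mpow k x y.

Lemma taylor_derive K x (t : R) :
  is_derive t 1 (taylor K.+1 x) (\sum_(v <- supp x) A x v * taylor K v t).
Proof.
have -> : taylor K.+1 x = cst (mpow 0 x y) + \sum_(k < K) (mpow k.+1 x y \*: (fun s : R => s ^+ k.+1 / k.+1`!%:R)).
  apply/funext => s; rewrite /taylor big_nat_recl //= expr0 divr1 mul1r.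
  rewrite -[RHS]/(_ + _) fct_sumE; congr (_ + _); rewrite big_mkord.
  by apply: eq_bigr => k _; rewrite mulrC.
apply: is_derive_eq.
  apply: is_deriveD; apply: is_derive_sum => k; apply: is_deriveZ; exact: is_derive_pow.
rewrite add0r /taylor; under [RHS]eq_bigr do rewrite big_mkord mulr_sumr.
rewrite exchange_big /=; apply: eq_bigr => k _.
rewrite -[LHS]/(_ * _) mulr_suml; apply: eq_bigr => v _; ring.
Qed.

(** By induction on [K]: the remainder of order [K + 1] has as derivative the matrix
    applied to the remainder of order [K]. The point is that the bound is uniform in
    [x], as infinitely many unknowns are coupled. *)
Lemma taylor_remainder K x t : 0 <= t <= T ->
  `|f x t - taylor K x t| <= B * M ^+ K * (t ^+ K / K`!%:R).
Proof.
elim: K x t => [|K IH] x t ht.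
  by rewrite /taylor big_geq // subr0 expr0 divr1 !mulr1; exact: f_bound.
apply: (@growth_bound R (f x - taylor K.+1 x)
  (fun t => \sum_(v <- supp x) A x v * f v t - \sum_(v <- supp x) A x v * taylor K v t) T _ K) => //.
- rewrite -[LHS]/(f x 0 - taylor K.+1 x 0) f_init /taylor big_nat_recl //= expr0 divr1 mul1r.
  by rewrite big1 ?addr0 ?subrr // => k _; rewrite expr0n !mul0r.
- move=> s; apply: cvgB; first exact: f_cont.
  exact: (derive_continuous (taylor_derive K x)).
- by move=> s hs; have H1 := taylor_derive K x s; have H2 := f_derive x hs; exact: is_deriveB.
move=> s hs; rewrite -sumrB; under eq_bigr do rewrite -mulrBr.
apply: le_trans (ler_norm_sum _ _ _) _.
have hs' : 0 <= s <= T by case/andP: hs => h1 h2; rewrite !ltW.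
apply: (@le_trans _ _ (\sum_(v <- supp x) `|A x v| * (B * M ^+ K * (s ^+ K / K`!%:R)))).
  by apply: ler_sum => v _; rewrite normrM ler_wpM2l // IH.
rewrite -mulr_suml exprSr mulrA [_ * M]mulrC -!mulrA; apply: ler_wpM2r; last exact: A_bound.
by have := IH x s hs'; rewrite -!mulrA; apply: le_trans.
Qed.

Lemma taylor_cvg x t : 0 <= t <= T -> taylor K x t @[K --> \oo] --> f x t.
Proof.
move=> ht.
have h : B * exp_coeff (M * t) K @[K --> \oo] --> (0 : R).
  by rewrite -[X in _ --> X](mulr0 B); apply: cvgMr; exact: cvg_exp_coeff.
apply/cvgrPdist_le => e e0; move/cvgrPdist_le : h => /(_ _ e0).
apply: filterS => K; rewrite sub0r normrN => h.
apply: le_trans (taylor_remainder K x ht) _; apply: le_trans h.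
by rewrite -mulrA [X in B * X]mulrA -exprMn; exact: ler_norm.
Qed.

End Expansion.

(** * Transition functions of chains with bounded rates *)

Section EsumFinite.
Variables (R : realType) (S : choiceType).

Lemma esum_ge_seq (f : S -> R) (r : R) (s : seq S) : (forall x, 0 <= f x) ->
  (\esum_(v in [set: S]) (f v)%:E = r%:E)%E -> uniq s -> \sum_(v <- s) f v <= r.
Proof.
move=> f0 hr us; rewrite -lee_fin -hr; apply: esum_ge.
exists [set` s]; first by split=> //; exact: finite_seq.
by rewrite -fsbig_seq // sumEFin.
Qed.
End EsumFinite.

Section Backward.
Variables (R : realType) (S : choiceType) (rate : S -> S -> R) (p : R -> S -> S -> R).
Hypothesis hp : is_transition_function rate p.
Let p0 := transition_ge0 hp.

Lemma p_sum_le1 (t : R) x s : 0 <= t -> uniq s -> \sum_(v <- s) p t x v <= 1.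
Proof.
move=> ht; apply: esum_ge_seq; first by move=> v; exact: p0.
by rewrite (transition_sum1 hp).
Qed.

Lemma p_le1 (t : R) x v : 0 <= t -> p t x v <= 1.
Proof. by move=> ht; have := @p_sum_le1 t x [:: v] ht isT; rewrite big_seq1. Qed.

Lemma p_lower (s t : R) x y l : 0 <= s -> 0 <= t -> uniq l ->
  \sum_(v <- l) p s x v * p t v y <= p (s + t) x y.
Proof.
move=> hs ht; apply: esum_ge_seq; first by move=> v; apply: mulr_ge0; exact: p0.
by rewrite (transition_add hp).
Qed.

(** The Chapman-Kolmogorov sum restricted to a finite set misses at most the mass
    outside that set. *)
Lemma p_upper (s t : R) x y l : 0 <= s -> 0 <= t -> uniq l ->
  p (s + t) x y <= \sum_(v <- l) p s x v * p t v y + (1 - \sum_(v <- l) p s x v).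
Proof.
move=> hs ht ul.
have h0 v : 0 <= p s x v * (1 - p t v y) by rewrite mulr_ge0 ?p0 // subr_ge0 p_le1.
have h : (\esum_(v in [set: S]) (p s x v * (1 - p t v y))%:E = (1 - p (s + t) x y)%:E)%E.
  have := transition_sum1 hp x hs.
  rewrite (@eq_esum _ _ _ _ (fun v => (p s x v * p t v y)%:E + (p s x v * (1 - p t v y))%:E)%E); last first.
    by move=> v _; rewrite -EFinD; congr EFin; ring.
  rewrite esumD.
  - rewrite (transition_add hp) // => h.
    by rewrite -[LHS](@addeK R (p (s + t) x y)%:E) // [X in (X - _)%E]addeC h EFinB.
  - by move=> v _; rewrite lee_fin mulr_ge0 ?p0.
  - by move=> v _; rewrite lee_fin.
have := esum_ge_seq h0 h ul; under eq_bigr do rewrite mulrBr mulr1.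
rewrite sumrB; lra.
Qed.

Lemma p_increment (h t : R) x y : 0 <= h -> 0 <= t -> `|p (h + t) x y - p t x y| <= 1 - p h x x.
Proof.
move=> hh ht; have := @p_lower h t x y [:: x] hh ht isT; have := @p_upper h t x y [:: x] hh ht isT.
rewrite !big_seq1 => h1 h2.
have a0 := p0 x x hh; have a1 := p_le1 x x hh; have b0 := p0 x y ht; have b1 := p_le1 x y ht.
by rewrite ler_norml; apply/andP; split; nra.
Qed.

Variables (supp : S -> seq S) (A : S -> S -> R) (e : R).
Hypothesis supp_uniq : forall x, uniq (supp x).
Hypothesis supp_self : forall x, x \in supp x.
Hypothesis q_matrixE : forall x v, q_matrix rate x v = A x v - e * (x == v)%:R.
Hypothesis A_mass : forall x, \sum_(v <- supp x) A x v = e.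

Let Q x v := q_matrix rate x v.
Let D h x v := (p h x v - p 0 x v) / h.

Lemma D_cvg x v : D h x v @[h --> 0^'+] --> Q x v.
Proof. exact: (transition_derive hp). Qed.

Lemma sum_self x (g : S -> R) : \sum_(v <- supp x) (x == v)%:R * g v = g x.
Proof.
rewrite (bigD1_seq x) //= eqxx mul1r big1 ?addr0 // => v; rewrite eq_sym => /negPf ->.
by rewrite mul0r.
Qed.

Lemma Q_sum0 x : \sum_(v <- supp x) Q x v = 0.
Proof.
rewrite /Q; under eq_bigr do rewrite q_matrixE.
rewrite sumrB A_mass -mulr_sumr; under eq_bigr do rewrite -[_%:R]mulr1.
by rewrite sum_self mulr1 subrr.
Qed.

(* A bound for the error of one Euler step, which does not depend on the time at which
   the step is taken. *)
Let eta x h := \sum_(v <- supp x) `|D h x v - Q x v| + `|\sum_(v <- supp x) D h x v|.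

Lemma eta_cvg x : eta x h @[h --> 0^'+] --> (0 : R).
Proof.
rewrite -[X in _ --> X](addr0 0).
have cvg_sum (s : seq S) (g : S -> R -> R) (l : S -> R) :
  (forall v, g v h @[h --> 0^'+] --> l v) -> \sum_(v <- s) g v h @[h --> 0^'+] --> \sum_(v <- s) l v.
  move=> hg; elim: s => [|v s IH].
    by under eq_fun do rewrite big_nil; rewrite big_nil; exact: cvg_cst.
  by under eq_fun do rewrite big_cons; rewrite big_cons; apply: cvgD.
apply: cvgD.
  have s0 : \sum_(v <- supp x) (0 : R) = 0 by rewrite big1.
  rewrite -[X in _ --> X]s0.
  apply: (cvg_sum _ (fun v h => `|D h x v - Q x v|) (fun=> 0)) => v.
  rewrite -[X in _ --> X](normr0 R); apply: cvg_norm.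
  by rewrite -[X in _ --> X](subrr (Q x v)); apply: cvgB; [exact: D_cvg|exact: cvg_cst].
have h2 : `|\sum_(v <- supp x) D h x v| @[h --> 0^'+] --> `|\sum_(v <- supp x) Q x v|.
  by apply: cvg_norm; apply: (cvg_sum _ (fun v h => D h x v) (Q x)) => v; exact: D_cvg.
by rewrite Q_sum0 normr0 in h2.
Qed.

Let G x y t := \sum_(v <- supp x) Q x v * p t v y.

(** The second term of [eta] bounds the mass that leaves [supp x] during the first
    time step. *)
Lemma euler_step x y (h t : R) : 0 < h -> 0 <= t ->
  `|(p (h + t) x y - p t x y) / h - G x y t| <= eta x h.
Proof.
move=> h0 ht; have hh := ltW h0.
have hl := p_lower x y hh ht (supp_uniq x); have hu := p_upper x y hh ht (supp_uniq x).
have eD : \sum_(v <- supp x) p h x v * p t v y - p t x y = h * \sum_(v <- supp x) D h x v * p t v y.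
  rewrite mulr_sumr -[in LHS](sum_self x (fun v => p t v y)) -sumrB; apply: eq_bigr => v _.
  rewrite /D (transition_0 hp) -mulrBl mulrA; congr (_ * _); rewrite mulrCA mulfV ?mulr1 //.
  by rewrite gt_eqF.
have eS : 1 - \sum_(v <- supp x) p h x v = - (h * \sum_(v <- supp x) D h x v).
  rewrite mulr_sumr -(sum_self x (fun=> 1)) -sumrB -sumrN; apply: eq_bigr => v _.
  rewrite /D (transition_0 hp) mulr1 mulrCA mulfV ?mulr1 ?opprB //.
  by rewrite gt_eqF.
set r := p (h + t) x y - \sum_(v <- supp x) p h x v * p t v y.
have r0 : 0 <= r by rewrite /r subr_ge0.
have r1 : r <= `|h * \sum_(v <- supp x) D h x v|.
  apply: le_trans (_ : r <= 1 - \sum_(v <- supp x) p h x v) _; first by rewrite /r; lra.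
  by rewrite eS -normrN; exact: ler_norm.
have -> : (p (h + t) x y - p t x y) / h - G x y t =
    \sum_(v <- supp x) (D h x v - Q x v) * p t v y + r / h.
  have -> : p (h + t) x y - p t x y = r + h * \sum_(v <- supp x) D h x v * p t v y.
    by rewrite -eD /r; ring.
  under [in RHS]eq_bigr do rewrite mulrBl.
  rewrite sumrB mulrDl [h * _]mulrC mulfK ?gt_eqF // /G; ring.
rewrite /eta; apply: le_trans (ler_normD _ _) _; apply: lerD.
  apply: le_trans (ler_norm_sum _ _ _) _; apply: ler_sum => v _.
  by rewrite normrM ler_piMr // ger0_norm ?p0 // p_le1.
rewrite normrM normfV (ger0_norm r0) (ger0_norm hh) ler_pdivrMr //.
by rewrite mulrC; move: r1; rewrite normrM (ger0_norm hh).
Qed.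

Lemma p_self_cvg x : 1 - p h x x @[h --> 0^'+] --> (0 : R).
Proof.
have h0 : h * D h x x @[h --> 0^'+] --> 0 * Q x x.
  by apply: cvgM; [apply: cvg_within_filter; exact: cvg_id|exact: D_cvg].
have h1 : - (h * D h x x) @[h --> 0^'+] --> - (0 * Q x x) by apply: cvgN; exact: h0.
rewrite mul0r oppr0 in h1.
apply: cvg_trans h1; apply: near_eq_cvg; near=> h.
rewrite /D (transition_0 hp) eqxx mulrCA mulfV ?mulr1 ?opprB //.
Unshelve. all: end_near. Qed.

(** Constant before time [0], so as to be continuous on the whole line. *)
Definition pext x y (t : R) := p (Num.max t 0) x y.

Lemma pext_cont x y : continuous (pext x y).
Proof.
move=> t; apply/cvgrPdist_le => eps e0.
have [d d0 hd] := right_limit_delta e0 (p_self_cvg x).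
have key s s' : 0 <= s -> s <= s' -> s' - s < d -> `|p s' x y - p s x y| <= eps.
  move=> hs hss hd'; have [->|ne] := eqVneq s s'; first by rewrite subrr normr0 ltW.
  have hpos : 0 < s' - s by rewrite subr_gt0 lt_neqAle ne.
  have := @p_increment (s' - s) s x y (ltW hpos) hs; rewrite subrK => /le_trans; apply.
  have := hd (s' - s); rewrite hpos hd' subr0 => /(_ isT); apply: le_trans; exact: ler_norm.
near=> s; rewrite /pext.
have hst : `|t - s| < d by near: s; exact: cvgr_dist_lt.
have m1 : 0 <= Num.max t 0 by rewrite le_max lexx orbT.
have m2 : 0 <= Num.max s 0 by rewrite le_max lexx orbT.
have hmm : `|Num.max t 0 - Num.max s 0| < d.
  apply: le_lt_trans hst.
  have a1 := ler_norm (t - s); have a2 := ler_norm (s - t); rewrite (distrC s t) in a2.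
  by rewrite ler_norml /Num.max; case: ltP => h1; case: ltP => h2; apply/andP; split; lra.
case: (leP (Num.max s 0) (Num.max t 0)) => hle.
  by apply: key => //; move: hmm; rewrite ger0_norm // subr_ge0.
rewrite distrC; apply: key => //; first exact: ltW.
by move: hmm; rewrite ltr0_norm ?opprB // subr_lt0.
Unshelve. all: end_near. Qed.

Lemma pextE x y t : 0 <= t -> pext x y t = p t x y.
Proof. by move=> ht; rewrite /pext /Num.max ltNge ht. Qed.

Lemma G_cont x y : continuous (fun t => \sum_(v <- supp x) Q x v * pext v y t).
Proof.
have -> : (fun t => \sum_(v <- supp x) Q x v * pext v y t) =
    \sum_(v <- supp x) (fun t => Q x v * pext v y t).
  by apply/funext => t; rewrite fct_sumE.
move=> t; elim: (supp x) => [|v s IH].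
  by rewrite big_nil; exact: cvg_cst.
rewrite big_cons; apply: cvgD; last exact: IH.
by apply: cvgM; [exact: cvg_cst|exact: pext_cont].
Qed.

(** The backward equation. The left derivative is obtained from the Euler step
    started at the earlier time, by uniformity of [eta] and continuity of the right-hand
    side. *)
Lemma pext_derive x y (t : R) : 0 < t ->
  is_derive t 1 (pext x y) (\sum_(v <- supp x) Q x v * pext v y t).
Proof.
move=> t0; set g := (X in is_derive _ _ _ X).
suff hc : h^-1 *: ((pext x y \o shift t) (h *: 1) - pext x y t) @[h --> 0^'] --> g.
  by apply: DeriveDef; [apply/cvg_ex; exists g|exact: cvg_lim].
apply/cvgrPdist_le => eps e0.
have e20 : 0 < eps / 2 by rewrite divr_gt0.
have [d d0 hd] := right_limit_delta e20 (eta_cvg x).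
have hG := @G_cont x y t; move/cvgrPdist_le : hG => /(_ _ e20) [d' /= d'0 hG].
have GE s : 0 <= s -> \sum_(v <- supp x) Q x v * pext v y s = G x y s.
  by move=> hs; apply: eq_bigr => v _; rewrite pextE.
near=> h.
have h_neq0 : h != 0 by near: h; exact: nbhs_dnbhs_neq.
have hd1 : `|h| < d by near: h; apply: dnbhs0_lt.
have hd2 : `|h| < d' by near: h; apply: dnbhs0_lt.
have hdt : `|h| < t by near: h; apply: dnbhs0_lt.
rewrite /= /shift /= -[h *: 1]/(h * 1) mulr1 -[_ *: _]/(_ * _) /g.
have [hpos|hneg] := ltP 0 h.
  rewrite (GE _ (ltW t0)) (pextE x y (ltW t0)) (pextE x y (addr_ge0 (ltW hpos) (ltW t0))) distrC mulrC.
  apply: le_trans (euler_step x y hpos (ltW t0)) _.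
  have hd3 : 0 < h < d by rewrite hpos -(gtr0_norm hpos).
  have := hd _ hd3; rewrite subr0 => /(le_trans (ler_norm _)); lra.
have hlt : h < 0 by rewrite lt_neqAle h_neq0.
have nh : 0 < - h by rewrite oppr_gt0.
have ht' : 0 <= h + t by move: hdt; rewrite ltr0_norm //; lra.
have E := euler_step x y nh ht'.
rewrite addrA addNr add0r in E.
have E2 : `|\sum_(v <- supp x) Q x v * pext v y t - \sum_(v <- supp x) Q x v * pext v y (h + t)| <= eps / 2.
  by apply: hG => /=; rewrite opprD addrCA subrr addr0 normrN.
have hd3 : 0 < - h < d by rewrite nh -(ltr0_norm hlt).
have E4 : `|(p t x y - p (h + t) x y) / - h - G x y (h + t)| <= eps / 2.
  by apply: le_trans E _; have := hd _ hd3; rewrite subr0 => /(le_trans (ler_norm _)).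
rewrite (pextE x y ht') (pextE x y (ltW t0)).
rewrite (GE _ ht') in E2.
have -> : h^-1 * (p (h + t) x y - p t x y) = (p t x y - p (h + t) x y) / - h.
  by rewrite invrN; ring.
rewrite -[X in `|X|](subrKA (G x y (h + t))).
apply: le_trans (ler_normD _ _) _; rewrite [eps]splitr; apply: lerD => //.
by rewrite distrC.
Unshelve. all: end_near. Qed.

(** The functions [e^(et) p] solve the linear system with matrix [A], are bounded on
    bounded intervals, and start from the unit vector at [y]. *)
Theorem transition_series (C : R) x y (t : R) : 0 <= t ->
  (forall x, \sum_(v <- supp x) `|A x v| <= C) ->
  taylor supp A y K x t @[K --> \oo] --> expR (e * t) * p t x y.
Proof.
move=> t0 hC.
pose f x : R -> R := (expR \o (e \*: (@id R))) * pext x y.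
have expd (s : R) : is_derive s 1 (expR \o (e \*: (@id R))) (e * expR (e * s)).
  have h1 : is_derive s 1 (e \*: (@id R)) (e *: 1) by apply: is_deriveZ.
  have h2 := is_derive_expR (e * s).
  have := @is_derive1_comp R expR (e \*: (@id R)) s _ _ h2 h1.
  by rewrite -[e *: 1]/(e * 1) mulr1 mulrC.
rewrite -(pextE x y t0).
apply: (@taylor_cvg R S supp A f y t (expR (`|e| * t)) C) => //.
- move=> x'; move=> s; apply: cvgM; last exact: pext_cont.
  exact: (derive_continuous expd).
- move=> x' s /andP[s0 st].
  have H1 := expd s; have H2 := pext_derive x' y s0.
  apply: is_derive_eq.
  rewrite -[LHS]/(expR (e * s) * _ + pext x' y s * _) mulr_sumr.
  rewrite -(sum_self x' (fun v => pext v y s)) mulr_suml -big_split.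
  apply: eq_bigr => v _ /=; rewrite /Q q_matrixE -[f v s]/(expR (e * s) * pext v y s); ring.
- move=> x'; rewrite -[LHS]/(expR (e * 0) * pext x' y 0) mulr0 expR0 mul1r pextE //.
  exact: (transition_0 hp).
- move=> x' s /andP[s0 st]; rewrite -[f x' s]/(expR (e * s) * pext x' y s) pextE // normrM.
  rewrite ger0_norm ?expR_ge0 // -[leRHS]mulr1; apply: ler_pM => //.
    rewrite ler_expR; apply: le_trans (ler_norm _) _.
    by rewrite normrM (ger0_norm s0) ler_wpM2l.
  by rewrite ger0_norm ?p0 // p_le1.
by rewrite t0 lexx.
Qed.

End Backward.

(** * The law of the chain started at the origin *)

Section Shapes.
Variable n : nat.

Definition zero_shape := nseq n 0%N.

Lemma crd_zero_shape i : crd zero_shape i = 0%N.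
Proof. by case: i => [|i] //; rewrite /crd /= nth_nseq; case: ifP. Qed.

Lemma zero_shape_is_shape : is_shape n zero_shape.
Proof.
split; first by rewrite size_nseq.
apply/(path.sortedP 0%N) => i; rewrite size_nseq => hi.
by rewrite !nth_nseq hi (ltnW hi).
Qed.

Lemma sorted_crd (lam : seq nat) : (forall i, (0 < i)%N -> (crd lam i.+1 <= crd lam i)%N) -> sorted geq lam.
Proof. by move=> h; apply/(path.sortedP 0%N) => i hi; exact: (h i.+1). Qed.

Variables (F : fieldType) (q : F).

Lemma rate_right_shape lam i : is_shape n lam -> (1 <= i <= n)%N ->
  rate_right q lam i != 0 -> is_shape n (inc i lam).
Proof.
move=> [hs hso] hi hr; split; first by rewrite size_set_crd ?hs.
apply: sorted_crd => j hj; rewrite !crd_inc; try lia.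
have h1 := crd_sorted hso hj.
case: (eqVneq j.+1 i) hr => [<- hr|_ hr]; last by case: eqVneq => [<-|_]; lia.
rewrite ifF; last by lia.
move: hr; rewrite /rate_right /=; case: j hj h1 => // j hj h1 /=.
have [->|h] := eqVneq (crd lam j.+1) (crd lam j.+2); last by lia.
by rewrite subnn expr0 subrr eqxx.
Qed.

Lemma rate_left_shape lam i : is_shape n lam -> (1 <= i <= n)%N ->
  rate_left q lam i != 0 -> is_shape n (dec i lam).
Proof.
move=> [hs hso] hi hr; split; first by rewrite size_set_crd ?hs.
apply: sorted_crd => j hj; rewrite !crd_dec; try lia.
have h1 := crd_sorted hso hj.
case: (eqVneq j i) hr => [<- hr|_ hr]; last by case: eqVneq => [<-|_]; lia.
rewrite ifF; last by lia.
move: hr; rewrite /rate_left.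
have [->|h] := eqVneq (crd lam j) (crd lam j.+1); last by lia.
by rewrite subnn expr0 subrr eqxx.
Qed.

(** The rates vanish at the jumps that would leave the partitions. *)
Lemma eq_shape_op (f g : seq nat -> F) : (forall mu, is_shape n mu -> f mu = g mu) ->
  forall lam, is_shape n lam -> shape_op q n f lam = shape_op q n g lam.
Proof.
move=> h lam hl; apply: eq_big_nat => i hi.
have hi' : (1 <= i <= n)%N by lia.
congr (_ + _).
  have [->|hr] := eqVneq (rate_right q lam i) 0; first by rewrite !mul0r.
  by rewrite h //; exact: rate_right_shape.
have [->|hr] := eqVneq (rate_left q lam i) 0; first by rewrite !mul0r.
by rewrite h //; exact: rate_left_shape.
Qed.

Lemma shape_opZ r (f : seq nat -> F) lam : shape_op q n (fun mu => r * f mu) lam = r * shape_op q n f lam.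
Proof. by rewrite /shape_op mulr_sumr; apply: eq_bigr => i _; ring. Qed.

End Shapes.

Section Origin.
Variable n : nat.
Hypothesis n_gt0 : (0 < n)%N.

Lemma pattern_eq (z z' : pattern n) :
  (forall k i, entry (val z) k i = entry (val z') k i) -> z = z'.
Proof.
move=> h; apply: val_inj; apply: (@eq_from_nth _ [::]).
  by rewrite !(pattern_size (valP _)).
move=> k; rewrite (pattern_size (valP _)) => hk.
have hl : level (val z) k.+1 = level (val z') k.+1.
  apply: crd_ext => [|i _]; last exact: h.
  by rewrite !(pattern_level_size (valP _)).
exact: hl.
Qed.

Definition origin_array : array := [seq nseq (nparts k) 0%N | k <- iota 1 n.*2].

Lemma origin_entry k i : entry origin_array k i = 0%N.
Proof.
rewrite /entry /level; case: k => [|k] /=; first by case: i => [|[|i]].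
case: i => [|i] //=.
have [hk|hk] := ltnP k n.*2.
  by rewrite (nth_map 0%N) ?size_iota // nth_nseq; case: ifP.
by rewrite (nth_default [::]) ?nth_nil // size_map size_iota.
Qed.

Lemma origin_is_pattern : is_pattern n origin_array.
Proof.
apply/andP; split; last by apply/allP => k _; apply/allP => i _; rewrite !origin_entry.
rewrite /seq.shape -map_comp; apply/eqP; apply: eq_map => k /=; exact: size_nseq.
Qed.

Definition origin : pattern n := exist _ origin_array origin_is_pattern.

Lemma originP (z : pattern n) : (forall k i, entry (val z) k i = 0%N) <-> z = origin.
Proof.
split=> [h|-> k i]; last exact: origin_entry.
by apply: pattern_eq => k i; rewrite h [RHS]origin_entry.
Qed.

Lemma origin_level : level (val origin) n.*2 = zero_shape n.
Proof.
apply: crd_ext; first by rewrite (pattern_level_size (valP origin)) // size_nseq sz_double.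
move=> i _; rewrite -[LHS]/(entry origin_array _ _) origin_entry crd_zero_shape.
by [].
Qed.

(** All entries of a pattern are bounded by the first entry of the last level. *)
Lemma zero_level (z : pattern n) : level (val z) n.*2 = zero_shape n -> z = origin.
Proof.
move=> h; apply/originP => k i; rewrite entryE.
have [hk|hk] := leqP k n.*2.
  by have := pattern_bound n_gt0 i (valP z) hk; rewrite h crd_zero_shape; lia.
case: k hk => // k hk; rewrite /crd /level /= (nth_default [::]) ?(pattern_size (valP z)) //.
by case: i => [|[|i]].
Qed.

Lemma weight_origin (F : fieldType) (q : F) (a : 'I_n -> F) : weight a q (val origin) = 1.
Proof.
have hb : qbinom q 0 0 = 1 :> F by rewrite /qbinom /qpoch big_geq // mulr1 divr1.
have hs k : sumn (level origin_array k) = 0%N.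
  have : all (eq_op^~ 0%N) (level origin_array k).
    apply/allP => e /(nthP 0%N)[i hi <-].
    by have := origin_entry k i.+1; rewrite /entry /= => ->.
  by elim: (level _ _) => //= e l IH /andP[/eqP -> /IH].
rewrite /weight big1 // => k _; rewrite !hs !origin_entry hb mulr1.
rewrite big1 ?mulr1 ?expr0z // => i _.
by rewrite !origin_entry hb mulr1.
Qed.
End Origin.

Section ChainLaw.
Variables (R : realType) (q : R) (n : nat) (a : 'I_n -> R).
Hypothesis q01 : 0 < q < 1.
Hypothesis n_gt0 : (0 < n)%N.
Hypothesis a_gt0 : forall i, 0 < a i.

Lemma pattern_shape_last (z : pattern n) : is_shape n (level (val z) n.*2).
Proof.
split; first by rewrite (pattern_level_size (valP z)) // sz_double.
exact: pattern_sorted n_gt0 _ (valP z).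
Qed.

Lemma qpoch_gt0 m : 0 < qpoch q q m.
Proof.
rewrite /qpoch; apply: prodr_gt0 => k _; rewrite subr_gt0 -exprS; exact: expq_lt1.
Qed.

Lemma qbinom_gt0 m k : 0 < qbinom q m k.
Proof. by rewrite /qbinom divr_gt0 ?mulr_gt0 ?qpoch_gt0. Qed.

Lemma weight_gt0 (z : array) : 0 < weight a q z.
Proof.
rewrite /weight; apply: prodr_gt0 => k _; apply: mulr_gt0; last exact: qbinom_gt0.
apply: mulr_gt0; first exact: exprz_gt0.
by apply: prodr_gt0 => i _; apply: mulr_gt0; exact: qbinom_gt0.
Qed.

Variables (rate : pattern n -> pattern n -> R) (A : (array -> R) -> array -> R) (C : R).
Hypothesis D : dynamics q a rate A C.

Definition total_rate : R := \sum_(l < n) (a l + (a l)^-1).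

(** The functional [A] acts on functions of all arrays; the next lemmas confine it to
    the patterns. *)
Lemma fibre_sum_outside lam (g : array -> R) : (forall z : pattern n, g (val z) = 0) ->
  fibre_sum q a lam g = 0.
Proof. by move=> h; rewrite /fibre_sum fsbig1 // => z _; rewrite h mulr0. Qed.

Lemma fibre_sum_eq lam (g h : array -> R) : (forall z : pattern n, g (val z) = h (val z)) ->
  fibre_sum q a lam g = fibre_sum q a lam h.
Proof. by move=> e; apply: eq_fsbigr => z _; rewrite e. Qed.

(** The intertwining applied to the indicator of the non-patterns has right-hand side
    [0]; on the left all terms are nonnegative and all weights positive. *)
Lemma dyn_conservative (z : pattern n) : A (fun y => (~~ is_pattern n y)%:R) (val z) = 0.
Proof.
set g := fun y => _; have gz (v : pattern n) : g (val v) = 0 :> R by rewrite /g (valP v : is_pattern n (val v)).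
pose lam := level (val z) n.*2; have hl := pattern_shape_last z.
have h : fibre_sum q a lam (A g) = 0.
  rewrite (dyn_intertwining D) // /shape_op big1 // => i _.
  by rewrite !fibre_sum_outside // !mulr0 addr0.
pose M := (crd lam 1).+1; have [hs _] := hl.
have hM : all (fun e => (e < M)%N) lam.
  apply/(all_nthP 0%N) => i hi; rewrite ltnS.
  exact: (pattern_bound n_gt0 i.+1 (valP z) (leqnn _)).
have zin : z \in fibre n M lam.
  have : [set v : pattern n | level (val v) n.*2 = lam] z by [].
  by rewrite (fibre_set n_gt0 hs hM).
move: h; rewrite (fibre_sum_seq _ n_gt0 _ _ hs hM) => /eqP.
rewrite psumr_eq0 => [/allP /(_ _ zin)|v _]; last first.
  by rewrite mulr_ge0 ?(ltW (weight_gt0 _)) // (dyn_ge0 D).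
by rewrite mulf_eq0 gt_eqF ?weight_gt0 //= => /eqP.
Qed.

Definition extend_by_zero (g : pattern n -> R) (y : array) : R :=
  if insub y is Some z then g z else 0.

Lemma extend_by_zero_val g (z : pattern n) : extend_by_zero g (val z) = g z.
Proof. by rewrite /extend_by_zero valK. Qed.

Definition rate_matrix (z v : pattern n) : R := A (fun y => (y == val v)%:R) (val z).

Lemma dyn_support (z : pattern n) : exists s : seq (pattern n),
  [/\ uniq s, z \in s, (forall v, v \notin s -> rate_matrix z v = 0) &
   forall g : array -> R, A g (val z) = \sum_(v <- s) rate_matrix z v * g (val v)
     + A (fun y => if is_pattern n y then 0 else g y) (val z)].
Proof.
have [os hos] := dyn_finite D z.
pose s := undup (z :: pmap insub [seq o.2 | o <- os]).
exists s; split.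
- exact: undup_uniq.
- by rewrite mem_undup inE eqxx.
- move=> v; rewrite mem_undup inE negb_or => /andP[_ hv].
  rewrite /rate_matrix hos big_seq big1 // => o ho.
  case: eqP => [e|_]; last by rewrite mulr0.
  by case/negP: hv; rewrite mem_pmap_sub; apply/mapP; exists o.
move=> g; rewrite hos.
under [X in _ = X + _]eq_bigr do rewrite /rate_matrix hos mulr_suml.
rewrite exchange_big /= hos -big_split /= !big_seq; apply: eq_bigr => o ho.
have [ho'|ho'] := boolP (is_pattern n o.2); last first.
  rewrite big1 ?add0r // => v _; rewrite (_ : (o.2 == val v) = false) ?mulr0 ?mul0r //.
  by apply/negP => /eqP e; move: ho'; rewrite e => /negP; apply; exact: valP.
rewrite mulr0 addr0.
have hs : Sub o.2 ho' \in s.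
  by rewrite mem_undup inE; apply/orP; right; rewrite mem_pmap_sub; apply/mapP; exists o.
rewrite (bigD1_seq _ hs) ?undup_uniq //= eqxx mulr1 big1 ?addr0 // => v hv.
rewrite (_ : (o.2 == val v) = false) ?mulr0 ?mul0r //.
by apply/negP => /eqP e; case/negP: hv; apply/eqP/val_inj; rewrite /= e.
Qed.

Definition rate_support (z : pattern n) : seq (pattern n) := projT1 (cid (dyn_support z)).

Lemma rate_supportP (z : pattern n) :
  [/\ uniq (rate_support z), z \in rate_support z, (forall v, v \notin rate_support z -> rate_matrix z v = 0) &
   forall g : array -> R, A g (val z) = \sum_(v <- rate_support z) rate_matrix z v * g (val v)
     + A (fun y => if is_pattern n y then 0 else g y) (val z)].
Proof. exact: projT2 (cid (dyn_support z)). Qed.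

Lemma dyn_outside (z : pattern n) (g : array -> R) : (forall y, 0 <= g y <= 1) ->
  A (fun y => if is_pattern n y then 0 else g y) (val z) = 0.
Proof.
move=> hg; have [os hos] := dyn_finite D z.
apply/eqP; rewrite eq_le; apply/andP; split; last first.
  apply: (dyn_ge0 D); last by rewrite ifT //; exact: valP.
  by move=> y; case: ifP => // _; case/andP: (hg y).
rewrite -[leRHS](dyn_conservative z) -subr_ge0 !hos -sumrB.
under eq_bigr do rewrite -mulrBr.
pose G y : R := (~~ is_pattern n y)%:R - (if is_pattern n y then 0 else g y).
have e : A G (val z) = \sum_(o <- os) o.1 * G o.2 by exact: hos.
rewrite -[leRHS]/(\sum_(o <- os) o.1 * G o.2) -e /G.
apply: (dyn_ge0 D) => [y|]; last by rewrite ifT ?(valP z) ?subr0 // (valP z : is_pattern n (val z)).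
by case: ifP => _ /=; rewrite ?subr0 // subr_ge0; case/andP: (hg y).
Qed.

Lemma matrix_mass z : \sum_(v <- rate_support z) rate_matrix z v = total_rate.
Proof.
have [_ _ _ h] := rate_supportP z; have := h (fun=> 1).
rewrite dyn_outside ?addr0; last by move=> y; rewrite ler01 lexx.
rewrite (dyn_mass D) => e; rewrite /total_rate e.
by apply: eq_bigr => v _; rewrite mulr1.
Qed.

Lemma matrix_ge0 z v : v != z -> 0 <= rate_matrix z v.
Proof.
move=> hv; apply: (dyn_ge0 D) => [y|]; first exact: ler0n.
by rewrite (inj_eq val_inj) eq_sym (negPf hv).
Qed.

Lemma matrix_off_le z : \sum_(v <- rate_support z | v != z) rate_matrix z v <= C.
Proof.
have [hu hz h0 h] := rate_supportP z.
pose g := fun y : array => (y != val z)%:R : R.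
have g01 y : 0 <= g y <= 1 by rewrite /g; case: (y != val z); rewrite ?lexx ?ler01.
have gz : g (val z) = 0 by rewrite /g eqxx.
have := dyn_le D g01 gz; rewrite h dyn_outside // addr0.
move=> hC; rewrite big_mkcond /=; apply: le_trans hC; apply: ler_sum => v _.
by rewrite /g (inj_eq val_inj); case: (v != z); rewrite ?mulr1 ?mulr0 lexx.
Qed.

Lemma q_matrix_matrix z v : q_matrix rate z v = rate_matrix z v - total_rate * (z == v)%:R.
Proof.
have [hu hz h0 h] := rate_supportP z.
rewrite /q_matrix; have [<-|hv] := eqVneq z v; last first.
  by rewrite mulr0 subr0 (dyn_rate D) // eq_sym.
rewrite mulr1 -(matrix_mass z).
have -> : \sum_(w \in [set w | w != z]) rate z w = \sum_(w <- rate_support z | w != z) rate_matrix z w.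
  rewrite -[RHS]big_filter [RHS]fsbig_seq ?filter_uniq //.
  rewrite [RHS](fsbig_widen _ [set w | w != z]).
  - by apply: eq_fsbigr => w; rewrite inE /= => hw; rewrite (dyn_rate D).
  - by move=> w /=; rewrite mem_filter => /andP[].
  move=> w [/= hw]; rewrite mem_filter hw /= => /negP hw'.
  exact: h0.
by rewrite (bigD1_seq z) //= opprD addrA subrr add0r.
Qed.

(** The diagonal entry is the total rate minus the off-diagonal row sum. *)
Lemma matrix_norm_le z : \sum_(v <- rate_support z) `|rate_matrix z v| <= `|total_rate| + C + C.
Proof.
have [hu hz h0 h] := rate_supportP z.
have e := matrix_mass z; rewrite (bigD1_seq z) //= in e.
rewrite (bigD1_seq z) //=.
have -> : \sum_(v <- rate_support z | v != z) `|rate_matrix z v| = \sum_(v <- rate_support z | v != z) rate_matrix z v.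
  by apply: eq_bigr => v hv; rewrite ger0_norm // matrix_ge0.
have hC := matrix_off_le z.
have hS : 0 <= \sum_(v <- rate_support z | v != z) rate_matrix z v.
  by apply: sumr_ge0 => v hv; exact: matrix_ge0.
have -> : rate_matrix z z = total_rate - \sum_(v <- rate_support z | v != z) rate_matrix z v by rewrite -e addrK.
apply: lerD => //; apply: le_trans (ler_normB _ _) _; apply: lerD => //.
by rewrite ger0_norm.
Qed.

Lemma shape_bound lam : is_shape n lam -> all (fun e => (e < (crd lam 1).+1)%N) lam.
Proof.
move=> [_ hso]; apply/(all_nthP 0%N) => i hi; rewrite ltnS.
elim: i hi => [|i IH] // hi; apply: leq_trans (IH (ltnW hi)).
exact: (crd_sorted hso (isT : (0 < i.+1)%N)).
Qed.

(** By induction on [K], each factor [A] becomes a factor [L] on the last level. *)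
Lemma fibre_mpow K lam (v : pattern n) : is_shape n lam ->
  fibre_sum q a lam (extend_by_zero (fun z => mpow rate_support rate_matrix K z v))
  = weight a q (val v) * iter K (shape_op q n) (fun mu => (mu == level (val v) n.*2)%:R) lam.
Proof.
elim: K lam => [|K IH] lam hl.
  have [hs _] := hl; have hM := shape_bound hl.
  have hin : (v \in fibre n (crd lam 1).+1 lam) = (lam == level (val v) n.*2).
    apply/idP/eqP => [hv|e].
      have : [set` fibre n (crd lam 1).+1 lam] v by [].
      by rewrite -(fibre_set n_gt0 hs hM).
    have : [set v : pattern n | level (val v) n.*2 = lam] v by [].
    by rewrite (fibre_set n_gt0 hs hM).
  rewrite (fibre_sum_seq _ n_gt0 _ _ hs hM) /= -hin.
  have [hv|hv] := boolP (v \in _).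
    rewrite (bigD1_seq v) ?uniq_fibre //= extend_by_zero_val eqxx big1 ?addr0 // => z /negPf hz.
    by rewrite extend_by_zero_val hz mulr0.
  rewrite mulr0 big_seq big1 // => z hz; rewrite extend_by_zero_val.
  by case: eqP => [e|_]; rewrite ?mulr0 // -e hz in hv *.
have -> : fibre_sum q a lam (extend_by_zero (fun z => mpow rate_support rate_matrix K.+1 z v)) =
   fibre_sum q a lam (A (extend_by_zero (fun z => mpow rate_support rate_matrix K z v))).
  apply: fibre_sum_eq => z; rewrite extend_by_zero_val.
  have [hu hz h0 h] := rate_supportP z; rewrite h.
  have [os hos] := dyn_finite D z.
  rewrite [X in _ = _ + X](_ : _ = 0) ?addr0; last first.
    rewrite hos big1 // => o _; case: ifP => ho; first by rewrite mulr0.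
    by rewrite /extend_by_zero (insubN _ (negbT ho)) mulr0.
  by apply: eq_bigr => w _; rewrite extend_by_zero_val.
rewrite (dyn_intertwining D) //= -[RHS]shape_opZ.
by apply: eq_shape_op => // mu hmu; rewrite IH.
Qed.

(** The fibre over the zero partition is the origin alone, with weight [1]. *)
Lemma mpow_origin K (v : pattern n) :
  mpow rate_support rate_matrix K (origin n) v
  = weight a q (val v) * iter K (shape_op q n) (fun mu => (mu == level (val v) n.*2)%:R) (zero_shape n).
Proof.
rewrite -fibre_mpow; last exact: zero_shape_is_shape.
have [hs _] := zero_shape_is_shape n; have hM := shape_bound (zero_shape_is_shape n).
rewrite (fibre_sum_seq _ n_gt0 _ _ hs hM).
have hin z : (z \in fibre n (crd (zero_shape n) 1).+1 (zero_shape n)) = (z == origin n).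
  apply/idP/eqP => [hv|->].
    have : [set` fibre n (crd (zero_shape n) 1).+1 (zero_shape n)] z by [].
    by rewrite -(fibre_set n_gt0 hs hM) /=; exact: zero_level.
  have : [set v : pattern n | level (val v) n.*2 = zero_shape n] (origin n) by exact: origin_level.
  by rewrite (fibre_set n_gt0 hs hM).
rewrite (bigD1_seq (origin n)) ?uniq_fibre ?hin ?eqxx // weight_origin mul1r extend_by_zero_val.
rewrite big_seq_cond big1 => [|z /andP[]]; first exact/esym/addr0.
by rewrite hin => /eqP ->; rewrite eqxx.
Qed.

Theorem origin_transition p (v : pattern n) (t : R) : is_transition_function rate p -> 0 <= t ->
  \sum_(0 <= k < K) t ^+ k / k`!%:R *
     (weight a q (val v) * iter k (shape_op q n) (fun mu => (mu == level (val v) n.*2)%:R) (zero_shape n))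
  @[K --> \oo] --> expR (total_rate * t) * p t (origin n) v.
Proof.
move=> hp ht.
have hu z : uniq (rate_support z) by have [] := rate_supportP z.
have hs z : z \in rate_support z by have [] := rate_supportP z.
have h := @transition_series R (pattern n) rate p hp rate_support rate_matrix total_rate hu hs q_matrix_matrix matrix_mass (`|total_rate| + C + C) (origin n) v t ht matrix_norm_le.
by under eq_fun do under eq_bigr do rewrite -mpow_origin.
Qed.

End ChainLaw.

(** * Iterated integrals of Lipschitz functions *)

Section CubeIntegral.
Variable R : realType.
Local Notation mu := (@lebesgue_measure R).
Local Notation I := (`[0, 2 * pi]%classic : set R).

Definition l1dist (n : nat) (s s' : seq R) : R := \sum_(i < n) `|s`_i - s'`_i|.

Lemma l1dist_cons n x y s s' : l1dist n.+1 (x :: s) (y :: s') = `|x - y| + l1dist n s s'.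
Proof. by rewrite /l1dist big_ord_recl. Qed.

Lemma l1dist_ge0 n s s' : 0 <= l1dist n s s'.
Proof. exact: sumr_ge0. Qed.

Lemma l1dist_refl n s : l1dist n s s = 0.
Proof. by rewrite /l1dist big1 // => i _; rewrite subrr normr0. Qed.

Definition lipschitz_with (n : nat) (f : seq R -> R) (M : R) : Prop :=
  forall s s', size s = n -> size s' = n -> `|f s - f s'| <= M * l1dist n s s'.

(** Lipschitz functions are stable under integration over one variable, and continuous
    in each of them. This makes the iterated integrals linear
    without any measurability argument in several variables. *)
Definition is_lipschitz (n : nat) (f : seq R -> R) : Prop := exists M, lipschitz_with n f M.

Lemma lipschitzD n f g : is_lipschitz n f -> is_lipschitz n g -> is_lipschitz n (fun s => f s + g s).
Proof.
move=> [M hf] [M' hg]; exists (M + M') => s s' hs hs'.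
rewrite opprD addrACA mulrDl; apply: le_trans (ler_normD _ _) _.
by apply: lerD; [exact: hf|exact: hg].
Qed.

Lemma lipschitzZ n c f : is_lipschitz n f -> is_lipschitz n (fun s => c * f s).
Proof.
move=> [M hf]; exists (`|c| * M) => s s' hs hs'.
by rewrite -mulrBr normrM -mulrA ler_wpM2l // hf.
Qed.

Lemma lipschitz_slice n f x : is_lipschitz n.+1 f -> is_lipschitz n (fun s => f (x :: s)).
Proof.
move=> [M hf]; exists M => s s' hs hs'.
have := hf (x :: s) (x :: s'); rewrite l1dist_cons subrr normr0 add0r => -> //=; by rewrite ?hs ?hs'.
Qed.

Lemma lip_continuous (f : R -> R) M : (forall x y, `|f x - f y| <= M * `|x - y|) -> continuous f.
Proof.
move=> hf x; apply/cvgrPdist_le => e e0.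
have M0 : 0 < `|M| + 1 by rewrite ltr_wpDl.
apply/nbhs_ballP; exists (e / (`|M| + 1)); first by rewrite /= divr_gt0.
move=> y hy; have {}hy : `|x - y| < e / (`|M| + 1) by [].
apply: le_trans (hf x y) _; apply: (@le_trans _ _ ((`|M| + 1) * `|x - y|)).
  by rewrite ler_wpM2r // ler_wpDr // ler_norm.
by rewrite mulrC -ler_pdivlMr // ltW.
Qed.

Lemma two_pi_gt0 : 0 < 2 * pi :> R.
Proof. by rewrite mulr_gt0 // pi_gt0. Qed.

Lemma mI : measurable (I : set (measurableTypeR R)). Proof. exact: measurable_itv. Qed.

Lemma continuous_integrable (f : R -> R) : continuous f -> mu.-integrable I (EFin \o f).
Proof.
move=> hf; apply: continuous_compact_integrable; first exact: segment_compact.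
exact: continuous_subspaceT.
Qed.

Lemma integral_cstI (c : R) : \int[mu]_(x in I) c = 2 * pi * c.
Proof.
have h : (mu I = (2 * pi)%:E)%E.
  by rewrite lebesgue_measure_itv /= lte_fin two_pi_gt0 -EFinD subr0.
rewrite (Rintegral_cst _ mI) mulrC; congr (_ * _).
by rewrite -[RHS]/(fine (2 * pi)%:E) -h.
Qed.

(** Near [x0] the function is at least half its value at [x0]. *)
Lemma integral_gt0 (f : R -> R) M x0 : (forall x y, `|f x - f y| <= M * `|x - y|) ->
  (forall x, 0 <= f x) -> 0 < x0 < 2 * pi -> 0 < f x0 -> 0 < \int[mu]_(x in I) f x.
Proof.
move=> hf f0 /andP[x00 x01] fx0.
have If := continuous_integrable (lip_continuous hf).
have M1 : 0 < `|M| + 1 by rewrite ltr_wpDl.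
(* on an interval of length [d] the function loses at most half of [f x0] *)
pose d := Num.min (2 * pi - x0) (f x0 / 2 / (`|M| + 1)).
have d0 : 0 < d by rewrite lt_min subr_gt0 x01 !divr_gt0.
have d1 : d <= 2 * pi - x0 by rewrite ge_min lexx.
have d2 : d <= f x0 / 2 / (`|M| + 1) by rewrite ge_min lexx orbT.
pose B : set R := `[x0, x0 + d]%classic.
have BI : B `<=` I.
  rewrite /B !set_itvcc => x /= /andP[h1 h2].
  by rewrite (le_trans (ltW x00) h1) (le_trans h2) // -lerBrDl.
have mB : measurable (B : set (measurableTypeR R)) by exact: measurable_itv.
have mf := measurable_int _ If.
have h : ((f x0 / 2 * d)%:E <= \int[mu]_(x in I) (f x)%:E)%E.
  apply: le_trans (ge0_subset_integral mu mB mI mf _ BI); last by move=> x _; rewrite lee_fin.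
  apply: (@le_trans _ _ (\int[mu]_(x in B) (cst (f x0 / 2)%:E x))%E).
    rewrite integral_cst //= lebesgue_measure_itv /= lte_fin ltrDl d0 -EFinD.
    by rewrite [x0 + d]addrC addrK -EFinM.
  apply: ge0_le_integral => //.
  - by move=> x _; rewrite lee_fin divr_ge0 // ltW.
  - by apply: measurable_funS mf => //; exact: mI.
  rewrite /B set_itvcc => x /= /andP[h1 h2]; rewrite lee_fin.
  have h3 := hf x0 x.
  have h4 : M * `|x0 - x| <= (`|M| + 1) * d.
    apply: (@le_trans _ _ ((`|M| + 1) * `|x0 - x|)).
      by rewrite ler_wpM2r // ler_wpDr // ler_norm.
    by rewrite ler_wpM2l ?(ltW M1) // distrC ger0_norm ?subr_ge0 // lerBlDl.
  have := h4; have h5 : (`|M| + 1) * d <= f x0 / 2 by rewrite mulrC -ler_pdivlMr.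
  move: h3; rewrite ler_norml => /andP[_]; lra.
have fin := integrable_fin_num mI If.
apply: fine_gt0; rewrite (lt_le_trans _ h) ?lte_fin ?mulr_gt0 ?divr_gt0 //=.
by rewrite ltey_eq fin.
Qed.

Local Notation cube := (@cube_integral R).

Lemma lipschitz_cst n c : is_lipschitz n (fun=> c).
Proof. by exists 0 => s s' _ _; rewrite subrr normr0 mul0r. Qed.

Lemma cube_cst n c : cube n (fun=> c) = (2 * pi) ^+ n * c.
Proof.
elim: n => [|n IH] /=; first by rewrite mul1r.
by rewrite IH integral_cstI mulrA exprS.
Qed.

Lemma cube_ge0 n f : (forall s, size s = n -> 0 <= f s) -> 0 <= cube n f.
Proof.
elim: n f => [|n IH] f hf /=; first exact: hf.
by apply: Rintegral_ge0 => x _; apply: IH => s hs; apply: hf; rewrite /= hs.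
Qed.

Lemma eq_cube n f g : (forall s, size s = n -> f s = g s) -> cube n f = cube n g.
Proof.
elim: n f g => [|n IH] f g hf /=; first exact: hf.
by apply: eq_Rintegral => x _; apply: IH => s hs; apply: hf; rewrite /= hs.
Qed.

(** Isolated as a property of the dimension: the induction on it needs the
    bounds that linearity implies in dimension [n] to integrate in dimension [n + 1]. *)
Definition cube_linear n := (forall f g, is_lipschitz n f -> is_lipschitz n g ->
    cube n (fun s => f s + g s) = cube n f + cube n g) /\
  (forall c f, is_lipschitz n f -> cube n (fun s => c * f s) = c * cube n f).

Lemma cube_bound_of_linear n f c : cube_linear n -> is_lipschitz n f ->
  (forall s, size s = n -> `|f s| <= c) -> `|cube n f| <= (2 * pi) ^+ n * c.
Proof.
move=> [hD hZ] lf hf.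
have hc := lipschitz_cst n c.
have lnf := lipschitzZ (-1) lf.
rewrite -(cube_cst n c) ler_norml; apply/andP; split.
  rewrite -subr_ge0 opprK addrC -hD //; apply: cube_ge0 => s hs.
  by have := hf s hs; rewrite ler_norml => /andP[h _]; lra.
rewrite -subr_ge0 -mulN1r -hZ // -hD //; apply: cube_ge0 => s hs.
by have := hf s hs; rewrite ler_norml => /andP[_ h]; lra.
Qed.

Lemma slice_lipschitz_of_linear n f M : cube_linear n -> lipschitz_with n.+1 f M -> forall x y,
  `|cube n (fun s => f (x :: s)) - cube n (fun s => f (y :: s))| <= (2 * pi) ^+ n * M * `|x - y|.
Proof.
move=> hl hf x y; have [hD hZ] := hl.
have lf : is_lipschitz n.+1 f by exists M.
have l1 := lipschitz_slice x lf; have l2 := lipschitzZ (-1) (lipschitz_slice y lf).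
rewrite -[X in _ - X]mul1r -mulNr -hZ; last exact: lipschitz_slice.
rewrite -hD // -mulrA; apply: cube_bound_of_linear => //; first exact: lipschitzD.
move=> s hs; rewrite mulN1r.
have := hf (x :: s) (y :: s); rewrite l1dist_cons l1dist_refl addr0 => -> //=; by rewrite hs.
Qed.

Lemma cube_linearity n : cube_linear n.
Proof.
elim: n => [|n IH]; first by split.
have int f : is_lipschitz n.+1 f -> mu.-integrable I (EFin \o (fun x => cube n (fun s => f (x :: s)))).
  move=> [M hf]; apply: continuous_integrable.
  exact: lip_continuous (slice_lipschitz_of_linear IH hf).
have [hD hZ] := IH; split=> [f g lf lg|c f lf] /=.
  rewrite -RintegralD; [|exact: mI|exact: int|exact: int].
  by apply: eq_Rintegral => x _; rewrite -hD //; exact: lipschitz_slice.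
rewrite -RintegralZl; [|exact: mI|exact: int].
by apply: eq_Rintegral => x _; rewrite -hZ //; exact: lipschitz_slice.
Qed.

Lemma cubeD n f g : is_lipschitz n f -> is_lipschitz n g ->
  cube n (fun s => f s + g s) = cube n f + cube n g.
Proof. by have [h _] := cube_linearity n; exact: h. Qed.

Lemma cubeZ n c f : is_lipschitz n f -> cube n (fun s => c * f s) = c * cube n f.
Proof. by have [_ h] := cube_linearity n; exact: h. Qed.

Lemma cube_bound n f c : is_lipschitz n f ->
  (forall s, size s = n -> `|f s| <= c) -> `|cube n f| <= (2 * pi) ^+ n * c.
Proof. exact: cube_bound_of_linear (cube_linearity n). Qed.

Lemma cube_gt0 n f s0 : is_lipschitz n f -> (forall s, size s = n -> 0 <= f s) ->
  size s0 = n -> all (fun x => 0 < x < 2 * pi) s0 -> 0 < f s0 -> 0 < cube n f.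
Proof.
elim: n f s0 => [|n IH] f [|x s0] //= lf f0 [hs] /andP[hx hs0] h.
have [M hM] := lf.
apply: (integral_gt0 (slice_lipschitz_of_linear (cube_linearity n) hM) _ hx).
  by move=> y; apply: cube_ge0 => s hs'; apply: f0; rewrite /= hs'.
by apply: (IH _ s0) => //; [exact: lipschitz_slice|move=> s hs'; apply: f0; rewrite /= hs'].
Qed.

End CubeIntegral.

Local Open Scope complex_scope.

(** * Convergence of the infinite products *)

Section Modulus.
Variable R : realType.
Local Notation C := R[i].
Implicit Types x y : C.

(** The norm of [R[i]] has values in [R[i]]; this is its real version. *)
Definition modulus (x : C) : R := complex.Re `|x|.

Lemma modulusE x : `|x| = (modulus x)%:C.
Proof. by rewrite /modulus normc_def. Qed.

Lemma modulus_ge0 x : 0 <= modulus x.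
Proof. by rewrite -ler0c -modulusE normr_ge0. Qed.

Lemma modulusM x y : modulus (x * y) = modulus x * modulus y.
Proof. by apply: complexI; rewrite rmorphM -!modulusE normrM. Qed.

Lemma modulusD x y : modulus (x + y) <= modulus x + modulus y.
Proof. by rewrite -lecR rmorphD /= -!modulusE ler_normD. Qed.

Lemma modulusN x : modulus (- x) = modulus x.
Proof. by rewrite /modulus normrN. Qed.

Lemma modulusC x y : modulus (x - y) = modulus (y - x).
Proof. by rewrite -modulusN opprB. Qed.

Lemma modulus_real (r : R) : modulus r%:C = `|r|.
Proof. by rewrite /modulus normc_def /= expr0n addr0 sqrtr_sqr. Qed.

Lemma modulus0 : modulus 0 = 0. Proof. by rewrite modulus_real normr0. Qed.
Lemma modulus1 : modulus 1 = 1. Proof. by rewrite modulus_real normr1. Qed.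

Lemma modulus_conj x : modulus (conjc x) = modulus x.
Proof. by apply: complexI; rewrite -!modulusE normcJ. Qed.

Lemma Re_le x : `|complex.Re x| <= modulus x.
Proof. by rewrite -lecR -modulusE normc_ge_Re. Qed.

Lemma Im_le x : `|complex.Im x| <= modulus x.
Proof.
have := Re_le (x * 'i); rewrite ReiNIm normrN modulusM.
by rewrite [modulus 'i]/modulus normc_def /= expr0n /= add0r expr1n sqrtr1 mulr1.
Qed.

Lemma modulus_le x : modulus x <= `|complex.Re x| + `|complex.Im x|.
Proof.
rewrite {1}[x]complexE; apply: le_trans (modulusD _ _) _; rewrite modulusM !modulus_real.
by rewrite [modulus 'i]/modulus normc_def /= expr0n /= add0r expr1n sqrtr1 mul1r.
Qed.

Lemma modulus_eq0 x : (modulus x == 0) = (x == 0).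
Proof. by rewrite -(inj_eq (@complexI R)) -modulusE normr_eq0. Qed.

Lemma Re_mul x y : complex.Re (x * y) = complex.Re x * complex.Re y - complex.Im x * complex.Im y.
Proof. by case: x y => [a b] [c d]. Qed.

Lemma Im_mul x y : complex.Im (x * y) = complex.Re x * complex.Im y + complex.Im x * complex.Re y.
Proof. by case: x y => [a b] [c d]. Qed.

Lemma Re_add x y : complex.Re (x + y) = complex.Re x + complex.Re y.
Proof. by case: x y => [a b] [c d]. Qed.

Lemma Im_add x y : complex.Im (x + y) = complex.Im x + complex.Im y.
Proof. by case: x y => [a b] [c d]. Qed.

Lemma Re_sub x y : complex.Re (x - y) = complex.Re x - complex.Re y.
Proof. by case: x y => [a b] [c d]. Qed.

Lemma Im_sub x y : complex.Im (x - y) = complex.Im x - complex.Im y.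
Proof. by case: x y => [a b] [c d]. Qed.

Lemma complex_cvg (u : nat -> C) (l : C) :
  modulus (l - u m) @[m --> \oo] --> (0 : R) -> (u m : C^o) @[m --> \oo] --> (l : C^o).
Proof.
move=> h; apply/cvgrPdist_lt => e; rewrite ltcE /= => /andP[/eqP ei e0].
have -> : e = (complex.Re e)%:C by rewrite [LHS]complexE ei mulr0 addr0.
move/cvgrPdist_lt : h => /(_ _ e0); apply: filterS => m.
by rewrite sub0r normrN ger0_norm ?modulus_ge0 // -[`|l - u m|]/(`|(l - u m : C)|) modulusE ltcR.
Qed.

End Modulus.

Section ModulusLimits.
Variable R : realType.
Local Notation C := R[i].
Implicit Types (u : nat -> C) (l : C).

Definition modulus_cvg u l := modulus (l - u m) @[m --> \oo] --> (0 : R).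

Lemma modulus_cvg_lim u l : modulus_cvg u l -> modulus (u m) @[m --> \oo] --> modulus l.
Proof.
move=> h; apply/cvgrPdist_le => e e0; move/cvgrPdist_le : h => /(_ _ e0).
apply: filterS => m; rewrite sub0r normrN ger0_norm ?modulus_ge0 // => h.
apply: le_trans h; rewrite ler_norml; apply/andP; split.
  by have := modulusD (u m - l) l; rewrite subrK modulusC; lra.
by have := modulusD (l - u m) (u m); rewrite subrK; lra.
Qed.

Lemma modulus_cvg_le u l c : modulus_cvg u l -> (forall m, modulus (u m) <= c) -> modulus l <= c.
Proof. by move=> /modulus_cvg_lim h hc; apply: (cvgr_to_le h); near=> m; exact: hc.
Unshelve. all: end_near. Qed.

Lemma modulus_cvg_ge u l c : modulus_cvg u l -> (forall m, c <= modulus (u m.+1)) -> c <= modulus l.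
Proof.
move=> /modulus_cvg_lim h hc; apply: (cvgr_to_ge h); near=> m.
have m0 : (0 < m)%N by near: m; exists 1%N.
by rewrite -(prednK m0).
Unshelve. all: end_near. Qed.

Lemma modulus_cvgB u v l l' : modulus_cvg u l -> modulus_cvg v l' ->
  modulus_cvg (fun m => u m - v m) (l - l').
Proof.
move=> h h'; have := cvgD h h'; rewrite addr0 => /(_ _) hs.
apply: (squeeze_cvgr (h := fun m => modulus (l - u m) + modulus (l' - v m)) _ (cvg_cst (0 : R)) hs).
near=> m; rewrite modulus_ge0 /=.
rewrite -[X in _ <= _ + X]modulusN; apply: le_trans (modulusD _ _).
by rewrite !opprD !opprK addrACA.
Unshelve. all: end_near. Qed.

Lemma modulus_cvg_conj u l : modulus_cvg u l -> modulus_cvg (fun m => conjc (u m)) (conjc l).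
Proof.
by move=> h; rewrite /modulus_cvg; under eq_fun do rewrite -rmorphB modulus_conj.
Qed.

Lemma modulus_cvg_unique u l l' : modulus_cvg u l -> modulus_cvg u l' -> l = l'.
Proof.
move=> h h'; apply/eqP; rewrite -subr_eq0 -modulus_eq0 eq_le modulus_ge0 andbT.
by apply: modulus_cvg_le (modulus_cvgB h h') _ => m; rewrite subrr modulus0.
Qed.

Lemma modulus_cvg_limE u l : modulus_cvg u l -> lim ((u m : C^o) @[m --> \oo]) = l.
Proof. by move=> /complex_cvg h; apply: (cvg_lim (@norm_hausdorff _ _) h). Qed.

(** A telescoping series dominated by a geometric one. *)
Lemma geometric_cvg (v : nat -> R) (B z : R) : 0 <= z < 1 ->
  (forall m, `|v m.+1 - v m| <= B * z ^+ m) -> cvgn v.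
Proof.
move=> /andP[z0 z1] hv.
have h : cvgn (series (telescope v)).
  apply: normed_cvg; apply: (@series_le_cvg R _ (geometric B z)) => //=.
  - by move=> k; apply: le_trans (normr_ge0 _) (hv k).
  by apply: is_cvg_geometric_series; rewrite ger0_norm.
have -> : v = (fun m => v 0%N + series (telescope v) m).
  by apply/funext => m; exact: eq_sum_telescope.
by apply: is_cvgD => //; exact: is_cvg_cst.
Qed.

Lemma geometric_modulus_cvg u (B z : R) : 0 <= z < 1 ->
  (forall m, modulus (u m.+1 - u m) <= B * z ^+ m) -> exists l, modulus_cvg u l.
Proof.
move=> hz hu.
have hr : cvgn (fun m => complex.Re (u m)).
  by apply: (geometric_cvg hz) => m; rewrite -Re_sub; apply: le_trans (Re_le _) (hu m).
have hi : cvgn (fun m => complex.Im (u m)).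
  by apply: (geometric_cvg hz) => m; rewrite -Im_sub; apply: le_trans (Im_le _) (hu m).
exists (limn (fun m => complex.Re (u m)) +i* limn (fun m => complex.Im (u m))).
have h0 (v : nat -> R) : cvgn v -> `|limn v - v m| @[m --> \oo] --> (0 : R).
  move=> hv; rewrite -[X in _ --> X](@normr0 _ R); apply: cvg_norm.
  by rewrite -[X in _ --> X](subrr (limn v)); apply: cvgB => //; exact: cvg_cst.
have := cvgD (h0 _ hr) (h0 _ hi); rewrite addr0 => /(_ _) h.
apply: (squeeze_cvgr (h := fun m => `|limn (fun m => complex.Re (u m)) - complex.Re (u m)|
  + `|limn (fun m => complex.Im (u m)) - complex.Im (u m)|) _ (cvg_cst (0 : R)) h).
near=> m; rewrite modulus_ge0 /=; apply: le_trans (modulus_le _) _.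
by rewrite Re_sub Im_sub.
Unshelve. all: end_near. Qed.

End ModulusLimits.

Section InfiniteProduct.
Variables (R : realType) (q : R).
Hypothesis q01 : 0 < q < 1.
Local Notation C := R[i].
Implicit Types x y : C.
Local Notation pp x m := (qpoch x q%:C m).
Let q0 : 0 < q. Proof. by case/andP: q01. Qed.
Let q1 : q < 1. Proof. by case/andP: q01. Qed.

Let bnd m : R := \prod_(0 <= k < m) (1 + q ^+ k).
Let geo m : R := \sum_(0 <= k < m) q ^+ k.

Lemma geo_le m : geo m <= (1 - q)^-1.
Proof.
have h : (1 - q) * geo m = 1 - q ^+ m.
  rewrite /geo; elim: m => [|m IH]; first by rewrite big_geq // mulr0 expr0 subrr.
  by rewrite big_nat_recr //= mulrDr IH exprS; ring.
rewrite -[leRHS]mul1r ler_pdivlMr ?subr_gt0 // mulrC h gerBl exprn_ge0 //; exact: ltW.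
Qed.

Lemma bnd_ge0 m : 0 <= bnd m.
Proof. by apply: prodr_ge0 => k _; rewrite addr_ge0 // exprn_ge0 // ltW. Qed.

(** From [1 + q^k <= exp(q^k)] and the geometric series. *)
Definition prod_bound : R := expR (1 - q)^-1.

Lemma bnd_le m : bnd m <= prod_bound.
Proof.
apply: (@le_trans _ _ (expR (geo m))); last by rewrite ler_expR geo_le.
rewrite /geo /bnd; elim: m => [|m IH]; first by rewrite !big_geq // expR0.
rewrite !big_nat_recr //= expRD; apply: ler_pM => //.
- exact: bnd_ge0.
- by rewrite addr_ge0 // exprn_ge0 // ltW.
exact: expR_ge1Dx.
Qed.

Lemma ppS x m : pp x m.+1 = pp x m * (1 - x * q%:C ^+ m).
Proof. by rewrite /qpoch big_nat_recr. Qed.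

Lemma modulus_qpow m : modulus (q%:C ^+ m) = q ^+ m.
Proof. by rewrite -rmorphXn /= modulus_real ger0_norm // exprn_ge0 // ltW. Qed.

Lemma pp_factor x m : modulus x <= 1 -> modulus (1 - x * q%:C ^+ m) <= 1 + q ^+ m.
Proof.
move=> hx; apply: le_trans (modulusD _ _) _; rewrite modulus1 modulusN modulusM modulus_qpow.
by rewrite lerD2l -[leRHS]mul1r ler_wpM2r // exprn_ge0 // ltW.
Qed.

Lemma pp_le_bnd x m : modulus x <= 1 -> modulus (pp x m) <= bnd m.
Proof.
move=> hx; rewrite /bnd; elim: m => [|m IH]; first by rewrite /qpoch !big_geq // modulus1.
rewrite ppS modulusM big_nat_recr //=; apply: ler_pM; rewrite ?modulus_ge0 //.
exact: pp_factor.
Qed.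

(** The Lipschitz constants of the partial products are bounded uniformly in [m], so
    they pass to the limit. *)
Lemma pp_lip x y m : modulus x <= 1 -> modulus y <= 1 ->
  modulus (pp x m - pp y m) <= bnd m * geo m * modulus (x - y).
Proof.
move=> hx hy; elim: m => [|m IH].
  by rewrite /qpoch !big_geq // subrr modulus0 /geo /bnd !big_geq // mulr0 mul0r.
have -> : pp x m.+1 - pp y m.+1 = (pp x m - pp y m) * (1 - x * q%:C ^+ m)
    + pp y m * (- (x - y) * q%:C ^+ m) by rewrite !ppS; ring.
apply: le_trans (modulusD _ _) _; rewrite !modulusM modulusN modulus_qpow.
have h1 : modulus (pp x m - pp y m) * modulus (1 - x * q%:C ^+ m) <=
   bnd m * geo m * modulus (x - y) * (1 + q ^+ m).
  by apply: ler_pM; rewrite ?modulus_ge0 //; exact: pp_factor.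
have qm : 0 <= q ^+ m by rewrite exprn_ge0 // ltW.
have h2 : modulus (pp y m) * (modulus (x - y) * q ^+ m) <=
   bnd m * (modulus (x - y) * q ^+ m) * (1 + q ^+ m).
  apply: (@le_trans _ _ (bnd m * (modulus (x - y) * q ^+ m))).
    by rewrite ler_wpM2r ?mulr_ge0 ?modulus_ge0 // pp_le_bnd.
  by rewrite ler_peMr ?lerDl // !mulr_ge0 ?bnd_ge0 ?modulus_ge0.
apply: le_trans (lerD h1 h2) _.
rewrite [bnd m.+1]big_nat_recr //= [geo m.+1]big_nat_recr //= -/(bnd m) -/(geo m).
by rewrite le_eqVlt; apply/orP; left; apply/eqP; ring.
Qed.

Lemma qpoch_cvg x : modulus x <= 1 -> modulus_cvg (fun m => pp x m) (qpoch_inf x q%:C).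
Proof.
move=> hx.
have [l hl] : exists l, modulus_cvg (fun m => pp x m) l.
  apply: (@geometric_modulus_cvg _ _ prod_bound q); first by rewrite ltW.
  move=> m; have -> : pp x m.+1 - pp x m = pp x m * (- (x * q%:C ^+ m)) by rewrite ppS; ring.
  rewrite modulusM modulusN modulusM modulus_qpow; apply: ler_pM.
  - exact: modulus_ge0.
  - by rewrite mulr_ge0 ?modulus_ge0 // exprn_ge0 // ltW.
  - exact: le_trans (pp_le_bnd m hx) (bnd_le m).
  by rewrite -[leRHS]mul1r ler_wpM2r // exprn_ge0 // ltW.
by rewrite /qpoch_inf (modulus_cvg_limE hl).
Qed.

Lemma qpoch_inf_le x : modulus x <= 1 -> modulus (qpoch_inf x q%:C) <= prod_bound.
Proof.
move=> hx; apply: modulus_cvg_le (qpoch_cvg hx) _ => m.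
exact: le_trans (pp_le_bnd m hx) (bnd_le m).
Qed.

Lemma qpoch_inf_lip x y : modulus x <= 1 -> modulus y <= 1 ->
  modulus (qpoch_inf x q%:C - qpoch_inf y q%:C) <= prod_bound * (1 - q)^-1 * modulus (x - y).
Proof.
move=> hx hy; apply: modulus_cvg_le (modulus_cvgB (qpoch_cvg hx) (qpoch_cvg hy)) _ => m.
apply: le_trans (pp_lip m hx hy) _; rewrite ler_wpM2r ?modulus_ge0 //.
apply: ler_pM; rewrite ?bnd_ge0 ?bnd_le ?geo_le //.
by apply: sumr_ge0 => k _; rewrite exprn_ge0 // ltW.
Qed.

Lemma qpoch_inf_conj x : modulus x <= 1 -> qpoch_inf (conjc x) q%:C = conjc (qpoch_inf x q%:C).
Proof.
move=> hx; apply: modulus_cvg_unique (modulus_cvg_conj (qpoch_cvg hx)).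
have h : modulus (conjc x) <= 1 by rewrite modulus_conj.
have := qpoch_cvg h; congr (modulus_cvg _ _); apply/funext => m.
rewrite /qpoch rmorph_prod; apply: eq_bigr => k _.
rewrite rmorphB rmorph1 rmorphM rmorphXn; congr (_ - _ * _ ^+ k).
exact/esym/conjc_real.
Qed.

(** The factor of index [0] is not [0] as [x != 1]. The others have modulus at least
    [1 - q^k >= exp(- q^k / (1 - q))], so the partial products stay away from [0]. *)
Lemma qpoch_inf_neq0 x : modulus x <= 1 -> x != 1 -> qpoch_inf x q%:C != 0.
Proof.
move=> hx x1; rewrite -modulus_eq0 gt_eqF //.
have h1 : 0 < modulus (1 - x) by rewrite lt_def modulus_ge0 andbT modulus_eq0 subr_eq0 eq_sym.
apply: (@lt_le_trans _ _ (modulus (1 - x) * expR (- ((1 - q)^-1 * (1 - q)^-1)))).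
  by rewrite mulr_gt0 ?expR_gt0.
apply: modulus_cvg_ge (qpoch_cvg hx) _ => m.
apply: (@le_trans _ _ (modulus (1 - x) * expR (- ((1 - q)^-1 * geo m.+1)))).
  by rewrite ler_wpM2l ?modulus_ge0 // ler_expR lerN2 ler_wpM2l ?geo_le // invr_ge0 subr_ge0 ltW.
elim: m => [|m IH].
  have -> : pp x 1 = 1 - x by rewrite ppS /qpoch big_geq // mul1r expr0 mulr1.
  rewrite -[leRHS]mulr1 ler_wpM2l ?modulus_ge0 // -[leRHS]expR0 ler_expR oppr_le0.
  apply: mulr_ge0; first by rewrite invr_ge0 subr_ge0 ltW.
  by rewrite /geo big_nat1 expr0 ler01.
rewrite ppS modulusM /geo big_nat_recr //= -/(geo m.+1) mulrDr opprD expRD mulrA.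
apply: ler_pM => //; rewrite ?mulr_ge0 ?modulus_ge0 ?expR_ge0 //.
have qm1 : q ^+ m.+1 <= q by rewrite exprS ger_pMr // exprn_ile1 // ltW.
have qm0 : 0 < q ^+ m.+1 by rewrite exprn_gt0.
have h2 : 1 - q ^+ m.+1 <= modulus (1 - x * q%:C ^+ m.+1).
  have := modulusD (1 - x * q%:C ^+ m.+1) (x * q%:C ^+ m.+1).
  rewrite subrK modulus1 modulusM modulus_qpow.
  have : modulus x * q ^+ m.+1 <= q ^+ m.+1 by rewrite ger_pMl.
  lra.
have h3 : 0 < 1 - q ^+ m.+1 by rewrite subr_gt0 (le_lt_trans qm1 q1).
apply: le_trans h2; rewrite expRN -[leRHS]invrK lef_pV2 ?posrE ?expR_gt0 ?invr_gt0 //.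
apply: le_trans (expR_ge1Dx _).
have -> : (1 - q ^+ m.+1)^-1 = 1 + (1 - q ^+ m.+1)^-1 * q ^+ m.+1.
  by field; rewrite gt_eqF.
rewrite lerD2l; apply: ler_wpM2r; first exact: ltW.
by rewrite lef_pV2 ?posrE ?subr_gt0 ?(le_lt_trans qm1 q1) // lerD2l lerN2.
Qed.

End InfiniteProduct.

(** * Lipschitz functions on the torus *)

Section UnitCircle.
Variable R : realType.
Local Notation C := R[i].

Definition cis (x : R) : C := cos x +i* sin x.

Lemma derive_le_lip (f g : R -> R) : (forall x : R, is_derive x 1 f (g x)) ->
  (forall x, `|g x| <= 1) -> forall x y, `|f x - f y| <= `|x - y|.
Proof.
move=> df hg x y; wlog xy : x y / y < x.
  move=> h; case: (ltgtP y x) => [||->]; [exact: h| |by rewrite !subrr normr0].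
  by move=> /h; rewrite distrC [`|y - x|]distrC.
have [c _ ->] := MVT xy (fun x _ => df x) (continuous_subspaceT (derive_continuous df)).
by rewrite normrM -[leRHS]mul1r ler_wpM2r.
Qed.

Lemma modulus_cis x : modulus (cis x) = 1.
Proof. by rewrite /modulus normc_def /= cos2Dsin2 sqrtr1. Qed.

Lemma cis_lip x y : modulus (cis x - cis y) <= 2 * `|x - y|.
Proof.
apply: le_trans (modulus_le _) _; rewrite Re_sub Im_sub /= mulr2n mulrDl mul1r; apply: lerD.
  by apply: (derive_le_lip (g := fun x => - sin x)) => z; rewrite ?normrN ?sin_max.
by apply: (derive_le_lip (g := cos)) => z; rewrite ?cos_max.
Qed.

Lemma cisD x y : cis (x + y) = cis x * cis y.
Proof. by rewrite /cis cosD sinD; apply/eqP; rewrite eq_complex /= addrC eqxx /=; apply/eqP; ring. Qed.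

Lemma cisN x : cis (- x) = conjc (cis x).
Proof. by rewrite /cis cosN sinN. Qed.

Lemma cis0 : cis 0 = 1. Proof. by rewrite /cis cos0 sin0. Qed.

Lemma cisV x : (cis x)^-1 = conjc (cis x).
Proof.
rewrite -cisN; apply: (mulrI (x := cis x)).
  by rewrite unitfE -modulus_eq0 modulus_cis oner_eq0.
by rewrite mulfV -?cisD ?subrr ?cis0 // -modulus_eq0 modulus_cis oner_eq0.
Qed.

Lemma cis_neq0 x : cis x != 0.
Proof. by rewrite -modulus_eq0 modulus_cis oner_eq0. Qed.

Lemma cis_neq1 x : 0 < x < 2 * pi -> cis x != 1.
Proof.
move=> /andP[x0 x1]; apply/eqP => /(congr1 (@complex.Re R)) /= h.
have : 0 < sin (x / 2) by apply: sin_gt0_pi; rewrite divr_gt0 //= ltr_pdivrMr // mulrC.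
have : cos (x / 2 *+ 2) = 1 by rewrite -mulr_natr mulfVK.
rewrite cos_mulr2n cos2sin2 => e s.
have : sin (x / 2) ^+ 2 = 0 by lra.
by move/eqP; rewrite expf_eq0 /= gt_eqF.
Qed.

End UnitCircle.

Section ComplexLipschitz.
Variables (R : realType) (n : nat).
Local Notation C := R[i].
Implicit Types f g : seq R -> C.

(** Bounded and Lipschitz on lists of size [n]; boundedness makes the class stable under
    products. *)
Definition lipC f := exists M : R, forall s s', size s = n -> size s' = n ->
  modulus (f s) <= M /\ modulus (f s - f s') <= M * l1dist n s s'.

Lemma eq_lipC f g : (forall s, f s = g s) -> lipC f -> lipC g.
Proof. by move=> /funext ->. Qed.

Lemma lipC_cst c : lipC (fun=> c).
Proof.
exists (modulus c) => s s' _ _; split=> //.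
by rewrite subrr modulus0 mulr_ge0 ?modulus_ge0 ?l1dist_ge0.
Qed.

Lemma lipCD f g : lipC f -> lipC g -> lipC (fun s => f s + g s).
Proof.
move=> [M hf] [M' hg]; exists (M + M') => s s' hs hs'.
have [h1 h2] := hf s s' hs hs'; have [h3 h4] := hg s s' hs hs'; split.
  by apply: le_trans (modulusD _ _) (lerD h1 h3).
by rewrite opprD addrACA mulrDl; apply: le_trans (modulusD _ _) (lerD h2 h4).
Qed.

Lemma lipCM f g : lipC f -> lipC g -> lipC (fun s => f s * g s).
Proof.
move=> [M hf] [M' hg]; exists (Num.max (M * M') (M * M' + M * M')) => s s' hs hs'.
have [h1 h2] := hf s s' hs hs'; have [h3 h4] := hg s s' hs hs'.
have [h1' _] := hf s' s hs' hs.
split.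
  rewrite modulusM le_max; apply/orP; left.
  by apply: ler_pM => //; exact: modulus_ge0.
apply: (@le_trans _ _ ((M * M' + M * M') * l1dist n s s')); last first.
  by rewrite ler_wpM2r ?l1dist_ge0 // le_max lexx orbT.
have -> : f s * g s - f s' * g s' = (f s - f s') * g s + f s' * (g s - g s') by ring.
apply: le_trans (modulusD _ _) _; rewrite !modulusM mulrDl; apply: lerD.
  by rewrite mulrAC; apply: ler_pM => //; exact: modulus_ge0.
by rewrite -mulrA; apply: ler_pM => //; exact: modulus_ge0.
Qed.

Lemma lipC_conj f : lipC f -> lipC (fun s => conjc (f s)).
Proof. by move=> [M hf]; exists M => s s' hs hs'; rewrite -rmorphB !modulus_conj; exact: hf. Qed.

Lemma lipC_sum (I : Type) (r : seq I) (P : pred I) (F : I -> seq R -> C) :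
  (forall i, lipC (F i)) -> lipC (fun s => \sum_(i <- r | P i) F i s).
Proof.
move=> h; elim: r => [|i r IH].
  have -> : (fun s => \sum_(i <- [::] | P i) F i s) = (fun=> 0).
    by apply/funext => s; rewrite big_nil.
  exact: lipC_cst.
have [hi|hi] := boolP (P i).
  have -> : (fun s => \sum_(i <- i :: r | P i) F i s) = (fun s => F i s + \sum_(i <- r | P i) F i s).
    by apply/funext => s; rewrite big_cons hi.
  exact: lipCD.
suff -> : (fun s => \sum_(i <- i :: r | P i) F i s) = (fun s => \sum_(i <- r | P i) F i s) by [].
by apply/funext => s; rewrite big_cons (negPf hi).
Qed.

Lemma lipC_prod (I : Type) (r : seq I) (P : pred I) (F : I -> seq R -> C) :
  (forall i, lipC (F i)) -> lipC (fun s => \prod_(i <- r | P i) F i s).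
Proof.
move=> h; elim: r => [|i r IH].
  have -> : (fun s => \prod_(i <- [::] | P i) F i s) = (fun=> 1).
    by apply/funext => s; rewrite big_nil.
  exact: lipC_cst.
have [hi|hi] := boolP (P i).
  have -> : (fun s => \prod_(i <- i :: r | P i) F i s) = (fun s => F i s * \prod_(i <- r | P i) F i s).
    by apply/funext => s; rewrite big_cons hi.
  exact: lipCM.
suff -> : (fun s => \prod_(i <- i :: r | P i) F i s) = (fun s => \prod_(i <- r | P i) F i s) by [].
by apply/funext => s; rewrite big_cons (negPf hi).
Qed.

Lemma lipC_Re f : lipC f -> is_lipschitz n (fun s => complex.Re (f s)).
Proof.
move=> [M hf]; exists M => s s' hs hs'; have [_ h] := hf s s' hs hs'.
by rewrite -Re_sub; exact: le_trans (Re_le _) h.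
Qed.

Lemma lipC_Im f : lipC f -> is_lipschitz n (fun s => complex.Im (f s)).
Proof.
move=> [M hf]; exists M => s s' hs hs'; have [_ h] := hf s s' hs hs'.
by rewrite -Im_sub; exact: le_trans (Im_le _) h.
Qed.

Local Notation tp s := (@torus_point R n s).

Lemma torus_pointE s j : tp s j = cis s`_j. Proof. by []. Qed.

Lemma lipC_point j : lipC (fun s => tp s j).
Proof.
exists 2 => s s' hs hs'; rewrite !torus_pointE modulus_cis; split; first by rewrite ler1n.
apply: le_trans (cis_lip _ _) _; rewrite ler_wpM2l //.
by rewrite /l1dist (bigD1 j) //= lerDl sumr_ge0.
Qed.

Lemma lipC_inv j : lipC (fun s => (tp s j)^-1).
Proof.
have -> : (fun s => (tp s j)^-1) = (fun s => conjc (tp s j)).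
  by apply/funext => s; rewrite torus_pointE cisV.
exact/lipC_conj/lipC_point.
Qed.

Lemma lipC_exprn f k : lipC f -> lipC (fun s => f s ^+ k).
Proof.
move=> hf; have := @lipC_prod nat (iota 0 k) xpredT (fun=> f) (fun=> hf).
congr lipC; apply/funext => s; by rewrite big_const_seq count_predT size_iota -Monoid.iteropE.
Qed.

Lemma lipC_exprz j (k : int) : lipC (fun s => tp s j ^ k).
Proof.
case: k => k; first exact: lipC_exprn (lipC_point j).
have := lipC_exprn k.+1 (lipC_inv j); congr lipC; apply/funext => s.
by rewrite NegzE -exprnN exprVn.
Qed.

Lemma lipC_qpoch (q : R) f : 0 < q < 1 -> (forall s, modulus (f s) <= 1) -> lipC f ->
  lipC (fun s => qpoch_inf (f s) q%:C).
Proof.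
move=> q01 h1 [M hf].
have B0 : 0 <= prod_bound q by exact: expR_ge0.
exists (Num.max (prod_bound q) (prod_bound q * (1 - q)^-1 * M)) => s s' hs hs'.
have [_ h] := hf s s' hs hs'; split; first by rewrite le_max qpoch_inf_le.
apply: (@le_trans _ _ (prod_bound q * (1 - q)^-1 * M * l1dist n s s')); last first.
  by rewrite ler_wpM2r ?l1dist_ge0 // le_max lexx orbT.
apply: le_trans (qpoch_inf_lip q01 _ _) _ => //.
rewrite -[leRHS]mulrA ler_wpM2l // mulr_ge0 // invr_ge0 subr_ge0 ltW //.
by case/andP: q01.
Qed.

End ComplexLipschitz.

(** * The scalar product on the torus *)

Section TorusProduct.
Variables (R : realType) (n : nat) (q : R).
Hypothesis q01 : 0 < q < 1.
Local Notation C := R[i].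
Local Notation tp s := (@torus_point R n s).
Local Notation Delta := (@Delta_hat R n q).
Implicit Types f g : ('I_n -> C) -> C.

Definition lip_on_torus f := lipC n (fun s => f (tp s)).

Let fac (s : seq R) (x : R) : C := qpoch_inf (cis x) q%:C.

Lemma fac_conj s x : fac s (- x) = conjc (fac s x).
Proof. by rewrite /fac cisN qpoch_inf_conj // modulus_cis. Qed.

Let squares (s : seq R) : C :=
  (\prod_(j < n) (fac s (s`_j + s`_j) * conjc (fac s (s`_j + s`_j)))) *
  \prod_(j < n) \prod_(k < n | (j < k)%N)
    ((fac s (s`_j + s`_k) * conjc (fac s (s`_j + s`_k))) *
     (fac s (s`_k - s`_j) * conjc (fac s (s`_k - s`_j)))).

(** On the torus inversion is conjugation, so the factors pair off into squared
    moduli. *)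
Lemma Delta_torus s : Delta (tp s) = squares s.
Proof.
rewrite /Delta_hat; congr (_ * _).
  apply: eq_bigr => j _; rewrite -fac_conj opprD /fac !cisD !cisN -!cisV !torus_pointE.
  by rewrite -invfM !expr2.
apply: eq_bigr => j _; apply: eq_bigr => k _.
rewrite -!fac_conj !opprD opprK /fac !cisD !cisN -!cisV !torus_pointE.
by rewrite [(cis _)^-1 * cis s`_k]mulrC [cis s`_j * (cis _)^-1]mulrC; ring.
Qed.

Lemma conjcM_ge0 (x : C) : 0 <= x * conjc x. Proof. exact: mulcJ_ge0. Qed.

(** A product of squared moduli. *)
Lemma Delta_ge0 s : 0 <= Delta (tp s).
Proof.
rewrite Delta_torus; apply: mulr_ge0; apply: prodr_ge0 => j _; first exact: conjcM_ge0.
by apply: prodr_ge0 => k _; apply: mulr_ge0; exact: conjcM_ge0.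
Qed.

Lemma lipC_fac (x : seq R -> R) : lipC n (fun s => cis (x s)) -> lipC n (fun s => fac s (x s)).
Proof. by apply: lipC_qpoch => // s; rewrite modulus_cis. Qed.

Lemma lipC_Delta : lip_on_torus Delta.
Proof.
rewrite /lip_on_torus; have -> : (fun s => Delta (tp s)) = squares by apply/funext => s; exact: Delta_torus.
have hD (j k : 'I_n) : lipC n (fun s : seq R => cis (s`_j + s`_k)).
  apply: (eq_lipC _ (lipCM (@lipC_point R n j) (@lipC_point R n k))) => s.
  by rewrite cisD.
have hB (j k : 'I_n) : lipC n (fun s : seq R => cis (s`_j - s`_k)).
  apply: (eq_lipC _ (lipCM (@lipC_point R n j) (@lipC_inv R n k))) => s.
  by rewrite cisD cisN -cisV.
apply: lipCM; apply: lipC_prod => j.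
  by apply: lipCM; [|apply: lipC_conj]; apply: lipC_fac.
apply: lipC_prod => k; apply: lipCM; apply: lipCM; [|apply: lipC_conj| |apply: lipC_conj];
  exact: lipC_fac.
Qed.

Lemma fac_neq0 s x : 0 < x < 2 * pi -> fac s x * conjc (fac s x) != 0.
Proof.
move=> hx; have h : fac s x != 0 by rewrite qpoch_inf_neq0 ?modulus_cis ?cis_neq1.
by rewrite mulf_neq0 // conjc_eq0.
Qed.

(** Angles in the open interval from [0] to [pi], in increasing order: none of the
    arguments of the infinite products equals [1] there. *)
Definition base_point : seq R := [seq pi * (j.+1%:R / n.+1%:R) | j <- iota 0 n].

Lemma base_point_nth j : (j < n)%N -> base_point`_j = pi * (j.+1%:R / n.+1%:R).
Proof. by move=> hj; rewrite (nth_map 0%N) ?size_iota // nth_iota. Qed.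

Lemma base_point_itv j : (j < n)%N -> 0 < base_point`_j < pi.
Proof.
move=> hj; rewrite base_point_nth //; have := @pi_gt0 R => p0.
rewrite mulr_gt0 ?divr_gt0 ?ltr0n //= -[ltRHS]mulr1 ltr_pM2l //.
by rewrite ltr_pdivrMr ?ltr0n // mul1r ltr_nat.
Qed.

Lemma Delta_base : 0 < Delta (tp base_point).
Proof.
rewrite lt_def Delta_ge0 andbT Delta_torus mulf_neq0 //.
  apply/prodf_neq0 => j _; apply: fac_neq0.
  by have /andP[h1 h2] := base_point_itv (ltn_ord j); apply/andP; split; lra.
apply/prodf_neq0 => j _; apply/prodf_neq0 => k jk.
have /andP[h1 h2] := base_point_itv (ltn_ord j).
have /andP[h3 h4] := base_point_itv (ltn_ord k).
have h5 : base_point`_j < base_point`_k.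
  by rewrite !base_point_nth // ltr_pM2l ?pi_gt0 // ltr_pM2r ?invr_gt0 ?ltr0n // ltr_nat.
by apply: mulf_neq0; apply: fac_neq0; apply/andP; split; lra.
Qed.

Local Notation J f := (cube_integral n (fun s => complex.Re (f s)) +i*
   cube_integral n (fun s => complex.Im (f s)) : C).

Lemma JD (f g : seq R -> C) : lipC n f -> lipC n g -> J (fun s => f s + g s) = J f + J g.
Proof.
move=> hf hg; apply/eqP; rewrite eq_complex /=; apply/andP; split; apply/eqP.
  by rewrite -cubeD; [apply: eq_cube => s _; rewrite Re_add|exact: lipC_Re|exact: lipC_Re].
by rewrite -cubeD; [apply: eq_cube => s _; rewrite Im_add|exact: lipC_Im|exact: lipC_Im].
Qed.

Lemma JZ (r : R) (f : seq R -> C) : lipC n f -> J (fun s => r%:C * f s) = r%:C * J f.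
Proof.
move=> hf; apply/eqP; rewrite eq_complex Re_mul Im_mul /= !mul0r subr0 addr0; apply/andP; split; apply/eqP.
  by rewrite -cubeZ; [apply: eq_cube => s _; rewrite Re_mul /= mul0r subr0|exact: lipC_Re].
by rewrite -cubeZ; [apply: eq_cube => s _; rewrite Im_mul /= mul0r addr0|exact: lipC_Im].
Qed.

Lemma J_bound (f : seq R -> C) c : lipC n f -> (forall s, size s = n -> modulus (f s) <= c) ->
  modulus (J f) <= (2 * pi) ^+ n * c + (2 * pi) ^+ n * c.
Proof.
move=> hf hc; apply: le_trans (modulus_le _) _ => /=; apply: lerD; apply: cube_bound.
- exact: lipC_Re.
- by move=> s hs; exact: le_trans (Re_le _) (hc s hs).
- exact: lipC_Im.
by move=> s hs; exact: le_trans (Im_le _) (hc s hs).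
Qed.

Let integrand f g (s : seq R) : C := f (tp s) * conjc (g (tp s)) * Delta (tp s).
Let const : C := (n`!%:R)^-1 * (((2 * pi) ^+ n)^-1)%:C.

Lemma torus_prodE f g : torus_prod q f g = const * J (integrand f g).
Proof. by rewrite /torus_prod /torus_mean -mulrA. Qed.

Lemma lipC_integrand f g : lip_on_torus f -> lip_on_torus g -> lipC n (integrand f g).
Proof.
move=> hf hg; apply: lipCM; last exact: lipC_Delta.
by apply: lipCM => //; exact: lipC_conj.
Qed.

Lemma eq_torus_prod f f' g g' : (forall s, f (tp s) = f' (tp s)) -> (forall s, g (tp s) = g' (tp s)) ->
  torus_prod q f g = torus_prod q f' g'.
Proof.
move=> h h'; rewrite !torus_prodE; suff -> : integrand f g = integrand f' g' by [].
by apply/funext => s; rewrite /integrand h h'.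
Qed.

Lemma torus_prodDl f f' g : lip_on_torus f -> lip_on_torus f' -> lip_on_torus g ->
  torus_prod q (fun b => f b + f' b) g = torus_prod q f g + torus_prod q f' g.
Proof.
move=> hf hf' hg; rewrite !torus_prodE -mulrDr; congr (_ * _).
rewrite -JD; [|exact: lipC_integrand|exact: lipC_integrand].
have -> // : integrand (fun b => f b + f' b) g = (fun s => integrand f g s + integrand f' g s).
by apply/funext => s; rewrite /integrand; ring.
Qed.

(** The scalars are real, as the rates are: the product is then linear in both
    arguments. *)
Lemma torus_prodZl (r : R) f g : lip_on_torus f -> lip_on_torus g ->
  torus_prod q (fun b => r%:C * f b) g = r%:C * torus_prod q f g.
Proof.
move=> hf hg; rewrite !torus_prodE mulrCA; congr (_ * _).
rewrite -JZ; last exact: lipC_integrand.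
have -> // : integrand (fun b => r%:C * f b) g = (fun s => r%:C * integrand f g s).
by apply/funext => s; rewrite /integrand; ring.
Qed.

Lemma torus_prodDr f g g' : lip_on_torus f -> lip_on_torus g -> lip_on_torus g' ->
  torus_prod q f (fun b => g b + g' b) = torus_prod q f g + torus_prod q f g'.
Proof.
move=> hf hg hg'; rewrite !torus_prodE -mulrDr; congr (_ * _).
rewrite -JD; [|exact: lipC_integrand|exact: lipC_integrand].
have -> // : integrand f (fun b => g b + g' b) = (fun s => integrand f g s + integrand f g' s).
by apply/funext => s; rewrite /integrand rmorphD; ring.
Qed.

Lemma conjc_realM (r : R) (x : C) : conjc (r%:C * x) = r%:C * conjc x.
Proof. by rewrite rmorphM; congr (_ * _); exact: conjc_real. Qed.

Lemma torus_prodZr (r : R) f g : lip_on_torus f -> lip_on_torus g ->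
  torus_prod q f (fun b => r%:C * g b) = r%:C * torus_prod q f g.
Proof.
move=> hf hg; rewrite !torus_prodE mulrCA; congr (_ * _).
rewrite -JZ; last exact: lipC_integrand.
have -> // : integrand f (fun b => r%:C * g b) = (fun s => r%:C * integrand f g s).
apply/funext => s; rewrite /integrand conjc_realM; ring.
Qed.

(** Uniform convergence on the torus may be integrated against [g]. *)
Lemma torus_prod_bound g : lip_on_torus g -> exists2 B : R, 0 <= B & forall f c, lip_on_torus f ->
  (forall s, size s = n -> modulus (f (tp s)) <= c) -> modulus (torus_prod q f g) <= B * c.
Proof.
move=> hg; have [M hM] := lipCM (lipC_conj hg) lipC_Delta.
have M0 : 0 <= `|M| by [].
exists (modulus const * ((2 * pi) ^+ n * `|M| + (2 * pi) ^+ n * `|M|)).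
  by rewrite mulr_ge0 ?modulus_ge0 // addr_ge0 // mulr_ge0 // exprn_ge0 // ltW // two_pi_gt0.
move=> f c hf hc; rewrite torus_prodE modulusM -mulrA ler_wpM2l ?modulus_ge0 //.
rewrite mulrDl -!mulrA; apply: J_bound; first exact: lipC_integrand.
move=> s hs; rewrite /integrand -mulrA modulusM mulrC; apply: ler_pM; rewrite ?modulus_ge0 ?hc //.
by have [h _] := hM s s hs hs; exact: le_trans h (ler_norm _).
Qed.

Lemma torus_prod_one : torus_prod q (fun _ : 'I_n -> C => 1) (fun=> 1) != 0.
Proof.
rewrite torus_prodE; have -> : integrand (fun=> 1) (fun=> 1) = (fun s => Delta (tp s)).
  by apply/funext => s; rewrite /integrand conjc1 !mul1r.
apply: mulf_neq0.
  have h : (2 * pi) ^+ n != 0 :> R by rewrite expf_neq0 // gt_eqF // two_pi_gt0.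
  apply: mulf_neq0; first by rewrite invr_eq0 pnatr_eq0 -lt0n fact_gt0.
  by rewrite -[0 in X in _ != X](@rmorph0 _ _ (real_complex R)) (inj_eq (@complexI R)) invr_eq0.
apply/eqP => /(congr1 (@complex.Re R)) /= h.
suff : 0 < cube_integral n (fun s => complex.Re (Delta (tp s))) by rewrite h ltxx.
apply: (cube_gt0 (s0 := base_point)).
- exact: lipC_Re lipC_Delta.
- by move=> s _; have := Delta_ge0 s; rewrite lecE /= => /andP[].
- by rewrite size_map size_iota.
- apply/(all_nthP 0) => j; rewrite size_map size_iota => /base_point_itv /andP[-> h2].
  by rewrite (lt_trans h2) // mulr2n mulrDl mul1r ltrDl pi_gt0.
by have := Delta_base; rewrite ltcE /= => /andP[].
Qed.

Lemma lip_cst c : lip_on_torus (fun=> c). Proof. exact: lipC_cst. Qed.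

Lemma torus_prod_sum (I : Type) (r : seq I) (c : I -> R) (F : I -> ('I_n -> C) -> C) g :
  (forall i, lip_on_torus (F i)) -> lip_on_torus g ->
  torus_prod q (fun b => \sum_(i <- r) (c i)%:C * F i b) g = \sum_(i <- r) (c i)%:C * torus_prod q (F i) g.
Proof.
move=> hF hg; have hZ i : lip_on_torus (fun b => (c i)%:C * F i b) by apply: lipCM; [exact: lipC_cst|exact: hF].
elim: r => [|i r IH].
  rewrite big_nil -[RHS](mul0r (torus_prod q (fun=> 1) g)) -torus_prodZl //; last exact: lip_cst.
  by apply: eq_torus_prod => // s; rewrite big_nil mul0r.
rewrite big_cons -IH -torus_prodZl // -torus_prodDl //; last exact: lipC_sum.
by apply: eq_torus_prod => // s; rewrite big_cons.
Qed.

Lemma torus_prod_sumr (I : Type) (r : seq I) (c : I -> R) (F : I -> ('I_n -> C) -> C) g :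
  (forall i, lip_on_torus (F i)) -> lip_on_torus g ->
  torus_prod q g (fun b => \sum_(i <- r) (c i)%:C * F i b) = \sum_(i <- r) (c i)%:C * torus_prod q g (F i).
Proof.
move=> hF hg; have hZ i : lip_on_torus (fun b => (c i)%:C * F i b) by apply: lipCM; [exact: lipC_cst|exact: hF].
elim: r => [|i r IH].
  rewrite big_nil -[RHS](mul0r (torus_prod q g (fun=> 1))) -torus_prodZr //; last exact: lip_cst.
  by apply: eq_torus_prod => // s; rewrite big_nil mul0r.
rewrite big_cons -IH -torus_prodZr // -torus_prodDr //; last exact: lipC_sum.
by apply: eq_torus_prod => // s; rewrite big_cons.
Qed.

End TorusProduct.

(** * Powers of the Pieri multiplier and norms *)

Section LowerShape.
Variable n : nat.

Lemma shape_support lam i : is_shape n lam -> (n < i)%N -> crd lam i = 0%N.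
Proof. by move=> [hs _]; case: i => // i hi; rewrite /crd /= nth_default // hs. Qed.

(** A box can be removed from the last nonzero part. *)
Lemma last_part lam : is_shape n lam -> lam <> zero_shape n ->
  exists2 i, (1 <= i <= n)%N & (crd lam i.+1 = 0%N /\ (0 < crd lam i)%N).
Proof.
move=> hl hz.
have h1 : (0 < crd lam 1)%N.
  rewrite lt0n; apply/eqP => h; apply: hz; have [hs hso] := hl.
  apply: crd_ext => [|i hi]; first by rewrite hs size_nseq.
  rewrite crd_zero_shape; apply/eqP; rewrite -leqn0 -h.
  case: i hi => // i _; elim: i => [|i IH] //; exact: leq_trans (crd_sorted hso (isT : (0 < i.+1)%N)) IH.
have [i hi hi'] : exists2 i, (0 < crd lam i.+1)%N & crd lam i.+2 = 0%N.
  have hex : exists m, crd lam m.+2 == 0%N by exists n; rewrite (shape_support hl).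
  have := ex_minnP hex => -[m /eqP hm hmin]; exists m => //.
  case: m hm hmin => // m hm hmin; rewrite lt0n; apply/negP => /hmin; by rewrite ltnn.
exists i.+1 => //; rewrite ltnS /= ltnNge; apply/negP => h.
by move: hi; rewrite (shape_support hl).
Qed.

Lemma inc_neq_dec i j (lam : seq nat) : (0 < i)%N -> (0 < j)%N -> (0 < crd lam i)%N -> inc j lam <> dec i lam.
Proof.
move=> hi hj h /(congr1 (crd^~ j)); rewrite crd_inc // crd_dec // eqxx.
by case: eqVneq => [->|_]; lia.
Qed.

Lemma dec_neq_dec i j (lam : seq nat) : (0 < i)%N -> (0 < j)%N -> (0 < crd lam i)%N -> j != i ->
  dec j lam <> dec i lam.
Proof.
move=> hi hj h ji /(congr1 (crd^~ i)); rewrite !crd_dec // eqxx eq_sym (negPf ji); lia.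
Qed.

End LowerShape.

Section RealRates.
Variables (R : realType) (q : R) (n : nat).
Local Notation C := R[i].

Lemma rate_right_complex lam i : rate_right q%:C lam i = (rate_right q lam i)%:C :> C.
Proof. by rewrite /rate_right /edge_gap; case: (i.-1) => [|j]; rewrite ?rmorph1 // rmorphB rmorph1 rmorphXn. Qed.

Lemma rate_left_complex lam i : rate_left q%:C lam i = (rate_left q lam i)%:C :> C.
Proof. by rewrite /rate_left rmorphB rmorph1 rmorphXn. Qed.

Lemma shape_op_complex (f : seq nat -> R) lam :
  shape_op q%:C n (fun mu => (f mu)%:C) lam = (shape_op q n f lam)%:C.
Proof.
rewrite /shape_op rmorph_sum; apply: eq_bigr => i _.
by rewrite rate_right_complex rate_left_complex -!(rmorphM (real_complex R)) -(rmorphD (real_complex R)).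
Qed.

End RealRates.

Section Whittaker.
Variables (R : realType) (n : nat) (q : R).
Hypothesis q01 : 0 < q < 1.
Hypothesis n_gt0 : (0 < n)%N.
Local Notation C := R[i].
Local Notation tp s := (@torus_point R n s).
Local Notation lip_on_torus := (@lip_on_torus R n).
Local Notation prod := (@torus_prod R n q).
Local Notation whit lam := (fun b : 'I_n -> C => calP q%:C lam b).

Lemma qC_neq0 : q%:C != 0 :> C.
Proof. by rewrite -[0 in X in _ != X]/(0%:C) (inj_eq (@complexI R)) (q_neq0 q01). Qed.

Lemma qC_not_root m : q%:C ^+ m.+1 != 1 :> C.
Proof. by rewrite -rmorphXn -[1 in X in _ != X]/(1%:C) (inj_eq (@complexI R)) (q_not_root q01). Qed.

Lemma lip_weight z : lip_on_torus (fun b => weight b q%:C z).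
Proof.
rewrite /lip_on_torus /weight; apply: lipC_prod => k.
apply: lipCM; last exact: lipC_cst.
by apply: lipCM; [exact: lipC_exprz|exact: lipC_cst].
Qed.

(** On the torus [calP] is a finite sum of monomials. If [lam] has the wrong size it is
    an empty sum. *)
Lemma lip_calP lam : lip_on_torus (whit lam).
Proof.
have [hs|hs] := eqVneq (size lam) n.
  pose M := (\max_(e <- lam) e).+1.
  have hM : all (fun e => (e < M)%N) lam.
    by apply/allP => e he; rewrite ltnS; apply: (@leq_bigmax_seq _ _ xpredT id e he).
  have h : lip_on_torus (fun b => \sum_(z <- fibre n M lam) weight b q%:C (val z)).
    by apply: lipC_sum => z; exact: lip_weight.
  apply: eq_lipC h => s; rewrite calP_fibre (fibre_sum_seq _ n_gt0 _ _ hs hM).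
  by apply: eq_bigr => z _; rewrite mulr1.
have h : lip_on_torus (fun=> 0) by exact: lip_cst.
apply: eq_lipC h => s; rewrite /calP fsbig1 // => z hz; case/eqP: hs.
by rewrite -hz (pattern_level_size (valP z)) // sz_double.
Qed.

Lemma calP_zero (b : 'I_n -> C) : calP q%:C (zero_shape n) b = 1 :> C.
Proof.
rewrite /calP; have -> : [set z : pattern n | level (val z) n.*2 = zero_shape n] = [set origin n].
  apply/seteqP; split=> z /=; first exact: zero_level.
  by move=> ->; exact: origin_level.
by rewrite fsbig_set1; exact: weight_origin.
Qed.

(** The multiplier [e] of the Pieri rule. *)
Definition energy (b : 'I_n -> C) : C := \sum_(l < n) (b l + (b l)^-1).

Lemma lip_energy : lip_on_torus energy.
Proof. by apply: lipC_sum => l; apply: lipCD; [exact: lipC_point|exact: lipC_inv]. Qed.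

Lemma lip_energy_pow k : lip_on_torus (fun b => energy b ^+ k).
Proof. exact: lipC_exprn lip_energy. Qed.

Lemma energy_real s : energy (tp s) = (\sum_(l < n) 2 * cos s`_l)%:C.
Proof.
rewrite rmorph_sum; apply: eq_bigr => l _; rewrite torus_pointE cisV addcJ rmorphM /=.
by rewrite -[2%:R in LHS](rmorph_nat (real_complex R)).
Qed.

Lemma pieri_torus s lam : is_shape n lam ->
  energy (tp s) * calP q%:C lam (tp s) = shape_op q%:C n (fun mu => calP q%:C mu (tp s)) lam.
Proof.
move=> hl; apply: pieri => //; [exact: qC_neq0|exact: qC_not_root|].
by move=> i; rewrite torus_pointE cis_neq0.
Qed.

Lemma prod_shape_op (h : ('I_n -> C) -> C) g lam : lip_on_torus h -> lip_on_torus g ->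
  prod (fun b => shape_op q%:C n (fun mu => h b * calP q%:C mu b) lam) g
  = shape_op q%:C n (fun mu => prod (fun b => h b * calP q%:C mu b) g) lam.
Proof.
move=> hh hg.
have hn mu : lip_on_torus (fun b => h b * calP q%:C mu b) by apply: lipCM => //; exact: lip_calP.
have hs (c : nat -> R) (F : nat -> seq nat) :
   lip_on_torus (fun b => \sum_(1 <= i < n.+1) (c i)%:C * (h b * calP q%:C (F i) b)).
  by apply: lipC_sum => i; apply: lipCM; [exact: lipC_cst|exact: hn].
transitivity (prod (fun b =>
   \sum_(1 <= i < n.+1) (rate_right q lam i)%:C * (h b * calP q%:C (inc i lam) b)
   + \sum_(1 <= i < n.+1) (rate_left q lam i)%:C * (h b * calP q%:C (dec i lam) b)) g).
  apply: eq_torus_prod => // s; rewrite /shape_op -big_split /=.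
  by apply: eq_bigr => i _; rewrite rate_right_complex rate_left_complex.
rewrite torus_prodDl // !torus_prod_sum // /shape_op -big_split /=.
by apply: eq_bigr => i _; rewrite rate_right_complex rate_left_complex.
Qed.

Lemma prod_shape_opr g lam : lip_on_torus g ->
  prod g (fun b => shape_op q%:C n (fun mu => calP q%:C mu b) lam)
  = shape_op q%:C n (fun mu => prod g (whit mu)) lam.
Proof.
move=> hg.
have hs (c : nat -> R) (F : nat -> seq nat) :
   lip_on_torus (fun b => \sum_(1 <= i < n.+1) (c i)%:C * calP q%:C (F i) b).
  by apply: lipC_sum => i; apply: lipCM; [exact: lipC_cst|exact: lip_calP].
transitivity (prod g (fun b =>
   \sum_(1 <= i < n.+1) (rate_right q lam i)%:C * calP q%:C (inc i lam) b
   + \sum_(1 <= i < n.+1) (rate_left q lam i)%:C * calP q%:C (dec i lam) b)).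
  apply: eq_torus_prod => // s; rewrite /shape_op -big_split /=.
  by apply: eq_bigr => i _; rewrite rate_right_complex rate_left_complex.
rewrite torus_prodDr // !(torus_prod_sumr q01 _ _ (fun i => lip_calP _)) // /shape_op -big_split /=.
by apply: eq_bigr => i _; rewrite rate_right_complex rate_left_complex.
Qed.

Hypothesis ortho : forall lam mu, is_shape n lam -> is_shape n mu -> lam <> mu ->
  prod (whit lam) (whit mu) = 0.

Definition norm2 (mu : seq nat) : C := prod (whit mu) (whit mu).

Lemma prod_whit lam mu : is_shape n lam -> is_shape n mu ->
  prod (whit lam) (whit mu) = norm2 mu * ((lam == mu)%:R : R)%:C.
Proof.
move=> hl hm; have [->|/eqP h] := eqVneq lam mu; first by rewrite rmorph1 mulr1.
by rewrite ortho // rmorph0 mulr0.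
Qed.

(** Each factor [energy] is absorbed by the Pieri rule. *)
Lemma prod_energy_pow k lam mu : is_shape n lam -> is_shape n mu ->
  prod (fun b => energy b ^+ k * calP q%:C lam b) (whit mu)
  = norm2 mu * (iter k (shape_op q n) (fun nu => (nu == mu)%:R) lam)%:C.
Proof.
move=> hl hm; elim: k lam hl => [|k IH] lam hl.
  rewrite -prod_whit //; apply: eq_torus_prod => // s; by rewrite expr0 mul1r.
rewrite iterS -shape_op_complex -shape_opZ.
rewrite -(eq_shape_op q%:C (fun nu hnu => IH nu hnu) hl) -prod_shape_op; last exact: lip_calP.
  apply: eq_torus_prod => // s; rewrite shape_opZ -pieri_torus // exprSr mulrA //.
exact: lip_energy_pow.
Qed.

(** [energy] is real on the torus. *)
Lemma prod_energy_sym f g : prod (fun b => energy b * f b) g = prod f (fun b => energy b * g b).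
Proof.
rewrite /torus_prod /torus_mean.
have e s : energy (tp s) * f (tp s) * conjc (g (tp s)) = f (tp s) * conjc (energy (tp s) * g (tp s)).
  by rewrite energy_real conjc_realM; ring.
by congr (_ * (_ * (_ +i* _))); congr cube_integral; apply/funext => s; congr (_ (_ * _)); exact: e.
Qed.

(** If the norm of [lam] vanished, the left side of the symmetry relation would vanish,
    whereas the right side is the norm of [lam - e_i] times a nonzero rate. *)
Lemma norm2_step lam i : is_shape n lam -> (1 <= i <= n)%N -> (0 < crd lam i)%N ->
  rate_left q lam i != 0 -> norm2 (dec i lam) != 0 -> norm2 lam != 0.
Proof.
move=> hl hi hc hr h0; have hd := rate_left_shape hl hi hr.
apply/eqP => hN.
have := prod_energy_sym (whit (dec i lam)) (whit lam).
have -> : prod (fun b => energy b * calP q%:C (dec i lam) b) (whit lam) = 0.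
  have := prod_energy_pow 1 hd hl; rewrite hN mul0r => <-.
  by apply: eq_torus_prod => // s; rewrite expr1.
have -> : prod (whit (dec i lam)) (fun b => energy b * calP q%:C lam b)
   = norm2 (dec i lam) * (rate_left q lam i)%:C.
  transitivity (shape_op q%:C n (fun mu => prod (whit (dec i lam)) (whit mu)) lam).
    rewrite -prod_shape_opr; last exact: lip_calP.
    by apply: eq_torus_prod => // s; rewrite pieri_torus.
  transitivity (shape_op q%:C n (fun mu => norm2 (dec i lam) * ((mu == dec i lam)%:R : R)%:C) lam).
    apply: eq_shape_op => // mu hmu; have [->|/eqP h] := eqVneq mu (dec i lam).
      by rewrite rmorph1 mulr1.
    by rewrite rmorph0 mulr0 ortho // => e; case: h.
  rewrite shape_opZ shape_op_complex; congr (_ * _%:C).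
  have hi0 : (0 < i)%N by case/andP: hi.
  rewrite /shape_op (bigD1_seq i) ?iota_uniq ?mem_index_iota //= eqxx.
  rewrite (_ : (inc i lam == dec i lam) = false); last exact/eqP/inc_neq_dec.
  rewrite mulr0 add0r mulr1 big_seq_cond big1 ?addr0 // => j /andP[]; rewrite mem_index_iota => hj ji.
  have hj0 : (0 < j)%N by case/andP: hj.
  rewrite (_ : (inc j lam == dec i lam) = false); last exact/eqP/inc_neq_dec.
  rewrite (_ : (dec j lam == dec i lam) = false); last exact/eqP/dec_neq_dec.
  by rewrite !mulr0 addr0.
move/esym/eqP; rewrite mulf_eq0 (negPf h0) /=.
by rewrite -[0 in X in _ == X]/(0%:C) (inj_eq (@complexI R)) (negPf hr).
Qed.

Lemma norm2_neq0 lam : is_shape n lam -> norm2 lam != 0.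
Proof.
have [k hk] := ubnP (sumn lam); elim: k lam hk => // k IH lam hk hl.
have [->|/eqP hz] := eqVneq lam (zero_shape n).
  rewrite /norm2 (eq_torus_prod q (f' := fun=> 1) (g' := fun=> 1)).
  - exact: torus_prod_one.
  - by move=> s; rewrite calP_zero.
  by move=> s; rewrite calP_zero.
have [i hi [h1 h2]] := last_part hl hz.
have hr : rate_left q lam i != 0.
  by rewrite /rate_left h1 subn0 -(prednK h2) subr_eq0 eq_sym (q_not_root q01).
apply: (norm2_step hl hi h2 hr); apply: IH; last exact: rate_left_shape hl hi hr.
have [hs _] := hl; have := @sumn_dec lam i; rewrite hs => /(_ hi h2) e.
by rewrite -ltnS e.
Qed.

End Whittaker.

(** * Expansion of the generating function *)

Section ExponentialRemainder.
Variable R : realType.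

(** The case of a one-point system of [taylor_remainder]. *)
Lemma expR_remainder (x c : R) K : `|x| <= c ->
  `|expR x - \sum_(0 <= k < K) x ^+ k / k`!%:R| <= expR c * (c ^+ K / K`!%:R).
Proof.
move=> hx; have x0 := normr_ge0 x.
pose f (_ : unit) : R -> R := expR \o (x \*: (@id R)).
have df (s : R) : is_derive s 1 (f tt) (x * f tt s).
  have h1 : is_derive s 1 (x \*: (@id R)) (x *: 1) by apply: is_deriveZ.
  have h2 := is_derive_expR (x * s).
  have := @is_derive1_comp R expR (x \*: (@id R)) s _ _ h2 h1.
  by rewrite -[x *: 1]/(x * 1) mulr1 mulrC.
have hm k : mpow (fun _ : unit => [:: tt]) (fun _ _ => x) k tt tt = x ^+ k.
  by elim: k => //= k IH; rewrite big_seq1 IH exprS.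
have := @taylor_remainder R unit (fun=> [:: tt]) (fun _ _ => x) f tt 1 (expR c) c.
move=> /(_ _ _ _ _ _ K tt 1) h; have {h} := h.
have -> : taylor (fun=> [:: tt]) (fun _ _ => x) tt K tt 1 = \sum_(0 <= k < K) x ^+ k / k`!%:R.
  by apply: eq_bigr => k _; rewrite hm expr1n mul1r mulrC.
rewrite -[f tt 1]/(expR (x * 1)) mulr1 expr1n mul1r -mulrA; apply.
- by case=> s; exact: (derive_continuous df).
- by case=> s _; rewrite big_seq1; exact: df.
- by case; rewrite -[LHS]/(expR (x * 0)) mulr0 expR0 eqxx.
- move=> [] s /andP[s0 s1]; rewrite -[f tt s]/(expR (x * s)) ger0_norm ?expR_ge0 // ler_expR.
  apply: le_trans (ler_norm _) _; rewrite normrM (ger0_norm s0); apply: le_trans hx.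
  by rewrite ler_piMr.
- by move=> _; rewrite big_seq1.
by rewrite ler01 lexx.
Qed.

End ExponentialRemainder.

Section Generating.
Variables (R : realType) (n : nat) (q : R).
Hypothesis q01 : 0 < q < 1.
Hypothesis n_gt0 : (0 < n)%N.
Local Notation C := R[i].
Local Notation tp s := (@torus_point R n s).
Local Notation lip_on_torus := (@lip_on_torus R n).
Local Notation prod := (@torus_prod R n q).
Local Notation whit lam := (fun b : 'I_n -> C => calP q%:C lam b).
Variable t : R.

Let E (s : seq R) : R := (\sum_(l < n) 2 * cos s`_l) * t.

Lemma cexp_real (r : R) : cexp r%:C = (expR r)%:C.
Proof. by rewrite /cexp /= cos0 sin0 mulr1. Qed.

Lemma Pi_torus s : Pi_fun t (tp s) = (expR (E s))%:C.
Proof. by rewrite /Pi_fun -/(energy (tp s)) energy_real -rmorphM cexp_real. Qed.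

Let c : R := n%:R * 2 * `|t|.

Lemma E_bound s : `|E s| <= c.
Proof.
rewrite /E /c normrM ler_wpM2r //; apply: le_trans (ler_norm_sum _ _ _) _.
apply: (@le_trans _ _ (\sum_(l < n) (2 : R))); last by rewrite sumr_const card_ord mulr_natl.
by apply: ler_sum => l _; rewrite normrM normr_nat ler_piMr // cos_max.
Qed.

Lemma expR_lipschitz (x y : R) : `|x| <= c -> `|y| <= c -> `|expR x - expR y| <= expR c * `|x - y|.
Proof.
wlog xy : x y / y <= x.
  by move=> h hx hy; case: (leP y x) => [/h|/ltW /h]; [apply|rewrite distrC [`|x - y|]distrC; apply].
move=> hx hy; rewrite !ger0_norm ?subr_ge0 ?ler_expR //.
have -> : expR x - expR y = expR x * (1 - expR (y - x)).
  by rewrite mulrBr mulr1 -expRD [x + _]addrC subrK.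
have h1 : 1 - expR (y - x) <= x - y by have := expR_ge1Dx (y - x); lra.
apply: ler_pM; rewrite ?expR_ge0 // ?ler_expR.
  by rewrite subr_ge0 -expR0 ler_expR subr_le0.
exact: le_trans (ler_norm _) hx.
Qed.

Lemma lip_Pi : lip_on_torus (Pi_fun t).
Proof.
have [M hM] := @lip_energy R n.
exists (Num.max (expR c) (expR c * (M * `|t|))) => s s' hs hs'.
rewrite !Pi_torus modulus_real ger0_norm ?expR_ge0 //; split.
  by rewrite le_max ler_expR (le_trans (ler_norm _) (E_bound s)).
rewrite -rmorphB modulus_real.
apply: (@le_trans _ _ (expR c * (M * `|t|) * l1dist n s s')); last first.
  by rewrite ler_wpM2r ?l1dist_ge0 // le_max lexx orbT.
apply: le_trans (expR_lipschitz (E_bound s) (E_bound s')) _.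
rewrite -[leRHS]mulrA ler_wpM2l ?expR_ge0 // mulrAC /E -mulrBl normrM ler_wpM2r //.
by have [_] := hM s s' hs hs'; rewrite !energy_real -rmorphB modulus_real.
Qed.

Hypothesis ortho : forall lam mu, is_shape n lam -> is_shape n mu -> lam <> mu ->
  prod (whit lam) (whit mu) = 0.

(** The exponential series of [t e(b)] converges uniformly on the torus, where
    [t e(b)] is real and bounded by [2 n |t|]. *)
Theorem Pi_coefficient mu : is_shape n mu ->
  modulus_cvg (fun K => norm2 n q mu * (\sum_(0 <= k < K) t ^+ k / k`!%:R *
      iter k (shape_op q n) (fun nu => (nu == mu)%:R) (zero_shape n))%:C)
    (prod (Pi_fun t) (whit mu)).
Proof.
move=> hmu; have hz := zero_shape_is_shape n.
have nmu : lip_on_torus (whit mu) by exact: lip_calP.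
have [B B0 hB] := torus_prod_bound q01 nmu.
have c0 : 0 <= c by rewrite !mulr_ge0.
pose T K := fun b : 'I_n -> C => \sum_(0 <= k < K) (t ^+ k / k`!%:R)%:C * energy b ^+ k.
have nT K : lip_on_torus (T K).
  by apply: lipC_sum => k; apply: lipCM; [exact: lipC_cst|exact: lip_energy_pow].
have hT K : prod (T K) (whit mu) = norm2 n q mu * (\sum_(0 <= k < K) t ^+ k / k`!%:R *
      iter k (shape_op q n) (fun nu => (nu == mu)%:R) (zero_shape n))%:C.
  rewrite torus_prod_sum //; last by move=> k; exact: lip_energy_pow.
  rewrite rmorph_sum mulr_sumr; apply: eq_bigr => k _.
  rewrite [X in _ = _ * X](rmorphM (real_complex R)) [RHS]mulrCA -(prod_energy_pow q01 n_gt0 ortho k hz hmu).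
  by congr (_ * _); apply: eq_torus_prod => // s; rewrite calP_zero // mulr1.
have hd K : prod (Pi_fun t) (whit mu) - prod (T K) (whit mu) =
    prod (fun b => Pi_fun t b + (-1)%:C * T K b) (whit mu).
  rewrite torus_prodDl // ?torus_prodZl //; last first.
  - by apply: lipCM; [exact: lipC_cst|exact: nT].
  - exact: lip_Pi.
  by rewrite rmorphN1 mulN1r.
have hE : B * (expR c * exp_coeff c K) @[K --> \oo] --> (0 : R).
  rewrite -[X in _ --> X](mulr0 B) -[X in _ * X](mulr0 (expR c)).
  by apply: cvgMr; apply: cvgMr; exact: cvg_exp_coeff.
apply: (squeeze_cvgr _ (cvg_cst (0 : R)) hE); near=> K.
rewrite modulus_ge0 /= -hT hd; apply: hB.
  by apply: lipCD; [exact: lip_Pi|apply: lipCM; [exact: lipC_cst|exact: nT]].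
move=> s _; rewrite rmorphN1 mulN1r Pi_torus.
have -> : T K (tp s) = (\sum_(0 <= k < K) E s ^+ k / k`!%:R)%:C.
  rewrite /T rmorph_sum; apply: eq_bigr => k _; rewrite energy_real -rmorphXn -rmorphM; congr (_%:C).
  by rewrite /E exprMn; ring.
rewrite -rmorphB modulus_real; exact: expR_remainder (E_bound s).
Unshelve. all: end_near. Qed.

End Generating.

(** * Comparison of the two expansions *)

(** The Markov property with no earlier observation time, started at time [0]. *)
Lemma process_law (R : realType) (S : choiceType) (rate : S -> S -> R) (d : measure_display)
    (T : measurableType d) (P : probability T R) (Z : R -> T -> S) (x : S) :
  is_markov_jump_process rate P Z -> P [set w | Z 0 w = x] = 1%E ->
  exists2 p, is_transition_function rate p &
    forall t y, 0 <= t -> P [set w | Z t w = y] = (p t x y)%:E.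
Proof.
move=> [mZ _ [p hp markov]] h0; exists p => // t y t0.
have m0 := mZ 0 x (lexx 0); have mt := mZ t y t0.
have none : 'I_0 -> False by case.
have := markov 0%N (fun=> 0) (fun=> x) 0 t x y (fun i => False_ind _ (none i)) (lexx 0) t0.
rewrite add0r.
have -> : [set w | (forall i : 'I_0, Z 0 w = x) /\ Z 0 w = x] = [set w | Z 0 w = x].
  by apply/seteqP; split=> [w /= []|w /= h] //; split=> // -[].
have -> : [set w | [/\ forall i : 'I_0, Z 0 w = x, Z 0 w = x & Z t w = y]]
    = [set w | Z t w = y] `&` [set w | Z 0 w = x].
  by apply/seteqP; split=> [w /= [_ h1 h2]|w /= [h1 h2]]; split=> // -[].
rewrite h0 mul1e => <-.
have null : P ([set w | Z t w = y] `\` [set w | Z 0 w = x]) = 0%E.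
  apply/eqP; rewrite eq_le measure_ge0 andbT.
  have hc : P (~` [set w | Z 0 w = x]) = 0%E by rewrite probability_setC // h0 subee.
  rewrite -[leRHS]hc.
  apply: le_measure; rewrite ?inE; [exact: measurableD|exact: measurableC|].
  by move=> w [].
rewrite -[RHS]add0e -[X in (X + _)%E]null; exact: measureDI.
Qed.

Section Corollary.
Variables (R : realType) (n : nat) (q : R) (a : 'I_n -> R).
Hypothesis n_gt0 : (0 < n)%N.
Hypothesis q01 : 0 < q < 1.
Hypothesis a_gt0 : forall i, 0 < a i.
Local Notation C := R[i].

Lemma orthogonality : hypothesis_C q -> forall lam mu, is_shape n lam -> is_shape n mu -> lam <> mu ->
  @torus_prod R n q (calP q%:C lam) (calP q%:C mu) = 0.
Proof.
move=> hC lam mu [hs hso] [hs' hso'] hne.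
have [P hP hcalP] := hC n n_gt0.
pose l : n.-tuple nat := Tuple (introT eqP hs); pose m : n.-tuple nat := Tuple (introT eqP hs').
have h : l <> m by move=> /(congr1 (@tval n nat)).
rewrite -(whittaker_orthogonal hP q01 (lam := l) (mu := m) hso hso' h).
apply: eq_torus_prod => s; [apply: (hcalP l)|apply: (hcalP m)] => //;
  by move=> j; rewrite torus_pointE cis_neq0.
Qed.

Lemma law_of_dynamics (rate : pattern n -> pattern n -> R) A B (d : measure_display)
    (T : measurableType d) (P : probability T R) (Z : R -> T -> pattern n) :
  dynamics q a rate A B -> is_markov_jump_process rate P Z ->
  P [set w | forall k i, entry (val (Z 0 w)) k i = 0%N] = 1%E ->
  hypothesis_C q ->
  forall (t : R) (z : pattern n), 0 <= t ->
    (fine (P [set w | Z t w = z]))%:C =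
    (weight a q (val z))%:C * @Q_fun R n q t (level (val z) n.*2)
      / Pi_fun t (fun i => (a i)%:C).
Proof.
move=> hdyn hZ h0 hC t z t0.
have ortho := orthogonality hC.
have e0 : [set w | forall k i, entry (val (Z 0 w)) k i = 0%N] = [set w | Z 0 w = origin n].
  by apply/seteqP; split=> w /originP.
rewrite e0 in h0; have [p hp law] := process_law hZ h0.
rewrite law //=; set mu := level (val z) n.*2.
have hmu : is_shape n mu by exact: pattern_shape_last.
have w0 : weight a q (val z) != 0 by rewrite gt_eqF // weight_gt0.
pose S K := \sum_(0 <= k < K) t ^+ k / k`!%:R *
   iter k (shape_op q n) (fun nu => (nu == mu)%:R) (zero_shape n).
pose l := expR (total_rate a * t) * p t (origin n) z / weight a q (val z).
have cvgS : S K @[K --> \oo] --> l.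
  have h := @origin_transition R q n a q01 n_gt0 a_gt0 _ _ _ hdyn p z t hp t0.
  have -> : S = (fun K => (weight a q (val z))^-1 * (\sum_(0 <= k < K) t ^+ k / k`!%:R * (weight a q (val z) *
      iter k (shape_op q n) (fun nu => (nu == mu)%:R) (zero_shape n)))).
    apply/funext => K; rewrite mulr_sumr; apply: eq_bigr => k _.
    by rewrite [t ^+ k / _ * (_ * _)]mulrCA mulKf.
  by rewrite /l mulrC; apply: cvgMr; exact: h.
have N0 := norm2_neq0 q01 n_gt0 ortho hmu.
have eQ : Q_fun n q t mu = l%:C.
  rewrite /Q_fun -/(norm2 n q mu).
  suff -> : torus_prod q (@Pi_fun R n t) (calP q%:C mu) = norm2 n q mu * l%:C by rewrite mulrC mulKf.
  have h1 := Pi_coefficient q01 n_gt0 t ortho hmu.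
  apply: (modulus_cvg_unique h1).
  have h2 : modulus (norm2 n q mu) * `|l - S K| @[K --> \oo] --> (0 : R).
    rewrite -[X in _ --> X](mulr0 (modulus (norm2 n q mu))); apply: cvgMr.
    rewrite -[X in _ --> X](@normr0 _ R) -(subrr l); apply: cvg_norm; apply: cvgB; last exact: cvgS.
    exact: cvg_cst.
  rewrite /modulus_cvg.
  suff -> : (fun K => modulus (norm2 n q mu * l%:C - norm2 n q mu * (S K)%:C)) =
    (fun K => modulus (norm2 n q mu) * `|l - S K|) by [].
  by apply/funext => K; rewrite -mulrBr modulusM -(rmorphB (real_complex R)) modulus_real.
have ePi : Pi_fun t (fun i => (a i)%:C) = (expR (total_rate a * t))%:C.
  have e1 : \sum_(i < n) ((a i)%:C + (a i)%:C^-1) = (total_rate a)%:C :> C.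
    rewrite /total_rate (rmorph_sum (real_complex R)); apply: eq_bigr => i _.
    by rewrite (rmorphD (real_complex R)) (fmorphV (real_complex R)).
  by rewrite /Pi_fun e1 -(rmorphM (real_complex R)) cexp_real.
rewrite eQ ePi -(fmorphV (real_complex R)) -!(rmorphM (real_complex R)); congr (_%:C).
have h1 : expR (total_rate a * t) != 0 by rewrite gt_eqF // expR_gt0.
rewrite /l; move: w0 h1; move: (weight a q _) (expR _) => w E w0 E0.
by field; rewrite w0 E0.
Unshelve. all: end_near. Qed.

End Corollary.

Theorem corollary6p0p3 (R : realType) (n : nat) (q : R) (a : 'I_n -> R)
    (d : measure_display) (T : measurableType d) (P : probability T R)
    (Z : R -> T -> pattern n) :
  (1 <= n)%N -> 0 < q < 1 -> (forall i, 0 < a i) ->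
  is_markov_jump_process (@berele_rate R q n a) P Z \/
    is_markov_jump_process (@randomised_rate R q n a) P Z ->
  P [set w | forall k i, entry (val (Z 0 w)) k i = 0%N] = 1%E ->
  hypothesis_C q ->
  forall (t : R) (z : pattern n), 0 <= t ->
    (fine (P [set w | Z t w = z]))%:C =
    (weight a q (val z))%:C * @Q_fun R n q t (level (val z) n.*2)
      / Pi_fun t (fun i => (a i)%:C).
Proof.
move=> n_gt0 q01 a_gt0 [hZ|hZ] h0 hC t z t0.
  exact: (law_of_dynamics n_gt0 q01 a_gt0 (berele_dynamics q01 n_gt0 a_gt0) hZ h0 hC).
exact: (law_of_dynamics n_gt0 q01 a_gt0 (rand_dynamics q01 n_gt0 a_gt0) hZ h0 hC).
Qed.
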